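(* Let $\mathcal{M}\subset\mathbb{R}^{n+k}$ be an embedded $n$-dimensional submanifold with the induced metric, and let $p\in\mathcal{M}$. As $\varepsilon\to0$, the $n$-dimensional volume of the spherical component $D_p(\varepsilon)$ is $$V(D_p(\varepsilon))=V_n(\varepsilon)\left[1+\frac{\varepsilon^2}{8(n+2)}\,\big(2\,\mathrm{tr}\,\mathbf{III}-\|\mathbf H\|^2\big)+\mathcal{O}(\varepsilon^3)\right],$$ where $2\,\mathrm{tr}\,\mathbf{III}-\|\mathbf H\|^2=\|\mathbf H\|^2-2\mathcal R$.
   Context: $V_n(\varepsilon)=\pi^{n/2}\varepsilon^n/\Gamma(\tfrac n2+1)$ is the volume of the ball of radius $\varepsilon$ in $\mathbb{R}^n$. The spherical component is $D_p(\varepsilon)=\mathcal{M}\cap\{q\in\mathbb{R}^{n+k}:\|q-p\|\le\varepsilon\}$ and $V(\cdot)$ is its volume for the induced Riemannian measure. $\mathbf{II}$ is the (normal-space valued) second fundamental form, $\{\mathbf e_\mu\}$ any orthonormal basis of $T_p\mathcal{M}$, $\mathbf H=\sum_\mu\mathbf{II}(\mathbf e_\mu,\mathbf e_\mu)$ the mean curvature vector at $p$ (no factor $1/n$), $\mathcal R$ the scalar curvature of $\mathcal{M}$ at $p$ (trace of the Ricci tensor, positive for round spheres of dimension at least 2). The third fundamental form is $\langle\mathbf{III}(\mathbf x,\mathbf y)\mathbf n,\mathbf m\rangle=\langle\hat{\mathbf S}_{\mathbf m}\mathbf x,\hat{\mathbf S}_{\mathbf n}\mathbf y\rangle$, where the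 Weingarten map satisfies $\langle\hat{\mathbf S}_{\mathbf n}\mathbf x,\mathbf y\rangle=\langle\mathbf{II}(\mathbf x,\mathbf y),\mathbf n\rangle$; its total trace (over orthonormal bases of $T_p\mathcal{M}$ and of $N_p\mathcal{M}$) is $\mathrm{tr}\,\mathbf{III}=\sum_{\alpha,\beta}\|\mathbf{II}(\mathbf e_\alpha,\mathbf e_\beta)\|^2$. Throughout one works inside a sufficiently small neighborhood of $p$ in $\mathbb{R}^{n+k}$ in which $\mathcal{M}$ is the graph of a smooth map $\mathbf f:T_p\mathcal{M}\to N_p\mathcal{M}$ with $p$ at the origin, $\mathbf f(\mathbf 0)=\mathbf 0$, $\nabla\mathbf f(\mathbf 0)=\mathbf 0$. *)

(* Defs.v *)
From HB Require Import structures.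
From mathcomp Require Import all_boot all_order all_algebra.
From mathcomp Require Import all_classical all_reals all_analysis.
Set Implicit Arguments.
Unset Strict Implicit.
Unset Printing Implicit Defensive.
Import Order.TTheory GRing.Theory Num.Theory.
Import numFieldNormedType.Exports.
Local Open Scope classical_set_scope.
Local Open Scope ring_scope.

(* The norm that the library puts on 'rV[R]_m is the sup norm, so the
   Euclidean structure of R^m is introduced separately; both norms have the
   same topology and the same differentiable maps. *)
Section Euclidean.
Context {R : realType} {m : nat}.
Implicit Types x y : 'rV[R]_m.

Definition dotp x y : R := (x *m y^T) 0 0.
Definition enorm x : R := Num.sqrt (dotp x x).

End Euclidean.

(* The sigma-algebra generated by the coordinates, i.e. the product of the
   Borel sigma-algebras of R; on R^n this is the Borel sigma-algebra. *)
Section MeasurableMatrix.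
Context {R : realType} {m n : nat}.

Definition coordinate_cylinders : set (set 'M[R]_(m, n)) :=
  [set A | exists i j, exists2 B : set (measurableTypeR R),
    measurable B & A = (fun M : 'M[R]_(m, n) => M i j) @^-1` B].

Let mx_set0 : <<s coordinate_cylinders >> set0.
Proof. exact: sigma_algebra0. Qed.

Let mx_setC A : <<s coordinate_cylinders >> A ->
  <<s coordinate_cylinders >> (~` A).
Proof. exact: sigma_algebraC. Qed.

Let mx_bigcup (F : (set 'M[R]_(m, n))^nat) :
  (forall i, <<s coordinate_cylinders >> (F i)) ->
  <<s coordinate_cylinders >> (\bigcup_i (F i)).
Proof. exact: sigma_algebra_bigcup. Qed.

HB.instance Definition _ := @isMeasurable.Build default_measure_display
  'M[R]_(m, n) <<s coordinate_cylinders >> mx_set0 mx_setC mx_bigcup.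

End MeasurableMatrix.

Section LebesgueRV.
Context {R : realType}.

Lemma measurable_rV_coord n i j :
  measurable_fun setT (fun v : 'rV[R]_n => v i j : measurableTypeR R).
Proof.
by move=> _ B mB; rewrite setTI; apply: sub_sigma_algebra; exists i, j, B.
Qed.

Lemma measurable_fun_rV d (T : measurableType d) n (f : T -> 'rV[R]_n) :
  (forall j, measurable_fun setT (fun x => f x 0 j : measurableTypeR R)) ->
  measurable_fun setT f.
Proof.
move=> mf; apply: (@measurability _ _ _ _ _ _ coordinate_cylinders) => //.
by move=> _ [_ [i [j [B mB ->]]] <-]; rewrite (ord1 i); exact: mf.
Qed.

Definition cons_rV {n : nat} (xy : measurableTypeR R * 'rV[R]_n) :
    'rV[R]_n.+1 :=
  \row_j oapp (fun k => xy.2 0 k) (xy.1 : R) (unlift ord0 j).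

Definition uncons_rV {n : nat} (v : 'rV[R]_n.+1) :
    measurableTypeR R * 'rV[R]_n :=
  (v 0 ord0, \row_k v 0 (lift ord0 k)).

Lemma cons_rVK n : cancel (@cons_rV n) uncons_rV.
Proof.
move=> [x y]; rewrite /uncons_rV /cons_rV mxE unlift_none/=; congr (_, _).
by apply/rowP => k; rewrite !mxE liftK.
Qed.

Lemma measurable_cons_rV n : measurable_fun setT (@cons_rV n).
Proof.
apply: measurable_fun_rV => j; case: (unliftP ord0 j) => [k|] ->.
- rewrite (_ : (fun x => _) = (fun v : 'rV[R]_n => v 0 k) \o snd).
    by apply: measurableT_comp => //; exact: measurable_rV_coord.
  by apply/funext => x; rewrite /cons_rV mxE liftK.
- rewrite (_ : (fun x => _) = fst)//.
  by apply/funext => x; rewrite /cons_rV mxE unlift_none.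
Qed.

Lemma measurable_uncons_rV n : measurable_fun setT (@uncons_rV n).
Proof.
apply/measurable_fun_pairP; split; first exact: measurable_rV_coord.
apply: measurable_fun_rV => k.
rewrite (_ : (fun x => _) = (fun v : 'rV[R]_n.+1 => v 0 (lift ord0 k))).
  exact: measurable_rV_coord.
by apply/funext => v; rewrite /= mxE.
Qed.

Section Step.
Context {n : nat} (mu : {sigma_finite_measure set 'rV[R]_n -> \bar R}).

Definition lebesgue_step : set 'rV[R]_n.+1 -> \bar R :=
  pushforward (@lebesgue_measure R \x mu)%E (@cons_rV n).

Let lebesgue_step0 : lebesgue_step set0 = 0%E.
Proof. by rewrite /lebesgue_step /pushforward preimage_set0 measure0. Qed.

Let lebesgue_step_ge0 A : (0 <= lebesgue_step A)%E.
Proof. by rewrite /lebesgue_step /pushforward measure_ge0. Qed.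

Let lebesgue_step_sigma_additive : semi_sigma_additive lebesgue_step.
Proof.
move=> F mF tF mUF; rewrite /lebesgue_step /pushforward preimage_bigcup.
apply: measure_semi_sigma_additive.
- by move=> i; rewrite -[X in measurable X]setTI; exact: measurable_cons_rV.
- apply/trivIsetP => /= i j _ _ ij; rewrite -preimage_setI.
  by move/trivIsetP : tF => /(_ _ _ _ _ ij) ->//; rewrite preimage_set0.
- rewrite -preimage_bigcup -[X in measurable X]setTI.
  exact: measurable_cons_rV.
Qed.

HB.instance Definition _ := isMeasure.Build _ _ _ lebesgue_step
  lebesgue_step0 lebesgue_step_ge0 lebesgue_step_sigma_additive.

Let lebesgue_step_sigma_finite : sigma_finite setT lebesgue_step.
Proof.
have /sigma_finiteP[F [TF ndF mF]] := sigma_finiteT (@lebesgue_measure R).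
have /sigma_finiteP[G [TG ndG mG]] := sigma_finiteT mu.
exists (fun i => uncons_rV @^-1` (F i `*` G i)).
  rewrite -preimage_bigcup (_ : \bigcup_i _ = setT) ?preimage_setT//.
  apply/seteqP; split=> // -[x y] _.
  have [i _ Fx] : (\bigcup_i F i) x by rewrite -TF.
  have [j _ Gy] : (\bigcup_i G i) y by rewrite -TG.
  exists (maxn i j) => //; split.
    by move: x Fx; exact/subsetPset/ndF/leq_maxl.
  by move: y Gy; exact/subsetPset/ndG/leq_maxr.
move=> i; have [mFi Fioo] := mF i; have [mGi Gioo] := mG i; split.
  rewrite -[X in measurable X]setTI; apply: measurable_uncons_rV => //.
  exact: measurableX.
rewrite /lebesgue_step /pushforward -comp_preimage.
rewrite (_ : uncons_rV \o _ = id); last by apply/funext; exact: cons_rVK.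
by rewrite product_measure1E// lte_mul_pinfty// ge0_fin_numE.
Qed.

HB.instance Definition _ := @Measure_isSigmaFinite.Build _ _ _ lebesgue_step
  lebesgue_step_sigma_finite.

End Step.

(* Lebesgue measure on R^n: the n-fold product of the Lebesgue measure of R
   (the Dirac mass on the one-point space R^0). *)
Fixpoint lebesgue_rV (n : nat) :
    {sigma_finite_measure set 'rV[R]_n -> \bar R} :=
  match n with
  | 0 => \d_(0 : 'rV[R]_0)
  | m.+1 => lebesgue_step (lebesgue_rV m)
  end.

End LebesgueRV.

Section SmoothMaps.
Context {R : realType} {n m : nat}.
Implicit Types (W : set 'rV[R]_n) (h : 'rV[R]_n -> 'rV[R]_m).

Definition basis_rV (i : 'I_n) : 'rV[R]_n := delta_mx 0 i.

Definition iter_partial (s : seq 'I_n) h : 'rV[R]_n -> 'rV[R]_m :=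
  foldr (fun i g => fun x => 'D_(basis_rV i) g x) h s.

(* C^infinity on an open set W: every iterated partial derivative exists and
   is differentiable (in particular continuous) at every point of W. *)
Definition smooth_on W h : Prop :=
  forall (s : seq 'I_n) x, W x -> differentiable (iter_partial s h) x.

End SmoothMaps.

(* Local differential geometry of an immersion psi : R^n -> R^m at the
   parameter u.  Vectors are rows, so row i of 'J psi u is the coordinate
   vector d_i psi(u), and the tangent space is the row space of 'J psi u. *)
Section Immersion.
Context {R : realType} {n m : nat} (psi : 'rV[R]_n -> 'rV[R]_m).
Implicit Types (u : 'rV[R]_n) (x y v nu mu : 'rV[R]_m).

Definition metric u : 'M[R]_n := 'J psi u *m ('J psi u)^T.

Definition volume_density u : R := Num.sqrt (\det (metric u)).

(* The coordinates a of the tangential part of v, i.e. of the tangent vector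
   a *m 'J psi u. *)
Definition coords u v : 'rV[R]_n := v *m ('J psi u)^T *m invmx (metric u).

Definition normal_part u v : 'rV[R]_m := v - coords u v *m 'J psi u.

(* II(x, y) is the normal part of the derivative in the direction x of the
   tangent field which extends y with constant coordinates. *)
Definition second_form u x y : 'rV[R]_m :=
  normal_part u ('D_(coords u x) (fun w => 'D_(coords u y) psi w) u).

(* Below, the rows of E are an orthonormal basis of the tangent space at u and
   the rows of N an orthonormal basis of the normal space. *)
Definition mean_curvature u (E : 'M[R]_(n, m)) : 'rV[R]_m :=
  \sum_i second_form u (row i E) (row i E).

(* The tangent vector S_nu x with <S_nu x, y> = <II(x, y), nu> for all tangent
   vectors y, expanded on the basis E. *)
Definition weingarten u (E : 'M[R]_(n, m)) nu x : 'rV[R]_m :=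
  \sum_i dotp (second_form u x (row i E)) nu *: row i E.

(* <III(x, y) nu, mu> *)
Definition third_form u (E : 'M[R]_(n, m)) x y nu mu : R :=
  dotp (weingarten u E mu x) (weingarten u E nu y).

Definition trace_third_form u (k : nat) (E : 'M[R]_(n, m))
    (N : 'M[R]_(k, m)) : R :=
  \sum_i \sum_j third_form u E (row i E) (row i E) (row j N) (row j N).

End Immersion.

(* Levi-Civita curvature of a Riemannian metric g on an open subset of R^n. *)
Section Curvature.
Context {R : realType} {n : nat} (g : 'rV[R]_n -> 'M[R]_n).
Implicit Types (u : 'rV[R]_n) (i j k l : 'I_n).

Definition pd i (h : 'rV[R]_n -> R) u : R := 'D_(basis_rV i) h u.

(* Gamma^k_ij *)
Definition christoffel k i j u : R :=
  2^-1 * \sum_l invmx (g u) k l *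
    (pd i (fun w => g w j l) u + pd j (fun w => g w i l) u
     - pd l (fun w => g w i j) u).

(* The component on d_l of R(d_i, d_j) d_k, where
   R(X, Y) = [nabla_X, nabla_Y] - nabla_[X, Y]. *)
Definition riemann l k i j u : R :=
  pd i (christoffel l j k) u - pd j (christoffel l i k) u
  + \sum_r (christoffel l i r u * christoffel r j k u
            - christoffel l j r u * christoffel r i k u).

(* Ric(Y, Z) = tr (X |-> R(X, Y) Z), positive on round spheres. *)
Definition ricci j k u : R := \sum_i riemann i k i j u.

Definition scalar_curvature u : R :=
  \sum_j \sum_k invmx (g u) j k * ricci j k u.

End Curvature.

Section Submanifold.
Context {R : realType} {n m : nat}.
Implicit Types (M : set 'rV[R]_m) (W : set 'rV[R]_n)
  (psi : 'rV[R]_n -> 'rV[R]_m).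

(* A smooth injective immersion of the open set W which is a homeomorphism onto
   an open subset of M (for the topology induced by R^m). *)
Definition local_parametrization M W psi : Prop :=
  [/\ open W, smooth_on W psi,
      (forall u, W u -> row_free ('J psi u)),
      (forall u v, W u -> W v -> psi u = psi v -> u = v) &
      (forall W', open W' -> W' `<=` W ->
         exists2 U : set 'rV[R]_m, open U & psi @` W' = M `&` U)].

Definition embedded_submanifold M : Prop :=
  forall p, M p -> exists W psi,
    local_parametrization M W psi /\ (psi @` W) p.

(* The Riemannian measure of M for the induced metric, as a Borel measure of
   R^m carried by M: in every local parametrization its density is the square
   root of the Gram determinant.  The parametrizations cover M, so this
   determines the measure. *)
Definition riemannian_measure M (vol : {measure set 'rV[R]_m -> \bar R}) :
    Prop :=
  vol (~` M) = 0%E /\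
  forall W psi, local_parametrization M W psi ->
  forall A, measurable A -> A `<=` W ->
    vol (psi @` A) =
      (\int[lebesgue_rV n]_(u in A) (volume_density psi u)%:E)%E.

End Submanifold.
Arguments embedded_submanifold {R} n {m} M.
Arguments riemannian_measure {R} n {m} M vol.

Section GraphCoordinates.
Context {R : realType} {n k : nat}.
Implicit Types (M : set 'rV[R]_(n + k)) (p : 'rV[R]_(n + k))
  (E : 'M[R]_(n, n + k)) (N : 'M[R]_(k, n + k)) (f : 'rV[R]_n -> 'rV[R]_k).

Definition graph_map p E N f (x : 'rV[R]_n) : 'rV[R]_(n + k) :=
  p + x *m E + f x *m N.

(* Near p, M is the graph of a smooth map f : T_pM -> N_pM with p at the
   origin, f(0) = 0 and f'(0) = 0; the rows of E and of N are orthonormal bases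
   of T_pM and of N_pM, in which the arguments and the values of f are
   expressed. *)
Definition graph_coordinates M p E N f : Prop :=
  [/\ E *m E^T = 1%:M, N *m N^T = 1%:M, E *m N^T = 0,
      f 0 = 0 /\ 'J f 0 = 0 &
      exists (B : set 'rV[R]_n) (U : set 'rV[R]_(n + k)),
        [/\ open B, B 0, open U & U p] /\
        smooth_on B f /\ M `&` U = graph_map p E N f @` B].

Definition spherical_component M p (eps : R) : set 'rV[R]_(n + k) :=
  M `&` [set q | enorm (q - p) <= eps].

End GraphCoordinates.

Section BallVolume.
Context {R : realType}.

Definition Gamma (z : R) : R :=
  \int[@lebesgue_measure R]_(t in `]0, +oo[) (t `^ (z - 1) * expR (- t)).

Definition ball_volume (n : nat) (eps : R) : R :=
  pi `^ (n%:R / 2) * eps ^+ n / Gamma (n%:R / 2 + 1).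

End BallVolume.

(* Main.v *)
(** In the graph chart [phi] over the tangent space the ball [D_p(eps)] is the set of
    [x] with [|x|^2 + |f x|^2 <= eps^2].  Let [q4] be the quartic form which is the
    leading term of [|f x|^2], and let [1 + q2 / 2] be the second order expansion of
    the volume density, where [q2] is the squared norm of the linearized Jacobian of
    [f].  With [Phi x = |x|^2 + eps^2 * q4 x / |x|^2], which is homogeneous of degree
    2, the identity
      [Phi - eps^2 = (|x|^2 + q4 - eps^2) * (1 - q4 / |x|^2) + (q4 / |x|^2) * q4]
    squeezes the ball between the sets [Phi <= (eps * (1 -+ L * eps^3))^2].  By
    homogeneity and the layer cake formula, the integrals of [1] and of [q2] over such
    sets are Gaussian integrals divided by values of Gamma; the expansion to first
    order in [eps^2] then only involves the Gaussian moments of [q2] and [q4], which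
    Wick's formula expresses by [tr III] and [|H|^2].  The second identity is the
    traced Gauss equation, read off from the first derivatives of the Christoffel
    symbols at the origin, where the metric is the identity to first order. *)
Require Import Defs.
From mathcomp Require Import all_boot all_order all_algebra all_fingroup.
From mathcomp Require Import all_classical all_reals all_analysis.
From mathcomp Require Import measurable_realfun ring lra.
Set Implicit Arguments.
Unset Strict Implicit.
Unset Printing Implicit Defensive.
Import Order.TTheory GRing.Theory Num.Theory.
Import numFieldNormedType.Exports.
Local Open Scope classical_set_scope.
Local Open Scope ring_scope.

(** * Layer cake formula and Gamma integrals *)

(** The function [|x|^2 + q4 x] mixes the degrees 2 and 4, so its sublevel sets do not scale. Near
    the boundary of the ball [|x|] is close to [eps], which allows trading [q4 x] for
    [eps^2 * q4 x / |x|^2]. With [t = eps^2] frozen as a parameter, dilations bring every sublevel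
    set of [Phi] back to level 1; apart from them only reflections of coordinates are used as
    changes of variables in [R^n]. The Gaussian weight takes the place of polar coordinates: radial
    integrals turn into the functional equation of Gamma, uniformly in [n], including [n = 0]. What
    remains are means for the normalized density of [exp (- |y|^2)], whose coordinates have variance
    1/2, and the expansion in [t] follows from elementary bounds on the exponential. The relative
    error [eps^3] of the radius is [|f x|^2 - q4 x = O(|x|^5)] measured against [eps^2]; the
    expansion of the volume density has an error of the same order. *)

Section LayerCake.
Context {R : realType} d (T : measurableType d)
  (m : {sigma_finite_measure set T -> \bar R}).
Variables (g Phi : T -> R) (om : measurableTypeR R -> R).
Hypothesis mg : measurable_fun setT g.
Hypothesis mPhi : measurable_fun setT Phi.
Hypothesis mom : measurable_fun setT om.
Hypothesis g0 : forall y, 0 <= g y.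
Hypothesis om0 : forall u, 0 <= om u.
Notation mu := (@lebesgue_measure R).

Let F : T * measurableTypeR R -> \bar R :=
  (fun z => (g z.1 * om z.2)%:E) \_ [set z | Phi z.1 <= z.2].

Let mF : measurable_fun [set: T * measurableTypeR R] F.
Proof.
rewrite /F; apply/(measurable_restrictT _ _).1.
  rewrite -[X in measurable X]setTI.
  apply: (measurable_fun_ler (D := setT)
     (f := fun z : T * measurableTypeR R => Phi z.1) (g := snd)) => //.
  by apply: measurableT_comp.
apply/measurable_EFinP; apply: measurable_funM.
- by apply: measurable_funTS; apply: measurableT_comp.
- by apply: measurable_funTS; apply: measurableT_comp.
Qed.

Let F0 z : (0 <= F z)%E.
Proof.
by rewrite /F patchE; case: ifPn => // _; rewrite lee_fin mulr_ge0.
Qed.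

(** Tonelli on the region [Phi y <= u]. For [om u = expR (- u)] the inner integral on the left is
    [expR (- Phi y)], so integrals over sublevel sets are traded for one over the whole space. *)
Lemma layer_cake :
  (\int[m]_y \int[mu]_(u in `[Phi y, +oo[) (g y * om u)%:E =
   \int[mu]_u \int[m]_(y in [set y | (Phi y <= u)%R]) (g y * om u)%:E)%E.
Proof.
transitivity (\int[m]_y \int[mu]_u F (y, u))%E.
  apply: eq_integral => y _; rewrite integral_mkcond; apply: eq_integral => u _.
  rewrite /F !patchE /= !mem_setE ?in_itv/= ?andbT.
  by [].
rewrite (fubini_tonelli (m1 := m) (m2 := mu))//.
apply: eq_integral => u _; rewrite [RHS]integral_mkcond.
by apply: eq_integral => y _; rewrite /F !patchE /=.
Qed.

Lemma measurable_layer_cake :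
  measurable_fun setT (fun u : measurableTypeR R => \int[m]_(y in [set y | (Phi y <= u)%R]) (g y * om u)%:E)%E.
Proof.
rewrite (_ : (fun _ => _) = fubini_G m F).
  by apply: measurable_fun_fubini_tonelli_G.
apply/funext => u; rewrite /fubini_G [LHS]integral_mkcond.
by apply: eq_integral => y _; rewrite /F !patchE /=.
Qed.

End LayerCake.

Section Line.
Context {R : realType}.
Notation mu := (@lebesgue_measure R).
Notation GR := (measurableTypeR R).
Implicit Types c a : R.

Lemma preimage_scale_ocitv c a b : c != 0 ->
  (fun x : R => c * x) @^-1` `]a, b] =
  if 0 < c then `]a / c, b / c]%classic else `[b / c, a / c[%classic.
Proof.
move=> c0; have [cp|cn] := ltP 0 c; apply/seteqP; split=> x /=; rewrite !in_itv/=.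
- by rewrite ltr_pdivrMr// ler_pdivlMr// !(mulrC x).
- by rewrite ltr_pdivrMr// ler_pdivlMr// !(mulrC x).
- have {}cn : c < 0 by rewrite lt_neqAle c0.
  by rewrite ler_ndivrMr// ltr_ndivlMr// !(mulrC x) andbC.
- have {}cn : c < 0 by rewrite lt_neqAle c0.
  by rewrite ler_ndivrMr// ltr_ndivlMr// !(mulrC x) andbC.
Qed.

(** By uniqueness of Lebesgue measure: [|c|] times its image under multiplication by [c] has the
    right value on the intervals []a, b]]. *)
Lemma ge0_integral_lebesgue_scale c (F : GR -> \bar R) : c != 0 ->
  measurable_fun setT F -> (forall x, 0 <= F x)%E ->
  (\int[mu]_x F (c * x)%R = (`|c|^-1)%:E * \int[mu]_x F x)%E.
Proof.
move=> c0 mF F0.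
have mc : measurable_fun setT ((fun x => c * x) : GR -> GR).
  exact: mulrl_measurable.
pose f : GR -> GR := fun x => c * x.
have cp : 0 <= `|c| by [].
have E : forall A : set GR, measurable A -> mu A = mscale (NngNum cp) (pushforward mu f) A.
  move=> mm; apply: lebesgue_measure_unique => _ [[a b] _ <-].
  transitivity (`|c|%:E * mu ((fun x : R => c * x)%R @^-1` `]a, b]))%E; last by [].
  rewrite (preimage_scale_ocitv _ _ c0) /=.
  have [cpos|cneg0] := ltP 0 c.
    rewrite !lebesgue_measure_itv/= !lte_fin ltr_pM2r ?invr_gt0//.
    case: ifPn => _; last by rewrite mule0.
    rewrite -!EFinD -EFinM; congr (_%:E); rewrite gtr0_norm//; by field.
  have cneg : c < 0 by rewrite lt_neqAle c0 cneg0.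
  rewrite !lebesgue_measure_itv/= !lte_fin ltr_nM2r ?invr_lt0//.
  case: ifPn => _; last by rewrite mule0.
  rewrite -!EFinD -EFinM; congr (_%:E); rewrite ltr0_norm//; by field.
rewrite [in RHS](eq_measure_integral (mscale (NngNum cp) (pushforward mu f))); last first.
  by move=> A mA _; exact: E.
rewrite [in RHS]ge0_integral_mscale//=.
rewrite [in RHS]ge0_integral_pushforward//=.
rewrite muleA -EFinM.
by rewrite mulVf ?normr_eq0// mul1e.
Qed.

(* The value in [\bar R] of the integral defining [Gamma (a + 1)]. *)
Definition egamma a : \bar R :=
  \int[mu]_(t in `]0, +oo[) (t `^ a * expR (- t))%:E.

Lemma measurable_powR_mulexpN a : measurable_fun setT (fun t : R => t `^ a * expR (- t)).
Proof.
apply: measurable_funM; first exact: measurable_powR.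
by apply: measurableT_comp => //; exact: oppr_measurable.
Qed.

Lemma integral_expN_ray a :
  (\int[mu]_(t in `[a, +oo[) (expR (- t))%:E = (expR (- a))%:E)%E.
Proof.
rewrite (ge0_continuous_FTC2y (F := fun t => - expR (- t)) (l := 0)).
- by rewrite sub0e -EFinN opprK.
- by move=> x _; exact: expR_ge0.
- apply: continuous_subspaceT => x.
  by apply: continuous_comp; [exact: opp_continuous|exact: continuous_expR].
- by rewrite -oppr0; apply: cvgN; exact: cvgr_expR.
- move=> x _; apply: derivableN; apply/derivable1_diffP.
  by apply: differentiable_comp => //; exact/derivable1_diffP.
- apply: cvgN; apply: cvg_at_right_filter.
  by apply: continuous_comp; [exact: opp_continuous|exact: continuous_expR].
- move=> x _; rewrite derive1E.
  have D := @is_derive1_comp R expR -%R x _ _ (is_derive_expR _) (is_deriveNid x 1).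
  have := @is_deriveN _ _ _ _ _ _ _ D.
  by move=> [_ ->]; rewrite mulrN1 opprK.
Qed.

Lemma integral_mulexpN_ray a : 0 <= a ->
  (\int[mu]_(t in `[a, +oo[) (t * expR (- t))%:E = ((a + 1) * expR (- a))%:E)%E.
Proof.
(* The primitive of the integrand is [- F], where [F x = (x + 1) * expR (- x)]. *)
move=> a0; pose F : R -> R := ((id : R -> R) + cst (1 : R)) * (fun t => expR (- t)).
have DF (x : R) : is_derive x 1 F (- (x * expR (- x))).
  have D1 := @is_derive1_comp R expR -%R x _ _ (is_derive_expR _) (is_deriveNid x 1).
  have D2 : is_derive x 1 ((id : R -> R) + cst (1 : R)) 1.
    by rewrite -[X in is_derive _ _ _ X]addr0; apply: is_deriveD.
  have D := @is_deriveM _ _ _ _ _ _ _ _ D2 D1.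
  apply: (is_derive_eq D); rewrite /= /GRing.scale/=.
  rewrite -[(id + _) x]/(x + 1); ring.
rewrite (ge0_continuous_FTC2y (F := - F) (l := 0)).
- by rewrite sub0e -EFinN opprK.
- by move=> x ax; rewrite mulr_ge0 ?expR_ge0//; exact: le_trans ax.
- apply: continuous_subspaceT => x.
  apply: (@continuousM _ _ id (fun t => expR (- t))); first exact: cvg_id.
  by apply: continuous_comp; [exact: opp_continuous|exact: continuous_expR].
- rewrite -oppr0; apply: cvgN.
  (* Decay at infinity, from [1 + x ^+ 2 / 2 <= expR x]. *)
  have B : \forall x \near +oo, 0 <= F x <= 4 / x.
    near=> x; have x0 : 1 <= x by near: x; exact: nbhs_pinfty_ge.
    have e := expR_ge1Dxn 1 (le_trans ler01 x0).
    rewrite -[F x]/((x + 1) * expR (- x)); apply/andP; split.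
      by apply: mulr_ge0; [rewrite addr_ge0// (le_trans ler01)|exact: expR_ge0].
    rewrite expRN ler_pdivrMr ?expR_gt0// mulrAC ler_pdivlMr ?(lt_le_trans _ x0)//.
    apply: le_trans (_ : 4 * (1 + x ^+ 2 / 2) <= _); last first.
      by rewrite ler_pM2l.
    nra.
  apply: (squeeze_cvgr B); first exact: cvg_cst.
  rewrite -(mulr0 4); apply: cvgM; first exact: cvg_cst.
  apply/gtr0_cvgV0; last exact: cvg_id.
  by near=> x; near: x; exact: nbhs_pinfty_gt.
- by move=> x _; apply: derivableN; have [] := DF x.
- apply: cvgN; apply: cvg_at_right_filter.
  apply: differentiable_continuous; apply/derivable1_diffP.
  by have [] := DF a.
- move=> x _; rewrite derive1E.
  by have [_ ->] := @is_deriveN _ _ _ _ _ _ _ (DF x); rewrite opprK.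
Unshelve. all: by end_near. Qed.
End Line.

Lemma integral_mul_expN_ray {R : realType} (k a : R) : 0 <= k ->
  (\int[@lebesgue_measure R]_(t in `[a, +oo[) (k * expR (- t))%:E =
   (k * expR (- a))%:E)%E.
Proof.
move=> k0; under eq_integral do rewrite EFinM.
rewrite ge0_integralZl//=.
- by rewrite integral_expN_ray -EFinM.
- apply/measurable_EFinP; apply: measurable_funTS.
  by apply: measurableT_comp => //; exact: oppr_measurable.
Qed.

Section HomogeneousLayerCake.
Context {R : realType} d (T : measurableType d)
  (m : {sigma_finite_measure set T -> \bar R}).
Variables (g Phi : T -> R) (a : R) (nu : \bar R).
Hypothesis mg : measurable_fun setT g.
Hypothesis mPhi : measurable_fun setT Phi.
Hypothesis g0 : forall y, 0 <= g y.
Hypothesis Phi0 : forall y, 0 <= Phi y.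
Hypothesis homog : forall u, 0 < u ->
  (\int[m]_(y in [set y | (Phi y <= u)%R]) (g y)%:E = (u `^ a)%:E * nu)%E.
Notation mu := (@lebesgue_measure R).
Notation GR := (measurableTypeR R).

(** By [homog] the layer at height [u] is a power of [u] times [nu], so the integral over [T] splits
    into a one-dimensional integral and the constant [nu], which may still be infinite. *)
Lemma layer_cake_homogeneous (om : GR -> R) :
  measurable_fun setT om -> (forall u, 0 <= om u) ->
  (\int[m]_y \int[mu]_(u in `[Phi y, +oo[) (g y * om u)%:E =
   \int[mu]_(u in `]0%R, +oo[) ((om u * u `^ a)%:E * nu))%E.
Proof.
move=> mom om0; rewrite layer_cake//.
set G := fun u : GR => (\int[m]_(y in _) _)%E.
have mG : measurable_fun setT G by apply: measurable_layer_cake.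
(* Layers below [0] are empty because [Phi] is nonnegative; the layer [u = 0], about which [homog]
   says nothing, is then dropped as a null set. *)
transitivity (\int[mu]_(u in `[0%R, +oo[) G u)%E.
  rewrite [RHS]integral_mkcond; apply: eq_integral => u _.
  rewrite patchE; case: ifPn => //; rewrite notin_setE/= in_itv/= andbT => /negP.
  rewrite -ltNge => u0; rewrite /G integral_mkcond integral0_eq// => y _.
  rewrite patchE memNset//= => yu.
  by have := le_lt_trans (Phi0 y) (le_lt_trans yu u0); rewrite ltxx.
rewrite -integral_itv_obnd_cbnd; last exact: measurable_funTS.
apply: eq_integral => u; rewrite inE/= in_itv/= andbT => u0.
rewrite /G EFinM -muleA -homog//.
under eq_integral do rewrite mulrC EFinM.
rewrite ge0_integralZl//.
- by rewrite -[X in measurable X]setTI; exact: measurable_fun_ler.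
- by apply/measurable_EFinP; apply: measurable_funTS.
- by move=> y _; rewrite lee_fin.
- by rewrite lee_fin.
Qed.

Let mexpN : measurable_fun setT (fun t : GR => expR (- t)).
Proof.
by apply: measurableT_comp => //; exact: oppr_measurable.
Qed.

Hypothesis nu0 : (0 <= nu)%E.

Lemma integral_homogeneous_exp :
  (\int[m]_y (g y * expR (- Phi y))%:E = egamma a * nu)%E.
Proof.
have := layer_cake_homogeneous mexpN (fun u => expR_ge0 (- u)).
under eq_integral do rewrite integral_mul_expN_ray//.
move=> ->; rewrite /egamma ge0_integralZr//.
- by congr (_ * nu)%E; apply: eq_integral => u _; rewrite mulrC.
- by apply/measurable_EFinP; apply: measurable_funTS; apply: measurable_funM.
- by move=> *; rewrite lee_fin mulr_ge0 ?powR_ge0 ?expR_ge0.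
Qed.

Lemma integral_homogeneous_mulexp :
  (\int[m]_y (g y * (Phi y + 1) * expR (- Phi y))%:E = egamma (a + 1) * nu)%E.
Proof.
(* The weight [u * expR (- u)], whose tail integral from [a >= 0] is [(a + 1) * expR (- a)]; the
   maximum makes it nonnegative on the whole line. *)
pose om (u : GR) : R := Num.max 0 u * expR (- u).
have mom : measurable_fun setT om.
  apply: measurable_funM => //; apply: measurable_maxr => //.
have om0 u : 0 <= om u by rewrite mulr_ge0 ?expR_ge0// le_max lexx.
have := layer_cake_homogeneous mom om0.
under eq_integral => y _.
  under eq_integral do rewrite EFinM.
  rewrite ge0_integralZl//=; last 3 first.
  - by apply/measurable_EFinP; exact: measurable_funTS.
  - by move=> *; rewrite lee_fin.
  - by rewrite lee_fin.
  rewrite (_ : (\int[mu]_(x in `[Phi y, +oo[) (om x)%:E = ((Phi y + 1) * expR (- Phi y))%:E)%E); last first.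
    rewrite -integral_mulexpN_ray//; apply: eq_integral => u.
    rewrite inE/= in_itv/= andbT => yu; rewrite /om; congr (_ * _)%:E.
    by apply/max_idPr; exact: le_trans yu.
  rewrite -EFinM mulrA.
  over.
move=> ->; rewrite /egamma ge0_integralZr//.
- congr (_ * nu)%E; apply: eq_integral => u; rewrite inE/= in_itv/= andbT => u0.
  congr (_%:E); rewrite /om (max_idPr _) ?ltW//.
  rewrite powRD ?(gt_eqF u0) ?implybT// powRr1 ?ltW//; ring.
- by apply/measurable_EFinP; apply: measurable_funTS; apply: measurable_funM.
- by move=> *; rewrite lee_fin mulr_ge0 ?powR_ge0.
Qed.

End HomogeneousLayerCake.

Section HalfIntegerGamma.
Context {R : realType}.
Notation mu := (@lebesgue_measure R).
Notation GR := (measurableTypeR R).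

Lemma powR_half (n : nat) (u : R) : 0 <= u -> u `^ (n%:R / 2) = Num.sqrt u ^+ n.
Proof.
by move=> u0; rewrite mulrC powRrM powR12_sqrt// powR_mulrn// sqrtr_ge0.
Qed.

Lemma integral_powR_half (n : nat) (u : R) : 0 < u ->
  (\int[mu]_(v in `]0%R, u]) ((n%:R / 2 + 1) * v `^ (n%:R / 2))%:E =
   (u `^ (n%:R / 2 + 1))%:E)%E.
Proof.
(* Natural powers of the square root make the integrand and its primitive continuous on the whole
   line, in particular at the end point [0]. *)
move=> u0; pose f := fun v : R => (n%:R / 2 + 1) * Num.sqrt v ^+ n.
pose F := fun v : R => v * Num.sqrt v ^+ n.
have cs : continuous (fun v : R => Num.sqrt v ^+ n).
  move=> x; apply: (@continuous_comp _ _ _ Num.sqrt (fun v => v ^+ n)).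
    exact: sqrt_continuous.
  exact: exprn_continuous.
have cf : continuous f.
  move=> x; apply: (@continuousM _ _ (fun=> n%:R / 2 + 1) (fun v : R => Num.sqrt v ^+ n)).
    exact: cvg_cst.
  exact: cs.
have cF : continuous F.
  move=> x; apply: (@continuousM _ _ id (fun v : R => Num.sqrt v ^+ n)).
    exact: cvg_id.
  exact: cs.
have FE (v : R) : 0 < v -> F v = v `^ (n%:R / 2 + 1).
  move=> v0; rewrite /F -powR_half ?ltW// powRD ?(gt_eqF v0) ?implybT//.
  by rewrite powRr1 ?ltW// mulrC.
have DF (v : R) : 0 < v -> is_derive v 1 F ((n%:R / 2 + 1) * v `^ (n%:R / 2)).
  move=> v0; have D := is_derive1_powR (n%:R / 2 + 1) v0; rewrite addrK in D.
  apply: (near_eq_is_derive _ D).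
  by near=> w; rewrite FE//; near: w; exact: lt_nbhsr.
transitivity (\int[mu]_(v in `[0%R, u]) (f v)%:E)%E.
  rewrite -integral_itv_obnd_cbnd; last first.
    by apply/measurable_EFinP; apply: measurable_funTS; exact: continuous_measurable_fun.
  apply: eq_integral => v; rewrite inE/= in_itv/= => /andP[v0 _].
  by rewrite /f powR_half// ltW.
rewrite (continuous_FTC2 (F := F))//.
- by rewrite {2}/F mul0r sube0 FE.
- exact: continuous_subspaceT.
- split.
  + by move=> x; rewrite in_itv/= => /andP[x0 _]; have [] := DF _ x0.
  + by apply: cvg_at_right_filter; exact: cF.
  + by apply: cvg_at_left_filter; exact: cF.
- move=> x; rewrite in_itv/= => /andP[x0 _]; rewrite derive1E.
  by have [_ ->] := DF _ x0; rewrite /f powR_half// ltW.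
Unshelve. all: by end_near. Qed.

(** The functional equation of Gamma by Tonelli rather than by parts: [expR (- v)] is a tail
    integral and the power of exponent [a + 1] is the integral of its derivative. It holds in
    [\bar R], before [egamma] is known to be finite. *)
Lemma egammaS (n : nat) :
  egamma (n%:R / 2 + 1 : R) = ((n%:R / 2 + 1)%:E * egamma (n%:R / 2))%E.
Proof.
pose a : R := n%:R / 2; have a0 : 0 <= a by rewrite divr_ge0.
have a10 : 0 <= a + 1 by rewrite addr_ge0.
pose g := (fun v : GR => (a + 1) * v `^ a) \_ `]0, +oo[.
have mg : measurable_fun setT g.
  apply/(measurable_restrictT _ _).1 => //; apply: measurable_funTS.
  by apply: measurable_funM.
have g0 v : 0 <= g v.
  by rewrite /g patchE; case: ifPn => // _; rewrite mulr_ge0 ?powR_ge0.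
have gE v : g v = if v \in `]0, +oo[%classic then (a + 1) * v `^ a else 0.
  by rewrite /g patchE.
clearbody g.
have mexpN : measurable_fun setT (fun t : GR => expR (- t)).
  by apply: measurableT_comp => //; exact: oppr_measurable.
(* The layer cake formula on the line itself, with the identity as [Phi]. *)
have := layer_cake mu mg (@measurable_id _ GR setT) mexpN g0 (fun u => expR_ge0 (- u)).
set L := LHS; set Rr := RHS => LR.
have <- : (L = (a + 1)%:E * egamma a)%E.
  transitivity (\int[mu]_v (g v * expR (- v))%:E)%E.
    by apply: eq_integral => v _; exact: integral_mul_expN_ray.
  transitivity (\int[mu]_(v in `]0%R, +oo[) ((a + 1)%:E * (v `^ a * expR (- v))%:E))%E.
    rewrite [RHS]integral_mkcond; apply: eq_integral => v _.
    rewrite gE patchE; case: ifPn => _; last by rewrite mul0r.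
    by rewrite -EFinM mulrA.
  rewrite {LR Rr mexpN mg} ge0_integralZl//.
  - by apply/measurable_EFinP; apply: measurable_funTS; exact: measurable_powR_mulexpN.
  - by move=> v _; rewrite lee_fin mulr_ge0 ?powR_ge0 ?expR_ge0.
rewrite LR {LR L mexpN} /Rr {Rr} /egamma integral_mkcond; apply: eq_integral => u _.
rewrite patchE; case: ifPn => /=; last first.
  rewrite notin_setE/= in_itv/= andbT => /negP; rewrite -leNgt => u0.
  apply/esym/integral0_eq => v /= vu; rewrite gE memNset ?mul0r//=.
  by rewrite in_itv/= andbT => /lt_le_trans/(_ (le_trans vu u0)); rewrite ltxx.
rewrite inE/= in_itv/= andbT => u0.
rewrite EFinM -integral_powR_half// muleC -ge0_integralZl//=; last 2 first.
- apply/measurable_EFinP; apply: measurable_funTS.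
  by apply: measurable_funM.
- by move=> v _; rewrite lee_fin mulr_ge0 ?powR_ge0.
rewrite [LHS]integral_mkcond [RHS]integral_mkcond; apply: eq_integral => v _.
rewrite !patchE (_ : (v \in [set y | y <= u]) = (v <= u)); last first.
  by apply/idP/idP; rewrite inE.
rewrite gE !mem_setE !in_itv/= andbT.
by case: (v <= u); rewrite ?andbT ?andbF//; case: ifPn => _; rewrite ?mul0r// -EFinM mulrC.
Qed.
End HalfIntegerGamma.

(** * Gaussian moments on R^n *)
Section LebesgueRVIntegral.
Context {R : realType}.
Notation mu := (@lebesgue_measure R).
Notation GR := (measurableTypeR R).

Lemma ge0_integral_lebesgue_rVS n (F : 'rV[R]_n.+1 -> \bar R) :
  measurable_fun setT F -> (forall y, 0 <= F y)%E ->
  (\int[lebesgue_rV n.+1]_y F y =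
   \int[mu]_x \int[lebesgue_rV n]_y F (cons_rV (x, y)))%E.
Proof.
move=> mF F0.
have mFc : measurable_fun setT (F \o @cons_rV R n).
  by apply: measurableT_comp => //; exact: measurable_cons_rV.
rewrite -[LHS]/(\int[pushforward (mu \x lebesgue_rV n)%E (@cons_rV R n)]_y F y)%E.
rewrite ge0_integral_pushforward//=; last exact: measurable_cons_rV.
by apply: (fubini_tonelli1 (F \o @cons_rV R n)) => // z; exact: F0.
Qed.

Lemma ge0_integral_lebesgue_rV0 (F : 'rV[R]_0 -> \bar R) :
  measurable_fun setT F ->
  (\int[lebesgue_rV 0]_y F y)%E = F 0.
Proof.
move=> mF; rewrite -[LHS]/(\int[\d_(0%R : 'rV[R]_0)]_y F y)%E.
by rewrite integral_dirac// diracT mul1e.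
Qed.

Lemma measurable_coord n (i : 'I_n) :
  measurable_fun setT (fun v : 'rV[R]_n => v 0 i).
Proof. exact: measurable_rV_coord. Qed.

Lemma measurable_fun_rV' n m (f : 'rV[R]_m -> 'rV[R]_n) :
  (forall j, measurable_fun setT (fun x => f x 0 j)) ->
  measurable_fun setT f.
Proof. exact: measurable_fun_rV. Qed.

(** Diagonal maps cover both dilations (constant [c]) and reflections (entries of absolute value 1),
    and their change of variables reduces to the line one coordinate at a time. *)
Definition diag_scale n (c y : 'rV[R]_n) : 'rV[R]_n := \row_j (c 0 j * y 0 j).

Lemma measurable_diag_scale n (c : 'rV[R]_n) :
  measurable_fun setT (diag_scale c).
Proof.
apply: measurable_fun_rV' => j; under eq_fun do rewrite mxE.
by apply: measurable_funM => //; exact: measurable_coord.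
Qed.

Lemma diag_scale_cons n (c : 'rV[R]_n.+1) (x : R) (y : 'rV[R]_n) :
  diag_scale c (cons_rV (x, y)) =
  cons_rV (c 0 0 * x, diag_scale (\row_j c 0 (lift ord0 j)) y).
Proof.
apply/rowP => j; rewrite !mxE /=; case: unliftP => [k|] -> /=.
  by rewrite !mxE.
by [].
Qed.

Lemma ge0_integral_diag_scale n (c : 'rV[R]_n) (F : 'rV[R]_n -> \bar R) :
  (forall j, c 0 j != 0) -> measurable_fun setT F -> (forall y, 0 <= F y)%E ->
  (\int[lebesgue_rV n]_y F (diag_scale c y) =
   (\prod_j `|c 0 j|^-1)%:E * \int[lebesgue_rV n]_y F y)%E.
Proof.
elim: n c F => [|n IHn] c F c0 mF F0.
  rewrite big_ord0 mul1e; apply: eq_integral => y _; congr F.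
  by apply/rowP => -[].
have msc := measurable_diag_scale c.
rewrite !ge0_integral_lebesgue_rVS//; last exact: measurableT_comp.
pose c' : 'rV[R]_n := \row_j c 0 (lift ord0 j).
have mcons x : measurable_fun setT (fun y => @cons_rV R n (x, y)).
  by apply: measurableT_comp; [exact: measurable_cons_rV|exact: pair1_measurable].
have mFc : measurable_fun setT (F \o @cons_rV R n).
  by apply: measurableT_comp => //; exact: measurable_cons_rV.
have mG : measurable_fun setT (fun x : GR => \int[lebesgue_rV n]_y F (cons_rV (x, y)))%E.
  by apply: (measurable_fun_fubini_tonelli_F (F \o @cons_rV R n)) => // z; exact: F0.
under eq_integral => x _.
  under eq_integral do rewrite diag_scale_cons.
  rewrite (IHn c' (fun y => F (cons_rV (c 0 0 * x, y)))); last 3 first.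
  - by move=> j; rewrite mxE.
  - by apply: measurableT_comp => //; exact: mcons.
  - by [].
  over.
rewrite ge0_integralZl//; last 3 first.
- apply: (measurableT_comp mG); exact: mulrl_measurable.
- by move=> x _; exact: integral_ge0.
- by rewrite lee_fin prodr_ge0.
rewrite (@ge0_integral_lebesgue_scale R _ (fun x => \int[lebesgue_rV n]_y F (cons_rV (x, y)))%E)//; last first.
  by move=> x; exact: integral_ge0.
rewrite muleA -EFinM; congr (_%:E * _)%E.
rewrite big_ord_recl mulrC; congr (_ * _).
by apply: eq_bigr => j _; rewrite mxE.
Qed.

Lemma ge0_integral_prod_coord n (phi : 'I_n -> GR -> R) :
  (forall j, measurable_fun setT (phi j)) -> (forall j x, 0 <= phi j x) ->
  (\int[lebesgue_rV n]_y (\prod_j phi j (y 0 j))%:E =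
   \prod_j \int[mu]_x (phi j x)%:E)%E.
Proof.
elim: n phi => [|n IHn] phi mphi phi0.
  rewrite ge0_integral_lebesgue_rV0 ?big_ord0//.
  by under eq_fun do rewrite big_ord0; exact: measurable_cst.
have mprod m (psi : 'I_m -> GR -> R) : (forall j, measurable_fun setT (psi j)) ->
    measurable_fun setT (fun y : 'rV[R]_m => (\prod_j psi j (y 0 j))%:E).
  move=> mpsi; apply/measurable_EFinP; apply: measurable_prod => j _.
  by apply: (measurableT_comp (mpsi j)); exact: measurable_rV_coord.
rewrite ge0_integral_lebesgue_rVS//; last 2 first.
- exact: mprod.
- by move=> y; rewrite lee_fin prodr_ge0.
rewrite big_ord_recl.
under eq_integral => x _.
  under eq_integral => y _.
    rewrite big_ord_recl EFinM.
    rewrite {1}/cons_rV mxE unlift_none/=.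
    under eq_bigr do rewrite /cons_rV mxE liftK/=.
    over.
  rewrite ge0_integralZl//=; last 3 first.
  - by apply: (mprod _ (fun j => phi (lift ord0 j))).
  - by move=> y _; rewrite lee_fin prodr_ge0.
  - by rewrite lee_fin.
  rewrite (IHn (fun j => phi (lift ord0 j)))//.
  over.
rewrite ge0_integralZr//=.
- by apply/measurable_EFinP.
- by move=> x _; rewrite lee_fin.
- apply: (big_ind (fun z => 0 <= z)%E) => //; first by move=> *; exact: mule_ge0.
  by move=> j _; apply: integral_ge0 => x _; rewrite lee_fin.
Qed.

End LebesgueRVIntegral.

Section DotProduct.
Context {R : realType} {n : nat}.
Implicit Types x y : 'rV[R]_n.

Lemma dotpE x y : dotp x y = \sum_j x 0 j * y 0 j.
Proof. by rewrite /dotp mxE; apply: eq_bigr => j _; rewrite mxE. Qed.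

Lemma dotp_ge0 x : 0 <= dotp x x.
Proof. by rewrite dotpE sumr_ge0// => j _; rewrite -expr2 sqr_ge0. Qed.

Lemma dotpZ (c : R) x : dotp (c *: x) (c *: x) = c ^+ 2 * dotp x x.
Proof.
by rewrite !dotpE mulr_sumr; apply: eq_bigr => j _; rewrite !mxE; ring.
Qed.

Lemma sqr_coord_le_dotp x j : x 0 j ^+ 2 <= dotp x x.
Proof.
rewrite dotpE (bigD1 j)//= -expr2 lerDl sumr_ge0// => i _.
by rewrite -expr2 sqr_ge0.
Qed.

Lemma measurable_dotp : measurable_fun setT (fun y : 'rV[R]_n => dotp y y).
Proof.
under eq_fun do rewrite dotpE.
by apply: measurable_sum => j; apply: measurable_funM; exact: measurable_coord.
Qed.

End DotProduct.

Section HomogeneousRV.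
Context {R : realType} {n : nat}.
Variables (d : nat) (g Phi : 'rV[R]_n -> R).
Hypothesis mg : measurable_fun setT g.
Hypothesis mPhi : measurable_fun setT Phi.
Hypothesis g0 : forall y, 0 <= g y.
Hypothesis Phi0 : forall y, 0 <= Phi y.
Hypothesis gZ : forall (c : R) y, 0 < c -> g (c *: y) = c ^+ d * g y.
Hypothesis PhiZ : forall (c : R) y, 0 < c -> Phi (c *: y) = c ^+ 2 * Phi y.

Let nu := (\int[lebesgue_rV n]_(y in [set y | (Phi y <= 1)%R]) (g y)%:E)%E.

(** Substitution of [c *: y]: the Jacobian contributes [c ^+ n] and the homogeneity of [g]
    contributes [c ^+ d]. *)
Lemma integral_sublevel_scale (c : R) : 0 < c ->
  (\int[lebesgue_rV n]_(y in [set y | (Phi y <= c ^+ 2)%R]) (g y)%:E =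
   (c ^+ (n + d))%:E * nu)%E.
Proof.
move=> c0; pose F := (fun y => (g y)%:E) \_ [set y | Phi y <= c ^+ 2].
pose G := (fun y => (g y)%:E) \_ [set y | Phi y <= 1].
rewrite /nu integral_mkcond [in RHS]integral_mkcond -/F -/G.
have mS u : measurable [set y | Phi y <= u].
  by rewrite -[X in measurable X]setTI; exact: measurable_fun_ler.
have mF : measurable_fun setT F.
  by apply/(measurable_restrictT _ _).1 => //; apply/measurable_EFinP/measurable_funTS.
have mG : measurable_fun setT G.
  by apply/(measurable_restrictT _ _).1 => //; apply/measurable_EFinP/measurable_funTS.
have F0 y : (0 <= F y)%E by rewrite /F patchE; case: ifPn => // _; rewrite lee_fin.
have G0 y : (0 <= G y)%E by rewrite /G patchE; case: ifPn => // _; rewrite lee_fin.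
have FG y : F (diag_scale (const_mx c) y) = ((c ^+ d)%:E * G y)%E.
  have -> : diag_scale (const_mx c) y = c *: y by apply/rowP => j; rewrite !mxE.
  rewrite /F /G !patchE.
  have -> : (c *: y \in [set y0 | Phi y0 <= c ^+ 2]) = (y \in [set y0 | Phi y0 <= 1]).
    by apply/idP/idP; rewrite !inE/= PhiZ// ger_pMr// exprn_gt0.
  by case: ifPn => _; rewrite ?mule0// gZ// EFinM.
have c0' (j : 'I_n) : (const_mx c : 'rV[R]_n) 0 j != 0 by rewrite mxE gt_eqF.
have := @ge0_integral_diag_scale R n (const_mx c) F c0' mF F0.
have -> : (\int[lebesgue_rV n]_y F (diag_scale (const_mx c) y) = \int[lebesgue_rV n]_y ((c ^+ d)%:E * G y))%E.
  by apply: eq_integral => y _; exact: FG.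
rewrite ge0_integralZl//; last by rewrite lee_fin exprn_ge0// ltW.
move=> E; rewrite exprD EFinM -muleA E.
rewrite muleA -EFinM.
rewrite (eq_bigr (fun=> c^-1)); last by move=> j _; rewrite mxE gtr0_norm.
rewrite prodr_const card_ord exprVn mulfV ?mul1e// expf_neq0// gt_eqF//.
Qed.

Let homog u : 0 < u ->
  (\int[lebesgue_rV n]_(y in [set y | (Phi y <= u)%R]) (g y)%:E =
   (u `^ ((n + d)%:R / 2))%:E * nu)%E.
Proof.
move=> u0; rewrite powR_half ?ltW// -integral_sublevel_scale ?sqrtr_gt0//.
by rewrite sqr_sqrtr// ltW.
Qed.

Let nu0 : (0 <= nu)%E.
Proof. by apply: integral_ge0 => y _; rewrite lee_fin. Qed.

(** Read from right to left, this computes the integral over the unit sublevel set from an integral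
    over the whole space, as polar coordinates would. *)
Lemma integral_exp_sublevel :
  (\int[lebesgue_rV n]_y (g y * expR (- Phi y))%:E =
   egamma ((n + d)%:R / 2) * nu)%E.
Proof. exact: (integral_homogeneous_exp mg mPhi g0 Phi0 homog nu0). Qed.

(* Euler's identity for homogeneous functions, integrated against [exp (- Phi)]. *)
Lemma integral_mulexp_sublevel :
  (\int[lebesgue_rV n]_y (g y * (Phi y + 1) * expR (- Phi y))%:E =
   ((n + d)%:R / 2 + 1)%:E * \int[lebesgue_rV n]_y (g y * expR (- Phi y))%:E)%E.
Proof.
rewrite (integral_homogeneous_mulexp mg mPhi g0 Phi0 homog nu0).
by rewrite integral_exp_sublevel muleA egammaS.
Qed.

End HomogeneousRV.

Section GaussianMoments.
Context {R : realType}.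
Notation mu := (@lebesgue_measure R).
Notation GR := (measurableTypeR R).

Definition gauss {n} (y : 'rV[R]_n) : R := expR (- dotp y y).

Lemma gaussE n (y : 'rV[R]_n) : gauss y = \prod_j expR (- (y 0 j) ^+ 2).
Proof.
by rewrite /gauss -expR_sum dotpE -sumrN; congr expR; apply: eq_bigr => j _.
Qed.

Lemma gauss_ge0 n (y : 'rV[R]_n) : 0 <= gauss y.
Proof. exact: expR_ge0. Qed.

Lemma measurable_gauss n : measurable_fun setT (@gauss n).
Proof.
apply: measurableT_comp => //.
by apply: measurable_funN; exact: measurable_dotp.
Qed.

(** The value of Gamma at [k + 1/2], which is the moment of order [2 k] of [exp (- x^2)]. *)
Fixpoint gmom (k : nat) : R :=
  if k is k'.+1 then (k'%:R + 1 / 2) * gmom k' else Num.sqrt pi.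

Lemma measurable_mono_gauss k : measurable_fun setT (fun x : GR => `|x| ^+ k * expR (- x ^+ 2)).
Proof.
apply: measurable_funM; first by apply: measurable_funX; exact: normr_measurable.
apply: measurableT_comp => //; apply: measurable_funN.
exact: exprn_measurable.
Qed.

(** The induction step is [integral_mulexp_sublevel] in dimension 1 for the even power of the
    coordinate. Removing the moment of order [2 k] from both sides leaves the factor
    [(1 + 2 k) / 2 + 1 - 1 = k + 1/2]. *)
Lemma integral_even_gauss (k : nat) :
  (\int[mu]_x (`|x| ^+ (k.*2) * expR (- x ^+ 2))%:E)%E = (gmom k)%:E.
Proof.
elim: k => [|k IHk].
  under eq_integral do rewrite expr0 mul1r.
  exact: integralT_gauss.
have toRV (k' : nat) : (\int[mu]_x (`|x| ^+ k' * expR (- x ^+ 2))%:E)%E =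
    (\int[@lebesgue_rV R 1]_y (`|y 0 0| ^+ k' * expR (- dotp y y))%:E)%E.
  have := @ge0_integral_prod_coord R 1 (fun=> fun x => `|x| ^+ k' * expR (- x ^+ 2))
    (fun=> measurable_mono_gauss k') (fun _ x => mulr_ge0 (exprn_ge0 _ (normr_ge0 x)) (expR_ge0 _)).
  rewrite big_ord1 => <-; apply: eq_integral => y _; rewrite big_ord1.
  by rewrite dotpE big_ord1 expr2.
have mc : measurable_fun setT (fun y : 'rV[R]_1 => `|y 0 0|).
  by apply: (measurableT_comp (@normr_measurable R setT)); exact: measurable_coord.
have := @integral_mulexp_sublevel R 1 k.*2 (fun y => `|y 0 0| ^+ k.*2) (fun y => dotp y y)
  (measurable_funX _ mc) measurable_dotp (fun y => exprn_ge0 _ (normr_ge0 _)) dotp_ge0.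
have H1 (c : R) (y : 'rV[R]_1) : 0 < c -> `|(c *: y) 0 0| ^+ k.*2 = c ^+ k.*2 * `|y 0 0| ^+ k.*2.
  by move=> c0; rewrite mxE normrM exprMn gtr0_norm.
move=> /(_ H1 (fun c y _ => dotpZ c y)).
rewrite -toRV IHk -EFinM.
have -> : (\int[@lebesgue_rV R 1]_y (`|y 0 0| ^+ k.*2 * (dotp y y + 1) * expR (- dotp y y))%:E =
  \int[@lebesgue_rV R 1]_y ((`|y 0 0| ^+ k.+1.*2 * expR (- dotp y y))%:E + (`|y 0 0| ^+ k.*2 * expR (- dotp y y))%:E))%E.
  apply: eq_integral => y _; rewrite -EFinD; congr (_%:E).
  rewrite doubleS !exprS mulrDr mulrDl mulr1; congr (_ * _ + _).
  rewrite {1}dotpE big_ord1 mulrA -expr2 [LHS]mulrC.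
  by rewrite -normrM -expr2 ger0_norm// sqr_ge0.
have mk k' : measurable_fun setT (fun y : 'rV[R]_1 => (`|y 0 0| ^+ k' * expR (- dotp y y))%:E).
  apply/measurable_EFinP; apply: measurable_funM; first exact: measurable_funX.
  exact: (measurable_gauss (n := 1)).
have mk0 k' (y : 'rV[R]_1) : (0 <= (`|y 0 0| ^+ k' * expR (- dotp y y))%:E)%E.
  by rewrite lee_fin mulr_ge0 ?exprn_ge0 ?expR_ge0.
rewrite ge0_integralD//.
rewrite -!toRV IHk => E.
have : (\int[mu]_x (`|x| ^+ k.+1.*2 * expR (- x ^+ 2))%:E + (gmom k)%:E - (gmom k)%:E =
  (((1 + k.*2)%:R / 2 + 1) * gmom k)%:E - (gmom k)%:E)%E by rewrite E.
rewrite addeK// => ->; rewrite -EFinB; congr (_%:E) => /=.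
by rewrite natrD -muln2 natrM; field.
Qed.

End GaussianMoments.

Section GaussianMonomials.
Context {R : realType}.
Notation mu := (@lebesgue_measure R).
Notation GR := (measurableTypeR R).

Lemma integral_abs_gauss_lty (k : nat) :
  (\int[mu]_x (`|x| ^+ k * expR (- x ^+ 2))%:E < +oo)%E.
Proof.
(* Since [|x| ^+ k <= 1 + |x| ^+ k.*2], the even moments control all the others. *)
apply: (@le_lt_trans _ _ (\int[mu]_x ((`|x| ^+ 0.*2 * expR (- x ^+ 2))%:E + (`|x| ^+ k.*2 * expR (- x ^+ 2))%:E))%E).
  apply: ge0_le_integral => //.
  - by apply/measurable_EFinP; exact: measurable_mono_gauss.
  - by apply: emeasurable_funD; apply/measurable_EFinP; exact: measurable_mono_gauss.
  - move=> x _; rewrite -EFinD lee_fin expr0 -mulrDl ler_wpM2r ?expR_ge0//.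
    rewrite -muln2 exprM; set t := `|x| ^+ k.
    have t0 : 0 <= t by rewrite exprn_ge0.
    have : 0 <= (t - 1) ^+ 2 by exact: sqr_ge0.
    clearbody t; nra.
have m0 k' (x : R) : (0 <= (`|x| ^+ k' * expR (- x ^+ 2))%:E)%E.
  by rewrite lee_fin mulr_ge0 ?exprn_ge0 ?expR_ge0.
have mm k' : measurable_fun setT (fun x : GR => (`|x| ^+ k' * expR (- x ^+ 2))%:E).
  by apply/measurable_EFinP; exact: measurable_mono_gauss.
by rewrite ge0_integralD// !integral_even_gauss -EFinD ltry.
Qed.

Definition monomial {n} (m : 'I_n -> nat) (y : 'rV[R]_n) : R := \prod_j y 0 j ^+ m j.

Lemma measurable_monomial n (m : 'I_n -> nat) : measurable_fun setT (monomial m).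
Proof.
apply: measurable_prod => j _; apply: measurable_funX; exact: measurable_coord.
Qed.

Lemma monomial_gauss_abs n (m : 'I_n -> nat) (y : 'rV[R]_n) :
  `|monomial m y * gauss y| = \prod_j (`|y 0 j| ^+ m j * expR (- (y 0 j) ^+ 2)).
Proof.
rewrite normrM (ger0_norm (gauss_ge0 y)) gaussE normr_prod -big_split/=.
by apply: eq_bigr => j _; rewrite normrX.
Qed.

Lemma prod_EFin (I : finType) (a : I -> R) :
  (\prod_i (a i)%:E)%E = (\prod_i a i)%:E.
Proof. by symmetry; exact: (big_morph _ EFinM). Qed.

Definition gint {n} (g : 'rV[R]_n -> R) : \bar R := (\int[lebesgue_rV n]_y (g y * gauss y)%:E)%E.
Definition gintegrable {n} (g : 'rV[R]_n -> R) : Prop :=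
  (lebesgue_rV n).-integrable setT (fun y => (g y * gauss y)%:E).

Lemma monomial_gintegrable n (m : 'I_n -> nat) : gintegrable (monomial m).
Proof.
apply/integrableP; split.
  apply/measurable_EFinP; apply: measurable_funM; first exact: measurable_monomial.
  exact: measurable_gauss.
under eq_integral => y _ do rewrite abse_EFin monomial_gauss_abs.
rewrite (ge0_integral_prod_coord (fun j => measurable_mono_gauss (m j))); last first.
  by move=> j x; rewrite mulr_ge0 ?exprn_ge0 ?expR_ge0.
rewrite (eq_bigr (fun j => (fine (\int[mu]_x (`|x| ^+ m j * expR (- x ^+ 2))%:E))%:E)).
  by rewrite prod_EFin ltry.
move=> j _; rewrite fineK// ge0_fin_numE ?integral_abs_gauss_lty//.
by apply: integral_ge0 => x _; rewrite lee_fin mulr_ge0 ?exprn_ge0 ?expR_ge0.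
Qed.

Lemma integral_diag_sign n (c : 'rV[R]_n) (F : 'rV[R]_n -> \bar R) :
  (forall j, `|c 0 j| = 1) -> measurable_fun setT F ->
  (\int[lebesgue_rV n]_y F (diag_scale c y) = \int[lebesgue_rV n]_y F y)%E.
Proof.
move=> c1 mF; rewrite [LHS]integralE [RHS]integralE.
have c0 j : c 0 j != 0 by rewrite -normr_eq0 c1 oner_neq0.
have P1 : \prod_j `|c 0 j|^-1 = 1 :> R.
  by rewrite big1// => j _; rewrite c1 invr1.
have mp := measurable_funepos mF; have mn := measurable_funeneg mF.
have := ge0_integral_diag_scale c0 mp (fun y => funepos_ge0 F y).
have := ge0_integral_diag_scale c0 mn (fun y => funeneg_ge0 F y).
rewrite P1 !mul1e => E1 E2; rewrite -E1 -E2.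
by congr (_ - _)%E; apply: eq_integral => y _; rewrite ?funeposE ?funenegE.
Qed.

Definition mval (k : nat) : R := if odd k then 0 else gmom k./2.

(** If some exponent is odd, reflecting that coordinate changes the sign of the integrand, and a
    finite integral equal to its opposite is zero. Otherwise the integrand is nonnegative and
    factors over the coordinates. *)
Lemma gint_monomial n (m : 'I_n -> nat) :
  gint (monomial m) = (\prod_j mval (m j))%:E.
Proof.
have [/existsP[p op]|/existsPn allE] := boolP [exists j, odd (m j)].
  rewrite (bigD1 p)//= /mval op mul0r.
  (* The reflection of the coordinate [p]. *)
  pose c : 'rV[R]_n := \row_j (-1) ^+ (j == p).
  have c1 j : `|c 0 j| = 1 by rewrite mxE normrX normrN1 expr1n.
  have mF : measurable_fun setT (fun y : 'rV[R]_n => (monomial m y * gauss y)%:E).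
    exact: measurable_int (monomial_gintegrable m).
  have fin : gint (monomial m) \is a fin_num.
    exact: (integrable_fin_num _ (monomial_gintegrable m)).
  have FN y : (monomial m (diag_scale c y) * gauss (diag_scale c y))%:E =
              (- (monomial m y * gauss y)%:E)%E.
    rewrite -EFinN; congr (_%:E); rewrite -mulNr; congr (_ * _).
      rewrite /monomial (bigD1 p)//= [in RHS](bigD1 p)//= -mulNr; congr (_ * _).
        by rewrite !mxE eqxx expr1 mulN1r exprNn -signr_odd op expr1 mulN1r.
      by apply: eq_bigr => j /negbTE jp; rewrite !mxE jp expr0 mul1r.
    rewrite !gaussE; apply: eq_bigr => j _; rewrite !mxE exprMn.
    by rewrite -exprM mulnC exprM sqrrN !expr1n mul1r.
  have := integral_diag_sign c1 mF.
  under eq_integral do rewrite FN.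
  rewrite integralN//; last first.
    by apply: integrable_add_def => //; exact: monomial_gintegrable.
  rewrite -/(gint _) -[in LHS](fineK fin) -[in RHS](fineK fin) => -[] E.
  rewrite -(fineK fin); congr (_%:E); lra.
transitivity (\int[@lebesgue_rV R n]_y (\prod_j (`|y 0 j| ^+ m j * expR (- (y 0 j) ^+ 2)))%:E)%E.
  apply: eq_integral => y _; rewrite -monomial_gauss_abs ger0_norm//.
  rewrite mulr_ge0 ?gauss_ge0//; apply: prodr_ge0 => j _.
  by rewrite exprn_even_ge0// (negbTE (allE j)).
rewrite (ge0_integral_prod_coord (fun j => measurable_mono_gauss (m j))); last first.
  by move=> j x; rewrite mulr_ge0 ?exprn_ge0 ?expR_ge0.
rewrite -prod_EFin; apply: eq_bigr => j _.
rewrite /mval (negbTE (allE j)) -integral_even_gauss.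
by rewrite even_halfK// (negbTE (allE j)).
Qed.

End GaussianMonomials.

Section GaussianExpectation.
Context {R : realType} {n : nat}.
Implicit Types g h : 'rV[R]_n -> R.

(** Integrability travels with the value, so that moments of polynomials are assembled term by term
    without separate integrability proofs. *)
Definition has_gint g (v : R) : Prop := gintegrable g /\ gint g = v%:E.

Lemma has_gint_fine g : gintegrable g -> has_gint g (fine (gint g)).
Proof. by move=> ig; split=> //; rewrite fineK//; exact: integrable_fin_num ig. Qed.

Lemma eq_has_gint g h v : g =1 h -> has_gint g v -> has_gint h v.
Proof. by move=> /funext ->. Qed.

Lemma has_gintZ (a : R) g v : has_gint g v -> has_gint (fun y => a * g y) (a * v).
Proof.
move=> [ig gv]; have E : (fun y => (a * g y * gauss y)%:E) = (fun y => a%:E * (g y * gauss y)%:E)%E.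
  by apply/funext => y; rewrite -mulrA EFinM.
split; rewrite /gintegrable /gint E; first exact: integrableZl.
by rewrite integralZl// -/(gint g) gv EFinM.
Qed.

Lemma has_gintD g h v w : has_gint g v -> has_gint h w ->
  has_gint (fun y => g y + h y) (v + w).
Proof.
move=> [ig gv] [ih hw]; have E : (fun y => ((g y + h y) * gauss y)%:E) =
    (fun y => (g y * gauss y)%:E + (h y * gauss y)%:E)%E.
  by apply/funext => y; rewrite mulrDl EFinD.
split; rewrite /gintegrable /gint E; first exact: integrableD.
by rewrite integralD// -/(gint g) -/(gint h) gv hw.
Qed.

Lemma has_gint0 : has_gint (fun=> 0) 0.
Proof.
split; rewrite /gintegrable /gint.
  by under [X in integrable _ _ X]funext do rewrite mul0r; exact: integrable0.
by apply: integral0_eq => y _; rewrite mul0r.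
Qed.

Lemma has_gint_sum (I : Type) (s : seq I) (g : I -> 'rV[R]_n -> R) (v : I -> R) :
  (forall i, has_gint (g i) (v i)) ->
  has_gint (fun y => \sum_(i <- s) g i y) (\sum_(i <- s) v i).
Proof.
move=> gv; elim: s => [|i s IHs].
  by rewrite big_nil; apply: eq_has_gint has_gint0 => y; rewrite big_nil.
rewrite big_cons; apply: eq_has_gint (has_gintD (gv i) IHs) => y.
by rewrite big_cons.
Qed.

Lemma has_gint_le g h v w : (forall y, g y <= h y) -> has_gint g v -> has_gint h w -> v <= w.
Proof.
move=> gh [ig gv] [ih hw]; rewrite -lee_fin -gv -hw; apply: le_integral => //.
by move=> y _; rewrite lee_fin ler_wpM2r ?gauss_ge0.
Qed.

Lemma gintegrable_le g h : measurable_fun setT g -> (forall y, `|g y| <= h y) ->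
  gintegrable h -> gintegrable g.
Proof.
move=> mg gh; apply: le_integrable => //.
  by apply/measurable_EFinP; apply: measurable_funM => //; exact: measurable_gauss.
move=> y _; rewrite !abse_EFin lee_fin !normrM ler_wpM2r//.
by rewrite (le_trans (gh y))// ler_norm.
Qed.

Definition gtot : R := Num.sqrt pi ^+ n.

Lemma gtot_gt0 : 0 < gtot.
Proof. by rewrite exprn_gt0// sqrtr_gt0 pi_gt0. Qed.

Lemma has_gint_monomial (m : 'I_n -> nat) :
  has_gint (monomial m) (\prod_j mval (m j)).
Proof. by split; [exact: monomial_gintegrable|exact: gint_monomial]. Qed.

Definition nmval (k : nat) : R := mval k / Num.sqrt pi.

Let spi0 : Num.sqrt pi != 0 :> R.
Proof. by rewrite gt_eqF// sqrtr_gt0 pi_gt0. Qed.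

Lemma nmval0 : nmval 0 = 1. Proof. by rewrite /nmval /mval/= divff. Qed.
Lemma nmval1 : nmval 1 = 0. Proof. by rewrite /nmval /mval/= mul0r. Qed.
Lemma nmval2 : nmval 2 = 1 / 2.
Proof. by rewrite /nmval /mval/= mulfK// add0r. Qed.
Lemma nmval3 : nmval 3 = 0. Proof. by rewrite /nmval /mval/= mul0r. Qed.
Lemma nmval4 : nmval 4 = 3 / 4.
Proof. by rewrite /nmval /mval/= mulrA mulfK//; lra. Qed.

Lemma prod_mval (m : 'I_n -> nat) :
  \prod_j mval (m j) = gtot * \prod_j nmval (m j).
Proof.
rewrite /nmval big_split/= prodr_const card_ord exprVn mulrCA mulfV ?mulr1//.
by rewrite gt_eqF// gtot_gt0.
Qed.

Lemma prod_expr_eq (y : 'rV[R]_n) i : \prod_j y 0 j ^+ (j == i) = y 0 i.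
Proof.
rewrite (bigD1 i)//= eqxx expr1 big1 ?mulr1// => j /negbTE ->.
by rewrite expr0.
Qed.

Lemma has_gint_one : has_gint (fun=> 1) gtot.
Proof.
have := has_gint_monomial (fun=> 0%N).
rewrite prod_mval big1 ?mulr1; last by move=> j _; exact: nmval0.
by apply: eq_has_gint => y; rewrite /monomial big1.
Qed.

Lemma has_gint_coord2 i j :
  has_gint (fun y => y 0 i * y 0 j) (gtot * ((i == j)%:R / 2)).
Proof.
have := has_gint_monomial (fun p => (p == i) + (p == j))%N.
rewrite prod_mval.
have -> : \prod_p nmval ((p == i) + (p == j)) = (i == j)%:R / 2.
  rewrite (bigD1 i)//= eqxx; have [<-|ij] := eqVneq i j.
    rewrite nmval2 big1 ?mulr1// => p /negbTE ->; exact: nmval0.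
  by rewrite nmval1 !mul0r.
apply: eq_has_gint => y; rewrite /monomial.
under eq_bigr do rewrite exprD.
by rewrite big_split/= !prod_expr_eq.
Qed.

(** Wick's formula in degree 4. The exponent of the coordinate [p] counts the indices equal to [p],
    so only the pattern of coincidences matters: an odd exponent gives 0, four equal indices give
    3/4, two distinct pairs give 1/4. *)
Lemma has_gint_coord4 i j k l :
  has_gint (fun y => y 0 i * y 0 j * (y 0 k * y 0 l))
    (gtot * (((i == j) && (k == l))%:R + ((i == k) && (j == l))%:R
             + ((i == l) && (j == k))%:R) / 4).
Proof.
have := has_gint_monomial (fun p => (p == i) + (p == j) + ((p == k) + (p == l)))%N.
rewrite prod_mval -mulrA.
set v := (X in has_gint _ (gtot * X) -> _); set w := (X in _ -> has_gint _ (gtot * X)).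
have -> : v = w.
  rewrite /v /w {v w}.
  have odd1 p : ((p == i) + (p == j) + ((p == k) + (p == l)) = 1)%N ->
     \prod_p nmval ((p == i) + (p == j) + ((p == k) + (p == l))) = 0.
    by move=> p1; rewrite (bigD1 p)//= p1 nmval1 mul0r.
  have odd3 p : ((p == i) + (p == j) + ((p == k) + (p == l)) = 3)%N ->
     \prod_p nmval ((p == i) + (p == j) + ((p == k) + (p == l))) = 0.
    by move=> p1; rewrite (bigD1 p)//= p1 nmval3 mul0r.
  have all4 a (F : 'I_n -> nat) : F a = 4 -> (forall p, p != a -> F p = 0)%N ->
      \prod_p nmval (F p) = 3 / 4.
    move=> Fa F0; rewrite (bigD1 a)//= Fa nmval4 big1 ?mulr1// => p pa.
    by rewrite F0// nmval0.
  have two2 a b (F : 'I_n -> nat) : a != b -> F a = 2 -> F b = 2 ->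
      (forall p, p != a -> p != b -> F p = 0)%N -> \prod_p nmval (F p) = 1 / 4.
    move=> ab Fa Fb F0; rewrite (bigD1 a)//= (bigD1 b)/= 1?eq_sym//.
    rewrite Fa Fb nmval2 big1 ?mulr1; first by field.
    by move=> p /andP[pa pb]; rewrite F0// nmval0.
  have [ij|ij] := eqVneq i j; have [kl|kl] := eqVneq k l.
  - subst j l; have [ik|ik] := eqVneq i k.
      subst k; rewrite (all4 i) ?eqxx//=; first by field.
      by move=> p /negbTE ->.
    rewrite (two2 i k)//= ?eqxx ?(negbTE ik) ?(eq_sym k) ?(negbTE ik)//=.
      by field.
    by move=> p /negbTE -> /negbTE ->.
  - subst j; have [ik|ik] := eqVneq i k.
      subst k; rewrite (negbTE kl)/= (odd3 i) ?eqxx ?(negbTE kl)//; by field.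
    have [il|il] := eqVneq i l.
      subst l; rewrite /= (odd3 i) ?eqxx ?(negbTE ik)//; by field.
    rewrite /= (odd1 k) ?eqxx ?(negbTE kl)//= ?(eq_sym k) ?(negbTE ik)//; by field.
  - subst l; have [ik|ik] := eqVneq i k.
      subst k; rewrite eq_sym (negbTE ij)/= (odd3 i) ?eqxx ?(negbTE ij)//; by field.
    rewrite /= (odd1 i) ?eqxx ?(negbTE ik) ?(negbTE ij)//; by field.
  - have [ik|ik] := eqVneq i k.
      subst k; have [jl|jl] := eqVneq j l.
        subst l; rewrite (two2 i j)//= ?eqxx ?(negbTE ij) ?(eq_sym j) ?(negbTE ij)//=.
          by field.
        by move=> p /negbTE -> /negbTE ->.
      rewrite (negbTE kl)/= (odd1 j) ?eqxx ?(eq_sym j i) ?(negbTE ij) ?(negbTE jl)//; by field.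
    have [il|il] := eqVneq i l.
      subst l; have [jk|jk] := eqVneq j k.
        subst k; rewrite (two2 i j)//= ?eqxx ?(negbTE ij) ?(eq_sym j) ?(negbTE ij)//=.
          by field.
        by move=> p /negbTE -> /negbTE ->.
      rewrite /= (odd1 j) ?eqxx ?(eq_sym j i) ?(negbTE ij) ?(negbTE jk)//; by field.
    rewrite /= (odd1 i) ?eqxx ?(negbTE ij) ?(negbTE ik) ?(negbTE il)//; by field.
apply: eq_has_gint => y; rewrite /monomial.
under eq_bigr do rewrite !exprD.
by rewrite !big_split/= !prod_expr_eq.
Qed.

End GaussianExpectation.

Section GammaVolume.
Context {R : realType}.

Lemma GammaE (a : R) : Gamma (a + 1) = fine (egamma a).
Proof.
rewrite /Gamma /egamma /Rintegral; congr fine; apply: eq_integral => t _.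
by rewrite addrK.
Qed.

Lemma egamma_ge0 (a : R) : (0 <= egamma a)%E.
Proof.
by apply: integral_ge0 => t _; rewrite lee_fin mulr_ge0 ?powR_ge0 ?expR_ge0.
Qed.

(** The product of [egamma (n / 2)] and the measure [nu] of the unit ball is the Gaussian mass
    [gtot]. As this is positive and finite, [egamma] can be neither zero nor infinite. *)
Lemma egamma_half_fin (n : nat) :
  exists2 G : R, 0 < G & egamma (n%:R / 2 : R) = G%:E.
Proof.
have [_ E] := @has_gint_one R n.
have := @integral_exp_sublevel R n 0 (fun=> 1) (fun y => dotp y y)
  (measurable_cst _) measurable_dotp (fun=> ler01) dotp_ge0
  (fun c y _ => esym (mulr1 _)) (fun c y _ => dotpZ c y).
rewrite addn0 -/(gint _) E => {E}.
set nu := (\int[_]_(y in _) _)%E => E.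
have nu0 : (0 <= nu)%E by apply: integral_ge0 => y _; rewrite lee_fin.
have := egamma_ge0 (n%:R / 2 : R); move: E.
case: (egamma _) => [G||] E // G0.
- exists G => //; rewrite lt_neqAle -lee_fin G0 andbT; apply/eqP => G00.
  by move: E; rewrite -G00 mul0e => -[] /eqP; rewrite gt_eqF// gtot_gt0.
- move: nu0 E; rewrite le_eqVlt => /predU1P[<-|nu0].
    by rewrite mule0 => -[] /eqP; rewrite gt_eqF// gtot_gt0.
  by rewrite gt0_mulye.
Qed.

Lemma ball_volumeE (n : nat) (eps : R) :
  ball_volume n eps = @gtot R n / Gamma (n%:R / 2 + 1) * eps ^+ n.
Proof.
by rewrite /ball_volume powR_half ?pi_ge0// mulrAC.
Qed.

End GammaVolume.

(** * Asymptotics of sublevel sets *)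
Section SublevelAsymptotics.
Context {R : realType} {n : nat}.
Variables (q4 q2 : 'rV[R]_n -> R) (K a4 a2 : R).
Hypothesis mq4 : measurable_fun setT q4.
Hypothesis mq2 : measurable_fun setT q2.
Hypothesis q4_ge0 : forall y, 0 <= q4 y.
Hypothesis q2_ge0 : forall y, 0 <= q2 y.
Hypothesis q4Z : forall (c : R) y, 0 < c -> q4 (c *: y) = c ^+ 4 * q4 y.
Hypothesis q2Z : forall (c : R) y, 0 < c -> q2 (c *: y) = c ^+ 2 * q2 y.
Hypothesis K_ge0 : 0 <= K.
Hypothesis q4_le : forall y, q4 y <= K * dotp y y ^+ 2.
Hypothesis q2_le : forall y, q2 y <= K * dotp y y.
Hypothesis gq4 : has_gint q4 (@gtot R n * a4).
Hypothesis gq2 : has_gint q2 (@gtot R n * a2).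

(* At the origin the division by [0] gives the value [0]. *)
Definition hom2 y := q4 y / dotp y y.

Lemma hom2_ge0 y : 0 <= hom2 y.
Proof. by rewrite divr_ge0// dotp_ge0. Qed.

Lemma hom2_le y : hom2 y <= K * dotp y y.
Proof.
rewrite /hom2; have [->|y0] := eqVneq (dotp y y) 0; first by rewrite invr0 !mulr0.
have p : 0 < dotp y y by rewrite lt_def y0 dotp_ge0.
by rewrite ler_pdivrMr// -mulrA -expr2.
Qed.

(** Where [dotp y y = 0] the quotient is [0] by convention, and [q4_le] forces [q4 y = 0] as
    well. *)
Lemma hom2_dotp y : hom2 y * dotp y y = q4 y.
Proof.
rewrite /hom2; have [y0|y0] := eqVneq (dotp y y) 0; last by rewrite divfK.
rewrite y0 mulr0; apply/esym/eqP; rewrite eq_le q4_ge0 andbT.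
by have := q4_le y; rewrite y0 expr0n/= mulr0.
Qed.

Lemma hom2Z (c : R) y : 0 < c -> hom2 (c *: y) = c ^+ 2 * hom2 y.
Proof.
move=> c0; rewrite /hom2 q4Z// dotpZ invfM.
have c2 : c ^+ 2 != 0 by rewrite expf_neq0// gt_eqF.
by rewrite [RHS]mulrA [in RHS](_ : c ^+ 2 = c ^+ 4 / c ^+ 2); [ring|field; rewrite gt_eqF].
Qed.

Lemma measurable_hom2 : measurable_fun setT hom2.
Proof.
rewrite (_ : hom2 = fun y => q4 y * dotp y y `^ (-1)); last first.
  by apply/funext => y; rewrite powR_inv1 ?dotp_ge0.
apply: measurable_funM => //.
by apply: (measurableT_comp (@measurable_powR R (-1))); exact: measurable_dotp.
Qed.

Lemma has_gint_dotp_sqr : exists v, has_gint (fun y : 'rV[R]_n => dotp y y ^+ 2) v.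
Proof.
eexists; apply: eq_has_gint; last first.
  apply: (has_gint_sum (index_enum _) (g := fun i y => \sum_k (y 0 i * y 0 i * (y 0 k * y 0 k)))) => i.
  by apply: has_gint_sum => k; exact: has_gint_coord4.
by move=> y /=; rewrite dotpE expr2 mulr_suml; apply: eq_bigr => i _; rewrite mulr_sumr.
Qed.

Lemma has_gint_dotp : exists v, has_gint (fun y : 'rV[R]_n => dotp y y) v.
Proof.
eexists; apply: eq_has_gint; last first.
  apply: (has_gint_sum (index_enum _) (g := fun i y => (y 0 i * y 0 i))) => i.
  exact: has_gint_coord2.
by move=> y /=; rewrite dotpE.
Qed.

(** [integral_mulexp_sublevel] applied to [hom2], of degree 2: since
    [hom2 y * (dotp y y + 1) = q4 y + hom2 y], the integral of [q4] is [(n + 2) / 2] times that of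
    [hom2]. *)
Lemma has_gint_hom2 : has_gint hom2 (@gtot R n * (a4 / (n%:R / 2 + 1))).
Proof.
have [v gv] := has_gint_dotp.
have ih : gintegrable hom2.
  apply: (gintegrable_le measurable_hom2 (h := fun y => K * dotp y y)).
    by move=> y; rewrite ger0_norm ?hom2_ge0 ?hom2_le.
  by have [] := has_gintZ K gv.
have := has_gint_fine ih; set w := fine _ => gw.
suff -> : @gtot R n * (a4 / (n%:R / 2 + 1)) = w by [].
have := @integral_mulexp_sublevel R n 2 hom2 (fun y => dotp y y) measurable_hom2
  measurable_dotp hom2_ge0 dotp_ge0 hom2Z (fun c y _ => dotpZ c y).
have [_ gsum] := has_gintD gq4 gw.
rewrite -/(gint hom2) gw.2.
have -> : (\int[lebesgue_rV n]_y (hom2 y * (dotp y y + 1) * expR (- dotp y y))%:E)%E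
    = (@gtot R n * a4 + w)%:E.
  rewrite -gsum; apply: eq_integral => y _; congr (_ * _)%:E.
  by rewrite mulrDr mulr1 hom2_dotp.
rewrite -EFinM => -[]; rewrite natrD => E.
have n0 : n%:R / 2 + 1 != 0 :> R by rewrite gt_eqF// ltr_wpDl// divr_ge0.
apply: (mulIf n0); rewrite mulrA divfK// -[LHS](addrK w) E.
by field.
Qed.

(* Homogeneous of degree 2 whatever [t] is; for [t = eps ^+ 2] its sublevel set at
   [eps ^+ 2] agrees with [{|y|^2 + q4 y <= eps ^+ 2}] up to higher order terms. *)
Definition Phi (t : R) y := dotp y y + t * hom2 y.

Lemma Phi_ge0 t y : 0 <= t -> 0 <= Phi t y.
Proof. by move=> t0; rewrite addr_ge0 ?dotp_ge0// mulr_ge0 ?hom2_ge0. Qed.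

Lemma PhiZ t (c : R) y : 0 < c -> Phi t (c *: y) = c ^+ 2 * Phi t y.
Proof. by move=> c0; rewrite /Phi dotpZ hom2Z//; ring. Qed.

Lemma measurable_Phi t : measurable_fun setT (Phi t).
Proof.
apply: measurable_funD; first exact: measurable_dotp.
by apply: measurable_funM => //; exact: measurable_hom2.
Qed.

Lemma expR_Phi t y : expR (- Phi t y) = expR (- (t * hom2 y)) * gauss y.
Proof. by rewrite /Phi opprD addrC expRD. Qed.

(** From [1 + x <= expR x] and [(1 + x) * (1 - x + x ^+ 2) = 1 + x ^+ 3]. *)
Lemma expRN_le (x : R) : 0 <= x -> expR (- x) <= 1 - x + x ^+ 2.
Proof.
move=> x0; rewrite expRN; apply: (@le_trans _ _ ((1 + x)^-1)).
  by rewrite lef_pV2 ?posrE ?expR_gt0 ?expR_ge1Dx// ltr_wpDr.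
by rewrite -[leLHS]mul1r ler_pdivrMr ?ltr_wpDr//; nra.
Qed.

Let G := Gamma (n%:R / 2 + 1 : R).

Lemma Gamma_half_gt0 : 0 < G.
Proof. by rewrite /G GammaE; have [g g0 ->] := @egamma_half_fin R n. Qed.

Lemma egamma_halfE : egamma (n%:R / 2 : R) = G%:E.
Proof. by rewrite /G GammaE; have [g g0 ->] := @egamma_half_fin R n. Qed.

Let gint_exp (g : 'rV[R]_n -> R) t : 0 <= t -> measurable_fun setT g ->
  (forall y, 0 <= g y) -> gintegrable g ->
  exists2 w, has_gint (fun y => g y * expR (- (t * hom2 y))) w &
     (\int[lebesgue_rV n]_y (g y * expR (- Phi t y))%:E)%E = w%:E.
Proof.
move=> t0 mg g0 ig.
have gi : gintegrable (fun y => g y * expR (- (t * hom2 y))).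
  apply: (gintegrable_le (h := g)) => //.
    apply: measurable_funM => //; apply: measurableT_comp => //.
    by apply: measurable_funN; apply: measurable_funM => //; exact: measurable_hom2.
  move=> y; rewrite ger0_norm ?mulr_ge0 ?expR_ge0//.
  by rewrite ler_piMr// -expR0 ler_expR oppr_le0 mulr_ge0// hom2_ge0.
eexists; first exact: has_gint_fine gi.
rewrite -(has_gint_fine gi).2; apply: eq_integral => y _.
by rewrite expR_Phi mulrA.
Qed.

Let b := a4 / (n%:R / 2 + 1).

(** Up to the factor [G], the volume is the Gaussian integral of [expR (- (t * hom2 y))], which lies
    between [1 - t * hom2 y] and the same plus its quadratic term. The constant [B] is uniform in
    [t] because [hom2 y] is at most [K * dotp y y]. *)
Lemma sublevel_volume : exists2 B : R, 0 <= B & forall t, 0 <= t -> exists v : R,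
  (\int[lebesgue_rV n]_(y in [set y | (Phi t y <= 1)%R]) 1%:E)%E = v%:E /\
  @gtot R n / G * (1 - t * b) <= v <= @gtot R n / G * (1 - t * b + t ^+ 2 * B).
Proof.
have G0 := Gamma_half_gt0; have c0 := @gtot_gt0 R n.
have [v gv] := has_gint_dotp_sqr.
have gv2 := has_gintZ (K ^+ 2) gv.
have v0 : 0 <= K ^+ 2 * v.
  apply: (has_gint_le _ has_gint0 gv2) => y.
  by rewrite mulr_ge0 ?sqr_ge0.
exists (K ^+ 2 * v / @gtot R n); first by rewrite divr_ge0// ltW.
move=> t t0.
have [w gw] := @gint_exp (fun=> 1) t t0 (measurable_cst _) (fun=> ler01) (has_gint_one).1.
have E := @integral_exp_sublevel R n 0 (fun=> 1) (Phi t) (measurable_cst _)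
  (measurable_Phi t) (fun=> ler01) (fun y => Phi_ge0 y t0)
  (fun c y _ => esym (mulr1 _)) (PhiZ t).
rewrite E addn0 egamma_halfE => Ew.
set nu := (\int[_]_(y in _) _)%E in Ew *.
(* [nu] is so far an extended real; it is finite because its product with the positive number [G]
   is. *)
have nuE : nu = (w / G)%:E.
  move: Ew; case: nu => [r||] //=.
  - by rewrite -EFinM => -[<-]; rewrite mulrAC divff ?mul1r// gt_eqF.
  - by rewrite gt0_muley ?lte_fin.
  - by rewrite gt0_muleNy ?lte_fin.
exists (w / G); split=> //.
have gh := has_gint_hom2.
have L : @gtot R n - t * (@gtot R n * b) <= w.
  have gl := has_gintD has_gint_one (has_gintZ (- t) gh).
  rewrite -mulNr; apply: has_gint_le gl gw => y.
  by rewrite mul1r mulNr expR_ge1Dx.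
have U : w <= @gtot R n - t * (@gtot R n * b) + t ^+ 2 * (K ^+ 2 * v).
  have gl := has_gintD (has_gintD has_gint_one (has_gintZ (- t) gh)) (has_gintZ (t ^+ 2) gv2).
  rewrite -mulNr; apply: has_gint_le gw gl => y.
  rewrite mul1r mulNr; apply: le_trans (expRN_le _) _.
    by rewrite mulr_ge0 ?hom2_ge0.
  rewrite lerD2l exprMn ler_wpM2l ?sqr_ge0// -exprMn.
  by rewrite ler_pXn2r ?nnegrE ?hom2_ge0 ?hom2_le// mulr_ge0 ?dotp_ge0.
have -> : @gtot R n / G * (1 - t * b) = (@gtot R n - t * (@gtot R n * b)) / G by ring.
have -> : @gtot R n / G * (1 - t * b + t ^+ 2 * (K ^+ 2 * v / @gtot R n)) =
  (@gtot R n - t * (@gtot R n * b) + t ^+ 2 * (K ^+ 2 * v)) / G.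
  by field; rewrite !gt_eqF.
by rewrite !ler_pM2r ?invr_gt0// L U.
Qed.

(** One order less than for the volume is enough, since this moment enters the expansion multiplied
    by [eps ^+ 2]. The factor [n / 2 + 1] comes from [egammaS], [q2] having degree 2. *)
Lemma sublevel_moment : exists2 B : R, 0 <= B & forall t, 0 <= t -> exists v : R,
  (\int[lebesgue_rV n]_(y in [set y | (Phi t y <= 1)%R]) (q2 y)%:E)%E = v%:E /\
  @gtot R n / G / (n%:R / 2 + 1) * (a2 - t * B) <= v <=
  @gtot R n / G / (n%:R / 2 + 1) * a2.
Proof.
have G0 := Gamma_half_gt0; have c0 := @gtot_gt0 R n.
have n0 : 0 < n%:R / 2 + 1 :> R by rewrite ltr_wpDl// divr_ge0.
have [v gv] := has_gint_dotp_sqr.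
have gv2 := has_gintZ (K ^+ 2) gv.
have v0 : 0 <= K ^+ 2 * v.
  apply: (has_gint_le _ has_gint0 gv2) => y.
  by rewrite mulr_ge0 ?sqr_ge0.
exists (K ^+ 2 * v / @gtot R n); first by rewrite divr_ge0// ltW.
move=> t t0.
have [w gw] := gint_exp t0 mq2 q2_ge0 gq2.1.
have E := @integral_exp_sublevel R n 2 q2 (Phi t) mq2
  (measurable_Phi t) q2_ge0 (fun y => Phi_ge0 y t0) q2Z (PhiZ t).
have n2 : (n + 2)%:R / 2 = n%:R / 2 + 1 :> R by rewrite natrD mulrDl divff.
rewrite E n2 egammaS egamma_halfE -EFinM => Ew.
set nu := (\int[_]_(y in _) _)%E in Ew *.
have nG : 0 < (n%:R / 2 + 1) * G by rewrite mulr_gt0.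
have nuE : nu = (w / ((n%:R / 2 + 1) * G))%:E.
  move: Ew; case: nu => [r||] //=.
  - by rewrite -EFinM => -[<-]; rewrite mulrAC divff ?mul1r// gt_eqF.
  - by rewrite gt0_muley ?lte_fin.
  - by rewrite gt0_muleNy ?lte_fin.
exists (w / ((n%:R / 2 + 1) * G)); split=> //.
have L : @gtot R n * a2 - t * (K ^+ 2 * v) <= w.
  have gl := has_gintD gq2 (has_gintZ (- t) gv2).
  rewrite -mulNr; apply: has_gint_le gl gw => y.
  apply: (@le_trans _ _ (q2 y * (1 - t * hom2 y))); last first.
    by rewrite ler_wpM2l// expR_ge1Dx.
  rewrite mulrBr mulr1 lerD2l mulNr lerN2 mulrCA ler_wpM2l//.
  by rewrite expr2 expr2 mulrACA ler_pM ?hom2_ge0 ?hom2_le.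
have U : w <= @gtot R n * a2.
  apply: has_gint_le gw gq2 => y.
  by rewrite ler_piMr// -expR0 ler_expR oppr_le0 mulr_ge0// hom2_ge0.
have -> : @gtot R n / G / (n%:R / 2 + 1) = @gtot R n / ((n%:R / 2 + 1) * G).
  by rewrite invfM mulrA mulrAC.
set H := (_ + 1) * G in nG *.
have -> : @gtot R n / H * (a2 - t * (K ^+ 2 * v / @gtot R n)) =
  (@gtot R n * a2 - t * (K ^+ 2 * v)) / H.
  by field; rewrite !gt_eqF.
have -> : @gtot R n / H * a2 = @gtot R n * a2 / H by ring.
by rewrite !ler_pM2r ?invr_gt0// L U.
Qed.

(* The radius is written [c] rather than [sqrt u] to keep natural exponents. *)
Lemma integral_Phi_sublevel t c : 0 <= t -> 0 < c ->
  (\int[lebesgue_rV n]_(y in [set y | (Phi t y <= c ^+ 2)%R]) 1%:E =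
   (c ^+ n)%:E * \int[lebesgue_rV n]_(y in [set y | (Phi t y <= 1)%R]) 1%:E)%E /\
  (\int[lebesgue_rV n]_(y in [set y | (Phi t y <= c ^+ 2)%R]) (q2 y)%:E =
   (c ^+ (n + 2))%:E * \int[lebesgue_rV n]_(y in [set y | (Phi t y <= 1)%R]) (q2 y)%:E)%E.
Proof.
move=> t0 c0; split.
  have := @integral_sublevel_scale R n 0 (fun=> 1) (Phi t) (measurable_cst _)
   (measurable_Phi t) (fun=> ler01) (fun c y _ => esym (mulr1 _)) (PhiZ t) c c0.
  by rewrite addn0.
exact: (@integral_sublevel_scale R n 2 q2 (Phi t) mq2
   (measurable_Phi t) q2_ge0 q2Z (PhiZ t) c c0).
Qed.

End SublevelAsymptotics.

(** * Taylor expansions *)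
Section OrderOfMagnitude.
Context {R : realType} {T : Type} (F : set_system T) {FF : Filter F} (N : T -> R).
Hypothesis N01 : \forall x \near F, 0 <= N x <= 1.
Implicit Types (u v : T -> R) (d e : nat).

(** [u = O(N ^+ d)] along [F]. The gauge [N] is the norm at the origin of [R^n] and the identity at
    [0^'+], so both asymptotics share one calculus; [N <= 1] lets a higher order imply a lower
    one. *)
Definition order_ge d u : Prop :=
  exists2 C : R, 0 <= C & \forall x \near F, `|u x| <= C * N x ^+ d.

Lemma order_ge_near d u v : (\forall x \near F, u x = v x) ->
  order_ge d u -> order_ge d v.
Proof.
move=> uv [C C0 uC]; exists C => //.
by near=> x; rewrite -(near uv x)//; near: x.
Unshelve. all: by end_near. Qed.

Lemma eq_order_ge d u v : u =1 v -> order_ge d u -> order_ge d v.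
Proof. by move=> uv; apply: order_ge_near; exact: nearW. Qed.

Lemma order_ge_le d e u : (d <= e)%N -> order_ge e u -> order_ge d u.
Proof.
move=> de [C C0 uC]; exists C => //.
near=> x; have /andP[n0 n1] : 0 <= N x <= 1 by near: x.
apply: (@le_trans _ _ (C * N x ^+ e)); first by near: x.
by rewrite ler_wpM2l// ler_wiXn2l.
Unshelve. all: by end_near. Qed.

Lemma order_ge_cst (c : R) : order_ge 0 (fun=> c).
Proof. by exists `|c| => //; apply: nearW => x; rewrite expr0 mulr1. Qed.

Lemma order_ge0 d : order_ge d (fun=> 0).
Proof. by exists 0 => //; apply: nearW => x; rewrite normr0 mul0r. Qed.

Lemma order_geD d u v : order_ge d u -> order_ge d v -> order_ge d (fun x => u x + v x).
Proof.
move=> [C C0 uC] [D D0 vD]; exists (C + D); first by rewrite addr_ge0.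
near=> x; rewrite (le_trans (ler_normD _ _))// mulrDl lerD//; by near: x.
Unshelve. all: by end_near. Qed.

Lemma order_geM d e u v : order_ge d u -> order_ge e v ->
  order_ge (d + e) (fun x => u x * v x).
Proof.
move=> [C C0 uC] [D D0 vD]; exists (C * D); first by rewrite mulr_ge0.
near=> x; rewrite normrM exprD mulrACA ler_pM//; by near: x.
Unshelve. all: by end_near. Qed.

Lemma order_geZ d (c : R) u : order_ge d u -> order_ge d (fun x => c * u x).
Proof. by move=> uO; have := order_geM (order_ge_cst c) uO; rewrite add0n. Qed.

Lemma order_geN d u : order_ge d u -> order_ge d (fun x => - u x).
Proof. by move=> /(order_geZ (-1)); apply: eq_order_ge => x; rewrite mulN1r. Qed.

Lemma order_geB d u v : order_ge d u -> order_ge d v -> order_ge d (fun x => u x - v x).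
Proof. by move=> uO vO; apply: order_geD => //; exact: order_geN. Qed.

Lemma order_ge_sum d (I : Type) (s : seq I) (P : pred I) (u : I -> T -> R) :
  (forall i, P i -> order_ge d (u i)) -> order_ge d (fun x => \sum_(i <- s | P i) u i x).
Proof.
move=> uO; elim: s => [|i s IHs].
  by apply: eq_order_ge (order_ge0 d) => x; rewrite big_nil.
case: (boolP (P i)) => [Pi|nPi].
  by apply: eq_order_ge (order_geD (uO i Pi) IHs) => x; rewrite big_cons Pi.
by apply: eq_order_ge IHs => x; rewrite big_cons (negbTE nPi).
Qed.

Lemma order_ge_prod0 (I : Type) (s : seq I) (P : pred I) (u : I -> T -> R) :
  (forall i, P i -> order_ge 0 (u i)) -> order_ge 0 (fun x => \prod_(i <- s | P i) u i x).
Proof.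
move=> uO; elim: s => [|i s IHs].
  by apply: eq_order_ge (order_ge_cst 1) => x; rewrite big_nil.
case: (boolP (P i)) => [Pi|nPi].
  by apply: eq_order_ge (order_geM (uO i Pi) IHs) => x; rewrite big_cons Pi.
by apply: eq_order_ge IHs => x; rewrite big_cons (negbTE nPi).
Qed.

End OrderOfMagnitude.

Section PartialDerivatives.
Context {R : realType} {n : nat}.
Implicit Types (u : 'rV[R]_n -> R) (x y v : 'rV[R]_n).

Lemma coord_le_norm m p (x : 'M[R]_(m, p)) i j : `|x i j| <= `|x|.
Proof.
rewrite [leRHS]/Num.Def.normr/= mx_normrE.
exact: (le_bigmax _ (fun ij => `|x ij.1 ij.2|) (i, j)).
Qed.

Lemma derive_partials u x v : differentiable u x ->
  'D_v u x = \sum_i v 0 i * 'D_(basis_rV i) u x.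
Proof.
move=> du; rewrite deriveE// {1}(row_sum_delta v) linear_sum; apply: eq_bigr => i _.
by rewrite linearZ/= deriveE.
Qed.

Lemma is_derive_line u x w (s : R) : differentiable u (s *: x + w) ->
  is_derive s 1 (fun r : R => u (r *: x + w)) ('D_x u (s *: x + w)).
Proof.
move=> du; have dux : derivable u (s *: x + w) x by exact: diff_derivable.
have E : (fun h : R => h^-1 *: (u (h *: x + (s *: x + w)) - u (s *: x + w))) =
         (fun h : R => h^-1 *: (u ((h *: 1 + s) *: x + w) - u (s *: x + w))).
  by apply/funext => h; rewrite scalerDl [h *: 1]mulr1 addrA.
apply: DeriveDef.
  change (cvg ((fun h : R => h^-1 *: (u (h *: x + (s *: x + w)) - u (s *: x + w))) @ 0^')) in dux.
  by rewrite E in dux.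
change (lim ((fun h : R => h^-1 *: (u ((h *: 1 + s) *: x + w) - u (s *: x + w))) @ 0^') =
        lim ((fun h : R => h^-1 *: (u (h *: x + (s *: x + w)) - u (s *: x + w))) @ 0^')).
by rewrite E.
Qed.

Lemma is_derive_coord x v i : is_derive x v (fun y : 'rV[R]_n => y 0 i) (v 0 i).
Proof.
apply: DeriveDef; first exact/diff_derivable/differentiable_coord.
have := @derive_mx R _ 1 n id x v (@derivable_id _ _ _ _).
by rewrite derive_id => /rowP/(_ i); rewrite mxE.
Qed.

(** The sup norm; the resulting bounds are made Euclidean at the end through [norm_le_enorm]. *)
Definition gauge0 := fun x : 'rV[R]_n => `|x|.

Lemma gauge0_le1 : \forall x \near (0 : 'rV[R]_n), 0 <= gauge0 x <= 1.
Proof.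
by apply/nbhs_norm0P; exists 1 => //= x /ltW x1; rewrite /gauge0 normr_ge0.
Qed.

Local Notation "'O' d" := (order_ge (nbhs (0 : 'rV[R]_n)) gauge0 d)
  (at level 10, d at level 9).

(** Mean value theorem on the segment from [0] to [x]. All the Taylor expansions below follow by
    applying it to a function minus its candidate polynomial. *)
Lemma order_ge_partials d u : (\forall x \near (0 : 'rV[R]_n), differentiable u x) ->
  u 0 = 0 -> (forall i, O d ('D_(basis_rV i) u)) -> O d.+1 u.
Proof.
move=> du u0 Du.
have [C C0 DC] : exists2 C : R, 0 <= C &
    \forall x \near (0 : 'rV[R]_n), forall i, `|'D_(basis_rV i) u x| <= C * `|x| ^+ d.
  have exC i : exists c : R, 0 <= c /\
      \forall x \near (0 : 'rV[R]_n), `|'D_(basis_rV i) u x| <= c * `|x| ^+ d.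
    by have [c c0 H] := Du i; exists c.
  have [c cP] := choice exC.
  exists (\sum_i c i); first by rewrite sumr_ge0// => i _; have [] := cP i.
  have : \forall x \near (0 : 'rV[R]_n), forall i, `|'D_(basis_rV i) u x| <= c i * `|x| ^+ d.
    exact: (@filter_forall _ 'I_n (fun i => [set x | `|'D_(basis_rV i) u x| <= c i * `|x| ^+ d]) (nbhs (0 : 'rV[R]_n)) _ (fun i => (cP i).2)).
  apply: filterS => x xP i; rewrite (le_trans (xP i))// ler_wpM2r ?exprn_ge0//.
  by rewrite (bigD1 i)//= lerDl sumr_ge0// => j _; have [] := cP j.
have /nbhs_norm0P[e /= e0 eP] : \forall x \near (0 : 'rV[R]_n),
    differentiable u x /\ forall i, `|'D_(basis_rV i) u x| <= C * `|x| ^+ d.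
  exact: filterI du DC.
(* The derivative along [x] is a sum of [n] terms, each a coordinate of [x] times a partial
   derivative. *)
exists (n%:R * C); first by rewrite mulr_ge0.
suff : \forall x \near (0 : 'rV[R]_n), `|u x| <= n%:R * C * `|x| ^+ d.+1 by [].
apply/nbhs_norm0P; exists e => //= x xe.
have inball (s : R) : 0 <= s <= 1 -> `|s *: x| <= `|x| /\ `|s *: x| < e.
  move=> /andP[s0 s1]; have : `|s *: x| <= `|x|.
    by rewrite normrZ ger0_norm// ler_piMl.
  by move=> sx; split=> //; exact: le_lt_trans sx xe.
pose phi := fun s : R => u (s *: x).
have dphi (s : R) : 0 <= s <= 1 -> is_derive s 1 phi ('D_x u (s *: x)).
  move=> s01; have := @is_derive_line u x 0 s; rewrite addr0 /phi.
  rewrite (_ : (fun r : R => u (r *: x + 0)) = fun r => u (r *: x)); last first.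
    by apply/funext => r; rewrite addr0.
  by apply; have [] := eP (s *: x) (inball s s01).2.
have [||c c01 E] := @MVT_segment R phi (fun s => 'D_x u (s *: x)) 0 1 ler01.
- by move=> s; rewrite in_itv/= => /andP[s0 s1]; apply: dphi; rewrite !ltW.
- apply: derivable_within_continuous => s; rewrite in_itv/= => s01.
  by have [] := dphi s s01.
rewrite in_itv/= in c01; have [cx ce] := inball c c01.
have [duc Dc] := eP _ ce.
move: E; rewrite /phi scale0r u0 scale1r !subr0 mulr1 => ->.
rewrite derive_partials// (le_trans (ler_norm_sum _ _ _))//.
apply: (@le_trans _ _ (\sum_(i < n) C * `|x| ^+ d.+1)); last first.
  by rewrite sumr_const card_ord -[leLHS]mulr_natl mulrA.
apply: ler_sum => i _; rewrite exprS normrM mulrCA.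
apply: ler_pM => //; first exact: coord_le_norm.
by rewrite (le_trans (Dc i))// ler_wpM2l// lerXn2r ?nnegrE.
Qed.

End PartialDerivatives.

Section Taylor.
Context {R : realType} {n k : nat}.
Variables (B : set 'rV[R]_n) (f : 'rV[R]_n -> 'rV[R]_k).
Hypothesis Bopen : open B.
Hypothesis B0 : B 0.
Hypothesis fsmooth : smooth_on B f.

Local Notation "'O' d" := (order_ge (nbhs (0 : 'rV[R]_n)) gauge0 d)
  (at level 10, d at level 9).

(** The head of [s] is the derivative taken last. *)
Definition partial (s : seq 'I_n) (a : 'I_k) (x : 'rV[R]_n) : R :=
  iter_partial s f x 0 a.

Lemma near_B (x : 'rV[R]_n) : B x -> \forall y \near x, B y.
Proof. by move=> Bx; apply: open_nbhs_nbhs. Qed.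

Lemma differentiable_partial s a x : B x -> differentiable (partial s a) x.
Proof.
move=> Bx; apply: (@differentiable_comp _ _ _ _ (iter_partial s f) (fun y => y 0 a)).
  exact: fsmooth.
exact: differentiable_coord.
Qed.

Lemma derive_partial s a i x : B x ->
  'D_(basis_rV i) (partial s a) x = partial (i :: s) a x.
Proof.
move=> Bx; rewrite /partial /= derive_mx ?mxE//.
by apply: diff_derivable; exact: fsmooth.
Qed.

Lemma partial_order0 s a : O 0 (partial s a).
Proof.
have c : {for 0, continuous (partial s a)}.
  by apply: differentiable_continuous; exact: differentiable_partial.
exists (`|partial s a 0| + 1); first by rewrite addr_ge0.
have := c; move=> /cvgr_dist_lt /(_ 1 ltr01); apply: filterS => x.
rewrite expr0 mulr1 => /ltW; rewrite distrC => d1.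
rewrite -[in leLHS](subrK (partial s a 0) (partial s a x)).
by rewrite addrC (le_trans (ler_normD _ _))// lerD2l.
Qed.

Lemma is_derive_affine (c : R) (g : 'I_n -> R) (x v : 'rV[R]_n) :
  is_derive x v (fun y : 'rV[R]_n => c + \sum_i y 0 i * g i) (\sum_i v 0 i * g i).
Proof.
rewrite -[X in is_derive _ _ _ X]add0r; apply: is_deriveD.
rewrite (_ : (fun _ => _) = \sum_i (fun y : 'rV[R]_n => y 0 i * g i)); last first.
  by apply/funext => y; rewrite fct_sumE.
apply: is_derive_sum => i.
have D := @is_deriveM _ _ (fun y : 'rV[R]_n => y 0 i) (cst (g i)) x v _ _
  (is_derive_coord x v i) (is_derive_cst _ _ _).
by apply: (is_derive_eq D); rewrite scaler0 add0r /GRing.scale/= mulrC.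
Qed.

Lemma derive_basis_affine (c : R) (g : 'I_n -> R) (x : 'rV[R]_n) i :
  'D_(basis_rV i) (fun y : 'rV[R]_n => c + \sum_j y 0 j * g j) x = g i.
Proof.
have [_ ->] := is_derive_affine c g x (basis_rV i).
rewrite (bigD1 i)//= big1 ?addr0; first by rewrite mxE !eqxx mul1r.
by move=> j ji; rewrite mxE eqxx (negbTE ji) mul0r.
Qed.

Lemma order_ge_partials_sub d u w :
  (\forall x \near (0 : 'rV[R]_n), differentiable u x) ->
  (\forall x \near (0 : 'rV[R]_n), differentiable w x) ->
  u 0 = w 0 ->
  (forall i, O d (fun x => 'D_(basis_rV i) u x - 'D_(basis_rV i) w x)) ->
  O d.+1 (fun x => u x - w x).
Proof.
move=> du dw uw Duw; apply: (@order_ge_partials _ _ d (u - w)).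
- near=> x; apply: differentiableB; by near: x.
- by apply/eqP; rewrite subr_eq0 uw.
- move=> i; apply: order_ge_near (Duw i); near=> x.
  by rewrite deriveB//; apply: diff_derivable; near: x.
Unshelve. all: by end_near. Qed.

Lemma differentiable_affine (c : R) (g : 'I_n -> R) (x : 'rV[R]_n) :
  differentiable (fun y : 'rV[R]_n => c + \sum_i y 0 i * g i) x.
Proof.
apply: differentiableD => //.
rewrite (_ : (fun _ => _) = \sum_i (fun y : 'rV[R]_n => y 0 i * g i)); last first.
  by apply/funext => y; rewrite fct_sumE.
apply: differentiable_sum => i.
by apply: differentiableM => //; exact: differentiable_coord.
Qed.

Lemma partial_near_diff s a : \forall x \near (0 : 'rV[R]_n), differentiable (partial s a) x.
Proof.
near=> x; apply: differentiable_partial; near: x; exact: near_B.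
Unshelve. all: by end_near. Qed.

Lemma partial_near_derive s a i : \forall x \near (0 : 'rV[R]_n),
   partial (i :: s) a x = 'D_(basis_rV i) (partial s a) x.
Proof.
near=> x; rewrite derive_partial//; near: x; exact: near_B.
Unshelve. all: by end_near. Qed.

Lemma partial_taylor1 s a : O 1 (fun x => partial s a x - partial s a 0).
Proof.
apply: (@order_ge_partials_sub 0 _ (cst (partial s a 0))) => //.
- exact: partial_near_diff.
- by near=> x; exact: differentiable_cst.
- move=> i; apply: order_ge_near (partial_order0 (i :: s) a).
  near=> x; rewrite derive_cst subr0; near: x; exact: partial_near_derive.
Unshelve. all: by end_near. Qed.

Lemma partial_taylor2 s a : O 2 (fun x =>
  partial s a x - (partial s a 0 + \sum_i x 0 i * partial (i :: s) a 0)).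
Proof.
apply: (@order_ge_partials_sub 1).
- exact: partial_near_diff.
- by near=> x; exact: differentiable_affine.
- by rewrite big1 ?addr0// => i _; rewrite mxE mul0r.
- move=> i; apply: order_ge_near (partial_taylor1 (i :: s) a).
  near=> x; rewrite derive_basis_affine; congr (_ - _); near: x.
  exact: partial_near_derive.
Unshelve. all: by end_near. Qed.

(* Both mixed partials are limits of the same symmetric second difference, by
   the mean value theorem along one coordinate and the Taylor expansion of the
   first partial derivative. *)
Lemma second_difference a i j : exists2 C : R, 0 <= C &
  \forall s \near (0 : R)^'+,
   `|partial [::] a (s *: basis_rV i + s *: basis_rV j) - partial [::] a (s *: basis_rV i)
     - partial [::] a (s *: basis_rV j) + partial [::] a 0
     - s ^+ 2 * partial [:: j; i] a 0| <= C * s ^+ 3.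
Proof.
have [C C0] := partial_taylor2 [:: i] a.
rewrite /gauge0 => TC.
have /nbhs_norm0P[e /= e0 eP] : \forall x \near (0 : 'rV[R]_n), B x /\
   `|partial [:: i] a x - (partial [:: i] a 0 + \sum_l x 0 l * partial [:: l; i] a 0)| <= C * `|x| ^+ 2.
  exact: filterI (near_B B0) TC.
(* The Taylor remainders at two points of norm at most [2 s] and [s] contribute [4 + 1]. *)
exists (C * 5); first by rewrite mulr_ge0.
near=> s; have s0 : 0 < s by near: s; exact: nbhs_right_gt.
have se : s < e / 2 by near: s; apply: nbhs_right_lt; rewrite divr_gt0.
have nb l : `|basis_rV l : 'rV[R]_n| <= 1.
  rewrite [leLHS]/Num.Def.normr/= mx_normrE; apply: bigmax_le => // -[p q] _ /=.
  by rewrite mxE; case: (_ && _); rewrite ?normr1 ?normr0.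
have n1 (r : R) l : 0 <= r <= s -> `|r *: basis_rV l : 'rV[R]_n| <= s.
  move=> /andP[r0 rs]; rewrite normrZ ger0_norm//.
  by rewrite (le_trans (ler_wpM2l r0 (nb l)))// mulr1.
have n2 (r : R) l m : 0 <= r <= s -> `|r *: basis_rV l + s *: basis_rV m : 'rV[R]_n| <= s *+ 2.
  move=> rs; rewrite (le_trans (ler_normD _ _))// mulr2n lerD//; first exact: n1.
  by apply: n1; rewrite lexx ltW.
have s2e : s *+ 2 < e by rewrite -mulr_natr -ltr_pdivlMr.
have s1e : s < e by rewrite (le_lt_trans _ s2e)// mulr2n lerDl ltW.
pose u := partial [::] a.
(* The difference in direction [j], as a function of the position along direction [i]; its increment
   over [[0, s]] is the second difference. The term [+ 0] gives both lines the form required by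
   [is_derive_line]. *)
pose phi := fun r : R => u (r *: basis_rV i + s *: basis_rV j) - u (r *: basis_rV i + 0).
pose dphi := fun r : R => partial [:: i] a (r *: basis_rV i + s *: basis_rV j)
                        - partial [:: i] a (r *: basis_rV i + 0).
have Dphi (r : R) : 0 <= r <= s -> is_derive r 1 phi (dphi r).
  move=> rs; rewrite /dphi -!derive_partial; last 2 first.
  - by rewrite addr0; apply: (eP _ _).1; exact: le_lt_trans (n1 r i rs) s1e.
  - by apply: (eP _ _).1; exact: le_lt_trans (n2 r i j rs) s2e.
  apply: is_deriveB; apply: is_derive_line; apply: differentiable_partial.
  - by apply: (eP _ _).1; exact: le_lt_trans (n2 r i j rs) s2e.
  - by rewrite addr0; apply: (eP _ _).1; exact: le_lt_trans (n1 r i rs) s1e.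
have [||c c01 E] := @MVT_segment R phi dphi 0 s (ltW s0).
- by move=> r; rewrite in_itv/= => /andP[r0 r1]; apply: Dphi; rewrite !ltW.
- apply: derivable_within_continuous => r; rewrite in_itv/= => rs.
  by have [] := Dphi r rs.
rewrite in_itv/= in c01.
have E' : u (s *: basis_rV i + s *: basis_rV j) - u (s *: basis_rV i)
     - u (s *: basis_rV j) + u 0 = dphi c * s.
  rewrite -[in RHS](subr0 s) -E /phi !scale0r !add0r !addr0.
  by rewrite opprB addrA addrAC.
rewrite -/u E'.
have [_ T1] := eP _ (le_lt_trans (n2 c i j c01) s2e).
have [_ T2] := eP _ (le_lt_trans (n1 c i c01) s1e).
set y := (c *: basis_rV i + s *: basis_rV j) in T1 *.
set z := (c *: basis_rV i) in T2 *.
set A := (X in `|X| <= _) in T1; set A' := (X in `|X| <= _) in T2.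
have -> : dphi c * s - s ^+ 2 * partial [:: j; i] a 0 = (A - A') * s.
  rewrite /dphi -/y addr0 -/z /A /A'.
  have -> : \sum_l y 0 l * partial [:: l; i] a 0 =
     \sum_l z 0 l * partial [:: l; i] a 0 + s * partial [:: j; i] a 0.
    under eq_bigr do rewrite mxE mulrDl; rewrite big_split/=; congr (_ + _).
    rewrite (bigD1 j)//= big1 ?addr0; first by rewrite !mxE !eqxx mulr1.
    by move=> l lj; rewrite !mxE eqxx (negbTE lj) mulr0 mul0r.
  ring.
rewrite normrM (gtr0_norm s0) exprSr mulrA ler_pM2r//.
rewrite (le_trans (ler_normB _ _))//.
apply: (@le_trans _ _ (C * (s *+ 2) ^+ 2 + C * s ^+ 2)); last first.
  by rewrite -mulr_natl; lra.
have y2 : `|y| <= s *+ 2 := n2 c i j c01.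
have z1 : `|z| <= s := n1 c i c01.
have s20 : 0 <= s *+ 2 by rewrite mulrn_wge0// ltW.
apply: lerD.
  by apply: (le_trans T1); apply: ler_wpM2l => //; apply: lerXn2r => //; rewrite nnegrE.
apply: (le_trans T2); apply: ler_wpM2l => //.
by apply: lerXn2r => //; rewrite nnegrE ?normr_ge0 ?(ltW s0).
Unshelve. all: by end_near. Qed.

Lemma partialC a i j : partial [:: i; j] a 0 = partial [:: j; i] a 0.
Proof.
have [C C0 HC] := second_difference a i j.
have [D D0 HD] := second_difference a j i.
set u := partial [:: i; j] a 0; set v := partial [:: j; i] a 0.
apply/eqP; rewrite -subr_eq0 -normr_le0; apply/ler_addgt0Pl => e e0.
rewrite addr0.
near (0 : R)^'+ => s.
have s0 : 0 < s by near: s; exact: nbhs_right_gt.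
have sCD : s <= e / (C + D + 1).
  by near: s; apply: nbhs_right_le; rewrite divr_gt0// ltr_wpDl// addr_ge0.
(* [Delta] is symmetric in [i] and [j], hence [s ^+ 2 * |u - v| <= (C + D) * s ^+ 3], and the choice
   of [s] makes this at most [s ^+ 2 * e]. *)
pose Delta (s : R) := partial [::] a (s *: basis_rV i + s *: basis_rV j) - partial [::] a (s *: basis_rV i)
     - partial [::] a (s *: basis_rV j) + partial [::] a 0.
have h1 : `|Delta s - s ^+ 2 * v| <= C * s ^+ 3 by near: s; exact: HC.
have h2 : `|Delta s - s ^+ 2 * u| <= D * s ^+ 3.
  rewrite (_ : Delta s = partial [::] a (s *: basis_rV j + s *: basis_rV i)
     - partial [::] a (s *: basis_rV j) - partial [::] a (s *: basis_rV i) + partial [::] a 0).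
    by near: s; exact: HD.
  by rewrite /Delta addrAC addrC [s *: _ + _]addrC; ring.
have s2 : 0 < s ^+ 2 by rewrite exprn_gt0.
rewrite -(ler_pM2l s2) -[s ^+ 2 in leLHS](ger0_norm (ltW s2)) -normrM.
rewrite mulrBr (_ : _ - _ = (Delta s - s ^+ 2 * v) - (Delta s - s ^+ 2 * u)); last by ring.
rewrite (le_trans (ler_normB _ _))// (le_trans (lerD h1 h2))//.
rewrite -mulrDl exprSr mulrA [leLHS]mulrAC mulrC ler_wpM2l ?(ltW s2)//.
rewrite ler_pdivlMr in sCD; last by rewrite ltr_wpDl// addr_ge0.
apply: le_trans sCD; rewrite mulrC ler_wpM2l ?(ltW s0)// lerDl//.
Unshelve. all: by end_near. Qed.

Hypothesis f0 : f 0 = 0.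
Hypothesis Jf0 : 'J f 0 = 0.

Lemma partial0 a : partial [::] a 0 = 0.
Proof. by rewrite /partial /= f0 mxE. Qed.

Lemma partial10 a i : partial [:: i] a 0 = 0.
Proof.
rewrite /partial /= deriveEjacobian ?Jf0 ?mulmx0 ?mxE//.
exact: (fsmooth [::]).
Qed.

Lemma partial_taylor1_first a i : O 2 (fun x =>
  partial [:: i] a x - \sum_l x 0 l * partial [:: l; i] a 0).
Proof.
by apply: eq_order_ge (partial_taylor2 [:: i] a) => x; rewrite partial10 add0r.
Qed.

Lemma derive_quadratic (g : 'I_n -> 'I_n -> R) (x : 'rV[R]_n) i :
  is_derive x (basis_rV i) (fun y : 'rV[R]_n => \sum_l \sum_m y 0 l * y 0 m * g l m)
   (\sum_m x 0 m * g i m + \sum_l x 0 l * g l i).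
Proof.
rewrite (_ : (fun _ => _) = \sum_l (fun y : 'rV[R]_n => y 0 l * (0 + \sum_m y 0 m * g l m))); last first.
  apply/funext => y; rewrite fct_sumE; apply: eq_bigr => l _.
  by rewrite add0r mulr_sumr; apply: eq_bigr => m _; rewrite mulrA.
have D l := @is_deriveM _ _ (fun y : 'rV[R]_n => y 0 l) (fun y => 0 + \sum_m y 0 m * g l m) x (basis_rV i) _ _
  (is_derive_coord x (basis_rV i) l) (is_derive_affine 0 (g l) x (basis_rV i)).
apply: (is_derive_eq (is_derive_sum D)).
rewrite big_split/= addrC; congr (_ + _).
  rewrite [LHS](bigD1 i)//= [X in _ + X]big1 ?addr0; last first.
    by move=> l li; rewrite mxE eqxx (negbTE li) scaler0.
  by rewrite mxE !eqxx add0r /GRing.scale/= mulr1.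
apply: eq_bigr => l _; rewrite /GRing.scale/=; congr (_ * _).
rewrite (bigD1 i)//= big1 ?addr0; first by rewrite mxE !eqxx mul1r.
by move=> m mi; rewrite mxE eqxx (negbTE mi) mul0r.
Qed.

Lemma partial_taylor_second a : O 3 (fun x => partial [::] a x -
  2^-1 * \sum_l \sum_m x 0 l * x 0 m * partial [:: l; m] a 0).
Proof.
have dq (x : 'rV[R]_n) i := derive_quadratic (fun l m => partial [:: l; m] a 0) x i.
pose q := fun x : 'rV[R]_n => \sum_l \sum_m x 0 l * x 0 m * partial [:: l; m] a 0.
have difq x : differentiable q x.
  rewrite /q (_ : (fun _ => _) = \sum_l (fun y : 'rV[R]_n => \sum_m y 0 l * y 0 m * partial [:: l; m] a 0)); last first.
    by apply/funext => y; rewrite fct_sumE.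
  apply: differentiable_sum => l.
  rewrite (_ : (fun _ => _) = \sum_m (fun y : 'rV[R]_n => y 0 l * y 0 m * partial [:: l; m] a 0)); last first.
    by apply/funext => y; rewrite fct_sumE.
  apply: differentiable_sum => m.
  apply: differentiableM => //; apply: differentiableM; exact: differentiable_coord.
apply: (@order_ge_partials_sub 2 _ (2^-1 *: q)).
- exact: partial_near_diff.
- by near=> x; exact: differentiableZ.
- rewrite partial0 -[LHS](mulr0 2^-1); congr (_ * _); rewrite /q big1// => l _.
  by rewrite big1// => m _; rewrite mxE !mul0r.
- move=> i; apply: order_ge_near (partial_taylor1_first a i).
  near=> x; rewrite deriveZ; last by have [] := dq x i.
  have [_ ->] := dq x i; congr (_ - _).
    near: x; exact: partial_near_derive.
  (* By symmetry of the Hessian the two sums of the derivative coincide and absorb the factor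
     [2^-1]. *)
  under [X in X + _]eq_bigr do rewrite partialC.
  by rewrite -mulr2n -[X in _ *: X]mulr_natl /GRing.scale/= mulrA mulVf ?mul1r.
Unshelve. all: by end_near. Qed.

End Taylor.

(** * Borel measurability on [R^n] and continuity of matrix operations *)

Section OpenMeasurable.
Context {R : realType} {n : nat}.

Definition rat_box (qr : 'rV[rat]_n * rat) : set 'rV[R]_n :=
  [set y | forall j, `|y 0 j - ratr (qr.1 0 j)| < ratr qr.2].

Lemma measurable_rat_box qr : measurable (rat_box qr).
Proof.
rewrite (_ : rat_box qr = \bigcap_(j in [set: 'I_n]) [set y : 'rV[R]_n | `|y 0 j - ratr (qr.1 0 j)| < ratr qr.2]); last first.
  by apply/seteqP; split=> y H j => [_|]; exact: H.
apply: fin_bigcap_measurable => // j _.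
rewrite -[X in measurable X]setTI.
apply: (measurable_fun_ltr (f := fun y : 'rV[R]_n => `|y 0 j - ratr (qr.1 0 j)|) (g := fun=> ratr qr.2)) => //.
apply: (measurableT_comp (@normr_measurable R setT)).
by apply: measurable_funB => //; exact: measurable_coord.
Qed.

(** The sigma-algebra is generated by coordinates, so [A] is written as a countable union of
    rational boxes; a box not contained in [A] is replaced by the empty set to keep the index type
    countable. *)
Lemma open_measurable_rV (A : set 'rV[R]_n) : open A -> measurable A.
Proof.
move=> oA.
pose F (qr : 'rV[rat]_n * rat) := if `[< rat_box qr `<=` A >] then rat_box qr else set0.
rewrite (_ : A = \bigcup_qr F qr).
  apply: countable_bigcupT_measurable => //.
  by move=> qr; rewrite /F; case: asboolP => // _; exact: measurable_rat_box.
apply/seteqP; split=> [x Ax|x [qr _]]; last first.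
  by rewrite /F; case: asboolP => // H; exact: H.
have : nbhs x A by exact: open_nbhs_nbhs.
move=> /nbhs_normP[e /= e0 eA].
have [r /andP[r0 re]] : exists r : rat, 0 < (ratr r : R) < e / 2.
  have /rat_in_itvoo[r rP] : 0 < e / 2 by rewrite divr_gt0.
  by exists r; rewrite in_itv/= in rP.
have exq j : exists q : rat, `|x 0 j - ratr q| < (ratr r : R).
  have /rat_in_itvoo[q] : x 0 j - ratr r < x 0 j + ratr r by lra.
  by rewrite in_itv/= => /andP[? ?]; exists q; rewrite ltr_norml; lra.
have [q qP] := choice exq.
have bA : rat_box (\row_j q j, r) `<=` A.
  move=> y yP; apply: eA; rewrite /= /ball_/= [ltLHS]/Num.Def.normr/= mx_normrE.
  apply: bigmax_lt => // -[i j] _ /=; rewrite !mxE (ord1 i).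
  have := yP j; rewrite /= mxE => yq; have := qP j.
  rewrite (_ : x 0 j - y 0 j = (x 0 j - ratr (q j)) - (y 0 j - ratr (q j))); last by ring.
  by move=> xq; rewrite (le_lt_trans (ler_normB _ _))//; lra.
exists (\row_j q j, r) => //; rewrite /F; case: asboolP => // _ j /=.
by rewrite mxE.
Qed.

Lemma measurable_fun_continuous_on (B A : set 'rV[R]_n) (u : 'rV[R]_n -> R) :
  open B -> (forall x, B x -> {for x, continuous u}) -> A `<=` B -> measurable A ->
  measurable_fun A u.
Proof.
move=> oB cu AB mA.
apply: (measurability _ (RGenOInfty.measurableE R)) => _ [_ [r ->] <-].
(* [u] is continuous only on [B], so its superlevel set becomes open after intersection with [B]. *)
rewrite (_ : A `&` _ = A `&` (B `&` [set x | r < u x])); last first.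
  apply/seteqP; split=> x /=; rewrite in_itv/= andbT => -[Ax].
    by move=> ux; split=> //; split=> //; exact: AB.
  by move=> [_ ux].
apply: measurableI => //; apply: open_measurable_rV.
rewrite openE => x [Bx ux]; apply: filterI; first exact: open_nbhs_nbhs.
by have := cu x Bx; move=> /cvgr_gt/(_ _ ux).
Qed.

End OpenMeasurable.

Section MatrixContinuity.
Context {R : realType}.

Lemma cvg_mx {T : Type} {F : set_system T} {FF : Filter F} m p (g : T -> 'M[R]_(m, p)) (l : 'M[R]_(m, p)) :
  (forall i j, g x i j @[x --> F] --> l i j) -> g x @[x --> F] --> l.
Proof.
move=> gl; apply/cvgrPdist_le => /= e e0.
have H i j : \forall x \near F, `|l i j - g x i j| <= e.
  by have /cvgrPdist_le := gl i j; apply.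
have : \forall x \near F, forall ij : 'I_m * 'I_p, `|l ij.1 ij.2 - g x ij.1 ij.2| <= e.
  exact: (@filter_forall _ _ (fun ij x => `|l ij.1 ij.2 - g x ij.1 ij.2| <= e) F _ (fun ij => H ij.1 ij.2)).
apply: filterS => x xe; rewrite [leLHS]/Num.Def.normr/= mx_normrE.
by apply: bigmax_le => [|[i j] _]; [exact: ltW|rewrite !mxE; exact: (xe (i, j))].
Qed.

Lemma continuous_mulmxr m p q (A : 'M[R]_(p, q)) :
  continuous (fun v : 'M[R]_(m, p) => v *m A).
Proof.
move=> v; apply: (@cvg_mx _ (nbhs v) (nbhs_filter v)) => i j.
rewrite mxE (_ : (fun _ => _) = fun x : 'M[R]_(m, p) => \sum_l x i l * A l j); last first.
  by apply/funext => x; rewrite mxE.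
apply: cvg_big; first exact: add_continuous.
by move=> l _; apply: cvgM; [exact: coord_continuous|exact: cvg_cst].
Qed.

End MatrixContinuity.

Lemma near_eq_differentiable {R : realType} {V W : normedModType R} (g h : V -> W) x :
  (\forall y \near x, g y = h y) -> differentiable g x -> differentiable h x.
Proof.
move=> gh /diff_locallyP[dgc /eqaddoP dg].
have hx : g x = h x by exact: nbhs_singleton gh.
have H : h \o shift x = cst (h x) + 'd g x +o_ 0 id.
  apply/eqaddoP => _/posnumP[e]; have He := dg _ (gt0 e).
  have gh0 : \forall y \near (0 : V), g (y + x) = h (y + x).
    by move: gh; rewrite (near_shift 0) subr0.
  near=> y; have : `|(g \o shift x - (cst (g x) + 'd g x)) y| <= e%:num * `|y| by near: y; exact: He.
  by rewrite -[(h \o shift x - _) y]/(h (y + x) - (h x + 'd g x y)) -hx -(near gh0 y).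
by apply/diff_locallyP; rewrite (diff_unique dgc H).
Unshelve. all: by end_near. Qed.

(** * Geometry of the graph chart *)
Section GraphParametrization.
Context {R : realType} {n k : nat}.
Variables (p : 'rV[R]_(n + k)) (E : 'M[R]_(n, n + k)) (N : 'M[R]_(k, n + k))
  (f : 'rV[R]_n -> 'rV[R]_k) (B : set 'rV[R]_n).
Hypothesis EE : E *m E^T = 1%:M.
Hypothesis NN : N *m N^T = 1%:M.
Hypothesis EN : E *m N^T = 0.
Hypothesis Bopen : open B.
Hypothesis fsmooth : smooth_on B f.
Local Notation phi := (graph_map p E N f).
Implicit Types (x v : 'rV[R]_n).

Lemma NE : N *m E^T = 0.
Proof. by rewrite -[LHS]trmxK trmx_mul trmxK EN trmx0. Qed.

Lemma dotp_mulE m q (A : 'M[R]_(m, q)) (a b : 'rV[R]_m) :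
  A *m A^T = 1%:M -> dotp (a *m A) (b *m A) = dotp a b.
Proof. by move=> AA; rewrite /dotp trmx_mul mulmxA -(mulmxA a) AA mulmx1. Qed.

Lemma dotp_graph (a b : 'rV[R]_n) (c d : 'rV[R]_k) :
  dotp (a *m E + c *m N) (b *m E + d *m N) = dotp a b + dotp c d.
Proof.
have mulE (a' : 'rV[R]_n) (c' : 'rV[R]_k) : (a' *m E + c' *m N) *m E^T = a'.
  by rewrite mulmxDl -!mulmxA EE NE mulmx0 addr0 mulmx1.
have mulN (a' : 'rV[R]_n) (c' : 'rV[R]_k) : (a' *m E + c' *m N) *m N^T = c'.
  by rewrite mulmxDl -!mulmxA NN EN mulmx0 add0r mulmx1.
rewrite /dotp linearD/= !trmx_mul mulmxDr !mulmxA mulE mulN mxE.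
by [].
Qed.

Lemma graph_mapB x : phi x - p = x *m E + f x *m N.
Proof. by rewrite /graph_map addrAC (addrAC p) subrr add0r. Qed.

(** Orthogonal projection onto the tangent space inverts the chart; the injectivity of the chart and
    the openness of its images rest on this. *)
Lemma graph_mapK x : (phi x - p) *m E^T = x.
Proof. by rewrite graph_mapB mulmxDl -!mulmxA EE NE mulmx0 addr0 mulmx1. Qed.

Lemma enorm_graph_map x : enorm (phi x - p) = Num.sqrt (dotp x x + dotp (f x) (f x)).
Proof. by rewrite graph_mapB /enorm dotp_graph. Qed.

Lemma is_derive_mulmxr m q (g : 'rV[R]_n -> 'M[R]_(1, m)) (A : 'M[R]_(m, q)) x v :
  derivable g x v -> is_derive x v (fun y => g y *m A) ('D_v g x *m A).
Proof.
move=> dg; have dgc l : derivable (fun y => g y 0 l) x v.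
  exact: (derivable_mxP g x v).1 dg 0 l.
have E1 i j : (fun y => (g y *m A) i j) = \sum_l (A l j *: (fun y => g y 0 l)).
  by apply/funext => y; rewrite fct_sumE mxE (ord1 i); apply: eq_bigr => l _; rewrite mulrC.
have dgA : derivable (fun y => g y *m A) x v.
  apply/derivable_mxP => i j; rewrite E1; apply: derivable_sum => l.
  exact: derivableZ.
apply: DeriveDef => //; rewrite derive_mx//; apply/matrixP => i j; rewrite !mxE E1.
rewrite derive_sum; last by move=> l; exact: derivableZ.
rewrite derive_mx//; apply: eq_bigr => l _; rewrite deriveZ// !mxE (ord1 i).
by rewrite mulrC.
Qed.

Lemma is_derive_id_mulmxr q (A : 'M[R]_(n, q)) x v :
  is_derive x v (fun y : 'rV[R]_n => y *m A) (v *m A).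
Proof.
have := @is_derive_mulmxr n q id A x v (@derivable_id _ _ _ _).
by rewrite derive_id.
Qed.

Lemma differentiable_mulmxr m q (g : 'rV[R]_n -> 'rV[R]_m) (A : 'M[R]_(m, q)) x :
  differentiable g x -> differentiable (fun y => g y *m A) x.
Proof.
move=> dg.
apply: (@differentiable_comp _ _ _ _ g (fun y : 'rV[R]_m => y *m A)) => //.
apply: (@linear_differentiable _ _ _ (mulmxr A)).
exact: continuous_mulmxr.
Qed.

(** [c] and [L] track the affine part [p + x *m E]: one derivative makes it constant, two make it
    vanish. *)
Lemma iter_partial_graph (s : seq 'I_n) : exists (c : 'rV[R]_(n + k)) (L : 'M[R]_(n, n + k)),
  [/\ forall x, B x -> iter_partial s phi x = c + x *m L + iter_partial s f x *m N,
      (0 < size s)%N -> L = 0 & (1 < size s)%N -> c = 0].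
Proof.
elim: s => [|i s [c [L [H L0 c0]]]]; first by exists p, E.
exists (basis_rV i *m L), 0; split=> //; last by move=> /L0 ->; rewrite mulmx0.
move=> x Bx /=.
have -> : 'D_(basis_rV i) (iter_partial s phi) x =
          'D_(basis_rV i) (fun y => c + y *m L + iter_partial s f y *m N) x.
  apply: near_eq_derive; near=> y; apply: H; near: y; exact: near_B.
have D1 := is_derive_id_mulmxr L x (basis_rV i).
have D2 := @is_derive_mulmxr k _ (iter_partial s f) N x (basis_rV i)
  (diff_derivable (fsmooth s Bx)).
have := is_deriveD (is_deriveD (is_derive_cst c x (basis_rV i)) D1) D2.
by move=> [_ ->]; rewrite add0r mulmx0 addr0.
Unshelve. all: by end_near. Qed.

Lemma iter_partial_graph2 (s : seq 'I_n) x : (1 < size s)%N -> B x ->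
  iter_partial s phi x = iter_partial s f x *m N.
Proof.
move=> s1 Bx; have [c [L [-> // L0 c0]]] := iter_partial_graph s.
by rewrite c0// L0 ?(ltn_trans _ s1)// mulmx0 !add0r.
Qed.

Lemma smooth_on_graph : smooth_on B phi.
Proof.
move=> s x Bx; have [c [L [H _ _]]] := iter_partial_graph s.
have d : differentiable (fun y => c + y *m L + iter_partial s f y *m N) x.
  apply: differentiableD; last by apply: differentiable_mulmxr; exact: fsmooth.
  by apply: differentiableD => //; exact: (@differentiable_mulmxr n _ id).
apply: near_eq_differentiable d; near=> y; rewrite H//; near: y; exact: near_B.
Unshelve. all: by end_near. Qed.

End GraphParametrization.

(** * First order expansion of determinants and square roots *)

Section DeterminantExpansion.
Context {R : realType} {T : Type} (F : set_system T) {FF : Filter F} (N : T -> R).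
Hypothesis N01 : \forall x \near F, 0 <= N x <= 1.
Local Notation O := (order_ge F N).

Lemma order_ge_prod_1D (I : Type) (s : seq I) (d : nat) (a : I -> T -> R) :
  (forall i, O d (a i)) ->
  O (d + d) (fun x => \prod_(i <- s) (1 + a i x) - 1 - \sum_(i <- s) a i x).
Proof.
move=> aO; elim: s => [|i s IHs].
  apply: (@eq_order_ge _ _ _ _ _ _ (fun=> 0)); last exact: order_ge0.
  by move=> x; rewrite !big_nil subrr subr0.
have P1 : O d (fun x => \prod_(i <- s) (1 + a i x) - 1).
  apply: (@eq_order_ge _ _ _ _ _ _ (fun x => (\prod_(i <- s) (1 + a i x) - 1
    - \sum_(i <- s) a i x) + \sum_(i <- s) a i x)); first by move=> x; rewrite subrK.
  apply: order_geD; first by apply: (@order_ge_le _ _ _ _ _ N01 d (d + d)) => //; exact: leq_addr.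
  exact: order_ge_sum.
apply: eq_order_ge (order_geD IHs (order_geM (aO i) P1)) => x /=.
by rewrite !big_cons; ring.
Qed.

(** The identity permutation gives the product of the diagonal. Any other permutation moves some
    [i0] and also [s i0], so its term contains two off-diagonal entries, each of order [d]. *)
Lemma order_ge_det_1D n (d : nat) (A : T -> 'M[R]_n) :
  (forall i j, O d (fun x => A x i j)) ->
  O (d + d) (fun x => \det (1%:M + A x) - 1 - \sum_i A x i i).
Proof.
move=> AO.
have D := @order_ge_prod_1D _ (index_enum 'I_n) d (fun i x => A x i i) (fun i => AO i i).
have entry0 i j : O 0 (fun x => (1%:M + A x) i j).
  apply: (@eq_order_ge _ _ _ _ _ _ (fun x => (i == j)%:R + A x i j)).
    by move=> x; rewrite !mxE.
  apply: order_geD; first exact: order_ge_cst.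
  by apply: (@order_ge_le _ _ _ _ _ N01 0 d).
have S : O (d + d) (fun x => \sum_(s : 'S_n | s != 1%g) (-1) ^+ s * \prod_i (1%:M + A x) i (s i)).
  apply: order_ge_sum => s s1; apply: order_geZ.
  have [i0 si0] : exists i0, s i0 != i0.
    apply/existsP; rewrite -negb_forall; apply: contra s1 => /forallP H.
    by apply/eqP/permP => i; rewrite perm1; exact/eqP.
  have i1 : s i0 != i0 by [].
  have ss : s (s i0) != s i0 by rewrite (inj_eq perm_inj).
  apply: (@eq_order_ge _ _ _ _ _ _ (fun x => A x i0 (s i0) * A x (s i0) (s (s i0)) *
      \prod_(i | (i != i0) && (i != s i0)) (1%:M + A x) i (s i))).
    move=> x; rewrite [RHS](bigD1 i0)//= [X in _ = _ * X](bigD1 (s i0))//= mulrA.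
    by rewrite !mxE eq_sym (negbTE si0) eq_sym (negbTE ss) !add0r.
  rewrite -[X in O X](addn0 (d + d)); apply: order_geM.
    by apply: order_geM.
  by apply: order_ge_prod0 => i _; exact: entry0.
apply: eq_order_ge (order_geD D S) => x /=.
rewrite /determinant [X in _ = X - 1 - _](bigD1 (1%g : 'S_n))//= odd_perm1 expr0 mul1r.
under [in RHS]eq_bigr do rewrite perm1 !mxE eqxx.
by rewrite [LHS]addrAC [X in X - _ = _]addrAC.
Qed.

(** With [s] the root, [s - 1 - w / 2 = - (s - 1) ^+ 2 / 2] while [w = (s - 1) * (s + 1)]. If
    [1 + w] is negative the root is [0] by convention, and [w ^+ 2 > 1] leaves enough room. *)
Lemma sqrt_1D_bound (w : R) : `|Num.sqrt (1 + w) - 1 - w / 2| <= 2 * w ^+ 2.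
Proof.
have [w1|w1] := leP 0 (1 + w).
  have s0 := sqrtr_ge0 (1 + w); have ss := sqr_sqrtr w1.
  set s := Num.sqrt _ in s0 ss *.
  have -> : s - 1 - w / 2 = - ((s - 1) ^+ 2 / 2).
    have -> : w = s ^+ 2 - 1 by rewrite ss; ring.
    by field.
  rewrite normrN ger0_norm ?divr_ge0 ?sqr_ge0//.
  have -> : w = (s - 1) * (s + 1) by rewrite -subr_sqr_1 ss; ring.
  rewrite exprMn; have := sqr_ge0 (s - 1); nra.
rewrite (ler0_sqrtr (ltW w1)) ler_norml; apply/andP; split; nra.
Qed.

Lemma order_ge_sqrt_1D d w : O d w -> O (d + d) (fun x => Num.sqrt (1 + w x) - 1 - w x / 2).
Proof.
move=> /(fun H => order_geM H H)[C C0 wC]; exists (2 * C); first by rewrite mulr_ge0.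
near=> x; rewrite (le_trans (sqrt_1D_bound _))// -mulrA ler_wpM2l// expr2.
by rewrite (le_trans (ler_norm _))//; near: x.
Unshelve. all: by end_near. Qed.

End DeterminantExpansion.

Section GraphGeometry.
Context {R : realType} {n k : nat}.
Variables (p : 'rV[R]_(n + k)) (E : 'M[R]_(n, n + k)) (N : 'M[R]_(k, n + k))
  (f : 'rV[R]_n -> 'rV[R]_k) (B : set 'rV[R]_n).
Hypothesis EE : E *m E^T = 1%:M.
Hypothesis NN : N *m N^T = 1%:M.
Hypothesis EN : E *m N^T = 0.
Hypothesis Bopen : open B.
Hypothesis B0 : B 0.
Hypothesis fsmooth : smooth_on B f.
Hypothesis f0 : f 0 = 0.
Hypothesis Jf0 : 'J f 0 = 0.
Local Notation phi := (graph_map p E N f).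
Implicit Types (x v : 'rV[R]_n).
Local Notation "'O' d" := (order_ge (nbhs (0 : 'rV[R]_n)) gauge0 d)
  (at level 10, d at level 9).
Local Notation P := (partial f).

Let NE0 : N *m E^T = 0 := NE EN.

Lemma derive_row_jacobian m (g : 'rV[R]_n -> 'rV[R]_m) x i : differentiable g x ->
  row i ('J g x) = 'D_(basis_rV i) g x.
Proof. by move=> dg; rewrite deriveEjacobian// rowE. Qed.

Lemma jacobian_partial x i a : B x -> 'J f x i a = P [:: i] a x.
Proof.
move=> Bx; have := derive_row_jacobian i (fsmooth [::] Bx).
by move=> /rowP/(_ a); rewrite mxE.
Qed.

Lemma jacobian_graph x : B x -> 'J phi x = E + 'J f x *m N.
Proof.
move=> Bx; apply/row_matrixP => i.
rewrite derive_row_jacobian; last exact: (smooth_on_graph p E N Bopen fsmooth [::] Bx).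
have D1 := is_derive_id_mulmxr E x (basis_rV i).
have D2 := @is_derive_mulmxr _ _ k _ f N x (basis_rV i)
  (diff_derivable (fsmooth [::] Bx)).
have [_ D] := is_deriveD (is_deriveD (is_derive_cst p x (basis_rV i)) D1) D2.
rewrite -[LHS]/('D_(basis_rV i) (cst p + (fun y : 'rV[R]_n => y *m E) + (fun y => f y *m N)) x).
rewrite D add0r linearD/= row_mul derive_row_jacobian; last exact: (fsmooth [::]).
by rewrite -rowE.
Qed.

Lemma metric_graph x : B x -> metric phi x = 1%:M + 'J f x *m ('J f x)^T.
Proof.
move=> Bx; rewrite /metric jacobian_graph// linearD/= trmx_mul mulmxDl !mulmxDr.
rewrite EE (mulmxA E) EN mul0mx addr0 -(mulmxA _ N E^T) NE0 mulmx0 add0r.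
by rewrite -(mulmxA _ N) (mulmxA N) NN mul1mx.
Qed.

Lemma metric_graphE x i j : B x ->
  metric phi x i j = (i == j)%:R + \sum_a P [:: i] a x * P [:: j] a x.
Proof.
move=> Bx; rewrite metric_graph// mxE [1%:M i j]mxE [(_ *m _) i j]mxE.
congr (_ + _); apply: eq_bigr => a _.
by rewrite [_^T a j]mxE !jacobian_partial.
Qed.

Lemma local_parametrization_graph (M U : set 'rV[R]_(n + k)) :
  open U -> M `&` U = phi @` B -> local_parametrization M B phi.
Proof.
move=> oU MU; split=> //.
- exact: smooth_on_graph.
- move=> x Bx; apply/row_freeP; exists E^T.
  by rewrite jacobian_graph// mulmxDl EE -mulmxA NE0 mulmx0 addr0.
- by move=> u v _ _ uv; rewrite -(graph_mapK p f EE EN u) uv graph_mapK.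
move=> W' oW' W'B.
pose pr (q : 'rV[R]_(n + k)) : 'rV[R]_n := (q - p) *m E^T.
have cpr : continuous pr.
  rewrite (_ : pr = (fun q => q *m E^T) - cst (p *m E^T)); last first.
    by apply/funext => q; rewrite /pr mulmxBl.
  move=> q; apply: continuousB; last exact: cst_continuous.
  exact: (@continuous_mulmxr _ 1 _ _ E^T).
(* The image of [W'] is cut out of the graph by the continuous projection [pr]. *)
exists (U `&` pr @^-1` W').
  by apply: openI => //; apply: open_comp => // q _; exact: cpr.
rewrite setIA MU; apply/seteqP; split=> q.
  move=> [x W'x <-]; split; first by exists x => //; exact: W'B.
  by rewrite /= /pr graph_mapK.
by move=> [[x Bx <-]]; rewrite /= /pr graph_mapK// => W'x; exists x.
Qed.

(** At the origin these are the components of the second fundamental form in the frames [E] and [N],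
    by [second_form_graph0]. *)
Definition hess (i j : 'I_n) (a : 'I_k) : R := P [:: i; j] a 0.

Lemma hessC i j a : hess i j a = hess j i a.
Proof. exact: (partialC Bopen B0 fsmooth). Qed.

(* [grad_lin] and [half_quad] are the leading terms of the first derivatives and
   of the components of [f]. *)
Definition grad_lin (i : 'I_n) (a : 'I_k) x : R := \sum_l x 0 l * hess l i a.
Definition half_quad (a : 'I_k) x : R := 2^-1 * \sum_l \sum_m x 0 l * x 0 m * hess l m a.
Definition quad2 x : R := \sum_i \sum_a grad_lin i a x ^+ 2.
Definition quad4 x : R := \sum_a half_quad a x ^+ 2.

Lemma coord_order1 i : O 1 (fun x : 'rV[R]_n => x 0 i).
Proof.
exists 1 => //; near=> x; rewrite mul1r expr1; exact: coord_le_norm.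
Unshelve. all: by end_near. Qed.

Lemma grad_lin_order1 i a : O 1 (grad_lin i a).
Proof.
apply: order_ge_sum => l _.
apply: (@eq_order_ge _ _ _ _ _ _ (fun x => hess l i a * x 0 l)).
  by move=> x; rewrite mulrC.
by apply: order_geZ; exact: coord_order1.
Qed.

Lemma half_quad_order2 a : O 2 (half_quad a).
Proof.
apply: order_geZ; apply: order_ge_sum => l _; apply: order_ge_sum => m _.
apply: (@eq_order_ge _ _ _ _ _ _ (fun x => hess l m a * (x 0 l * x 0 m))).
  by move=> x; rewrite mulrC.
by apply: order_geZ; apply: (@order_geM _ _ _ _ _ 1 1); exact: coord_order1.
Qed.

Lemma order_ge_sqrB d e (u v : 'rV[R]_n -> R) : (e <= d)%N -> O d (fun x => u x - v x) -> O e v ->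
  O (d + e) (fun x => u x ^+ 2 - v x ^+ 2).
Proof.
move=> ed duv ov.
apply: (@eq_order_ge _ _ _ _ _ _ (fun x => (u x - v x) * ((u x - v x) + v x + v x))).
  by move=> x; rewrite subrK -subr_sqr.
apply: order_geM => //; apply: order_geD => //; apply: order_geD => //.
by apply: (@order_ge_le _ _ _ _ _ gauge0_le1 e d).
Qed.

(** Each component of [f] is [half_quad] plus an error of order 3, and [half_quad] has order 2; the
    difference of the squares has order [3 + 2]. *)
Lemma graph_height_order5 : O 5 (fun x => dotp (f x) (f x) - quad4 x).
Proof.
apply: (@eq_order_ge _ _ _ _ _ _ (fun x => \sum_a (P [::] a x ^+ 2 - half_quad a x ^+ 2))).
  by move=> x; rewrite dotpE sumrB; congr (_ - _); apply: eq_bigr => a _; rewrite expr2.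
apply: order_ge_sum => a _; apply: (@order_ge_sqrB 3 2) => //.
  exact: (partial_taylor_second Bopen B0 fsmooth f0 Jf0).
exact: half_quad_order2.
Qed.

(** The Gram matrix is the identity plus a term [A] of order 2, so the determinant and the square
    root produce errors of order 4 only; order 3 is lost in replacing the trace of [A] by
    [quad2]. *)
Lemma volume_density_order3 : O 3 (fun x => volume_density phi x - (1 + quad2 x / 2)).
Proof.
pose A x := 'J f x *m ('J f x)^T.
pose tr x := \sum_i A x i i.
have P1 i a : O 1 (P [:: i] a).
  apply: (@eq_order_ge _ _ _ _ _ _ (fun x => (P [:: i] a x - grad_lin i a x) + grad_lin i a x)).
    by move=> x; rewrite subrK.
  apply: order_geD; last exact: grad_lin_order1.
  apply: (@order_ge_le _ _ _ _ _ gauge0_le1 1 2) => //.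
  exact: (partial_taylor1_first Bopen B0 fsmooth Jf0).
have AE x i j : B x -> A x i j = \sum_a P [:: i] a x * P [:: j] a x.
  by move=> Bx; rewrite mxE; apply: eq_bigr => a _; rewrite [_^T a j]mxE !jacobian_partial.
have A2 i j : O 2 (fun x => A x i j).
  apply: (@order_ge_near _ _ _ _ _ _ (fun x => \sum_a P [:: i] a x * P [:: j] a x)).
    near=> x; rewrite AE//; near: x; exact: near_B.
  by apply: order_ge_sum => a _; apply: (@order_geM _ _ _ _ _ 1 1).
have D : O 4 (fun x => \det (1%:M + A x) - 1 - tr x).
  exact: (order_ge_det_1D gauge0_le1 A2).
have tr2 : O 2 tr by apply: order_ge_sum => i _; exact: A2.
have trq : O 3 (fun x => tr x - quad2 x).
  apply: (@order_ge_near _ _ _ _ _ _ (fun x => \sum_i \sum_a (P [:: i] a x ^+ 2 - grad_lin i a x ^+ 2))).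
    near=> x; rewrite /tr /quad2 -sumrB; apply: eq_bigr => i _.
    rewrite sumrB; congr (_ - _); rewrite AE; last by near: x; exact: near_B.
    by apply: eq_bigr => a _; rewrite expr2.
  apply: order_ge_sum => i _; apply: order_ge_sum => a _.
  apply: (@order_ge_sqrB 2 1) => //; first exact: (partial_taylor1_first Bopen B0 fsmooth Jf0).
  exact: grad_lin_order1.
pose w x := \det (1%:M + A x) - 1.
have w2 : O 2 w.
  apply: (@eq_order_ge _ _ _ _ _ _ (fun x => (\det (1%:M + A x) - 1 - tr x) + tr x)).
    by move=> x; rewrite subrK.
  apply: order_geD => //.
 exact: (@order_ge_le _ _ _ _ _ gauge0_le1 2 4 _ isT D).
have S : O 4 (fun x => Num.sqrt (1 + w x) - 1 - w x / 2) by exact: (order_ge_sqrt_1D w2).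
have S3 := @order_ge_le _ _ _ (nbhs_filter _) _ gauge0_le1 3 4 _ isT S.
have D3 := @order_ge_le _ _ _ (nbhs_filter _) _ gauge0_le1 3 4 _ isT D.
apply: (@order_ge_near _ _ _ _ _ _ (fun x => (Num.sqrt (1 + w x) - 1 - w x / 2)
  + 2^-1 * (\det (1%:M + A x) - 1 - tr x) + 2^-1 * (tr x - quad2 x))).
  near=> x; rewrite /volume_density metric_graph; last by near: x; exact: near_B.
  rewrite -/(A x) /w [1 + (_ - 1)]addrC subrK; set dt := \det _.
  by clearbody dt; field.
apply: order_geD; last exact: order_geZ.
by apply: order_geD => //; exact: order_geZ.
Unshelve. all: by end_near. Qed.

End GraphGeometry.

(** * Curvature at the origin *)
Section MatrixInverseContinuity.
Context {R : realType} {T : Type} (F : set_system T) {FF : Filter F}.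

Lemma cvg_det n (g : T -> 'M[R]_n) (l : 'M[R]_n) :
  (forall i j, g x i j @[x --> F] --> l i j) -> \det (g x) @[x --> F] --> \det l.
Proof.
move=> gl; rewrite /determinant.
apply: cvg_big; first exact: add_continuous.
move=> s _; apply: cvgM; first exact: cvg_cst.
apply: cvg_big; first exact: mul_continuous.
by move=> i _; exact: gl.
Qed.

Lemma cvg_invmx n (g : T -> 'M[R]_n) (l : 'M[R]_n) : l \in unitmx ->
  (forall i j, g x i j @[x --> F] --> l i j) ->
  forall i j, invmx (g x) i j @[x --> F] --> invmx l i j.
Proof.
move=> lu gl i j.
have dg := cvg_det gl.
have dl0 : \det l != 0 by rewrite -unitfE.
have adj : (\adj (g x)) i j @[x --> F] --> (\adj l) i j.
  rewrite mxE (_ : (fun x => _) = fun x => cofactor (g x) j i); last first.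
    by apply/funext => x; rewrite mxE.
  rewrite /cofactor; apply: cvgM; first exact: cvg_cst.
  apply: cvg_det => i' j'; rewrite !mxE.
  rewrite (_ : (fun x => _) = fun x => g x (lift j i') (lift i j')); last first.
    by apply/funext => x; rewrite !mxE.
  exact: gl.
have E0 : invmx l i j = (\det l)^-1 * (\adj l) i j by rewrite /invmx lu mxE.
(* Cramer's formula, valid near the limit because the determinant stays nonzero there. *)
rewrite E0; apply: cvg_trans (cvgM (cvgV dl0 dg) adj).
apply: near_eq_cvg.
have : \forall x \near F, \det (g x) != 0.
  have := dg; move=> /cvgr_neq0; exact.
apply: filterS => x dx; rewrite /invmx unitmxE unitfE dx [in RHS]mxE.
by [].
Qed.

End MatrixInverseContinuity.

Section ProductRuleAtZero.
Context {R : realType} {V : normedModType R}.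

(** Where one factor vanishes, the product rule needs only continuity of the other. The inverse
    metric therefore never has to be differentiated. *)
Lemma is_derive_mul_zero (u w : V -> R) x v (dw : R) :
  {for x, continuous u} -> w x = 0 -> is_derive x v w dw ->
  is_derive x v (fun y => u y * w y) (u x * dw).
Proof.
move=> cu w0 [dwx wE].
have H : h^-1 *: (u (h *: v + x) * w (h *: v + x) - u x * w x) @[h --> (0 : R)^'] --> u x * dw.
  rewrite w0 mulr0.
  rewrite (_ : (fun h => _) = fun h : R => u (h *: v + x) * (h^-1 *: (w (h *: v + x) - w x))); last first.
    by apply/funext => h; rewrite w0 !subr0 [RHS]mulrCA.
  apply: cvgM; last by rewrite -wE; exact: dwx.
  have L : (h *: v + x) @[h --> (0 : R)^'] --> x.
    rewrite -[X in _ --> X](add0r x) -[X in _ --> X + _](scale0r v).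
    apply: cvgD; last exact: cvg_cst.
    apply: cvgZr_tmp; apply: cvg_within_filter.
    exact: cvg_id.
  exact: (cvg_comp _ _ L cu).
apply: DeriveDef.
  by apply/cvg_ex; exists (u x * dw).
by apply/cvg_lim.
Qed.

End ProductRuleAtZero.

Lemma cvg_sumr {R : realType} {T : Type} {F : set_system T} {FF : Filter F} (I : Type)
    (s : seq I) (g : I -> T -> R) (l : I -> R) :
  (forall i, g i x @[x --> F] --> l i) ->
  \sum_(i <- s) g i x @[x --> F] --> \sum_(i <- s) l i.
Proof. by move=> gl; apply: cvg_big; [exact: add_continuous|move=> i _; exact: gl]. Qed.

Lemma half_sum_comb {R : realType} {I : Type} (s : seq I) (u v w u' v' w' y z : I -> R) :
  (forall a, 2^-1 * (u a + v a - w a) - 2^-1 * (u' a + v' a - w' a) = y a - z a) ->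
  2^-1 * (\sum_(a <- s) u a + \sum_(a <- s) v a - \sum_(a <- s) w a) -
  2^-1 * (\sum_(a <- s) u' a + \sum_(a <- s) v' a - \sum_(a <- s) w' a) =
  \sum_(a <- s) y a - \sum_(a <- s) z a.
Proof.
move=> H; rewrite -!big_split/= -!sumrB !mulr_sumr -sumrB.
by apply: eq_bigr => a _; exact: H.
Qed.

Section CurvatureAtOrigin.
Context {R : realType} {n k : nat}.
Variables (p : 'rV[R]_(n + k)) (E : 'M[R]_(n, n + k)) (N : 'M[R]_(k, n + k))
  (f : 'rV[R]_n -> 'rV[R]_k) (B : set 'rV[R]_n).
Hypothesis EE : E *m E^T = 1%:M.
Hypothesis NN : N *m N^T = 1%:M.
Hypothesis EN : E *m N^T = 0.
Hypothesis Bopen : open B.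
Hypothesis B0 : B 0.
Hypothesis fsmooth : smooth_on B f.
Hypothesis Jf0 : 'J f 0 = 0.
Local Notation phi := (graph_map p E N f).
Local Notation P := (partial f).
Local Notation h := (hess f).

Let NE0 : N *m E^T = 0 := NE EN.

Lemma jacobian_graph0 : 'J phi 0 = E.
Proof. by rewrite (jacobian_graph p E N Bopen fsmooth B0) Jf0 mul0mx addr0. Qed.

Lemma metric_graph0 : metric phi 0 = 1%:M.
Proof. by rewrite /metric jacobian_graph0 EE. Qed.

Lemma invmx_metric_graph0 : invmx (metric phi 0) = 1%:M.
Proof. by rewrite metric_graph0 invmx1. Qed.

Lemma coords_graph0 v : coords phi 0 v = v *m E^T.
Proof. by rewrite /coords invmx_metric_graph0 mulmx1 jacobian_graph0. Qed.

Lemma coords_graph0_row i : coords phi 0 (row i E) = basis_rV i.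
Proof. by rewrite coords_graph0 -row_mul EE row1. Qed.

Lemma second_form_graph0 i j :
  second_form phi 0 (row i E) (row j E) = (\row_a h i j a) *m N.
Proof.
rewrite /second_form !coords_graph0_row.
rewrite -[X in normal_part _ _ X]/(iter_partial [:: i; j] phi 0).
rewrite (iter_partial_graph2 p E N Bopen fsmooth)//.
rewrite /normal_part coords_graph0 -(mulmxA _ N) NE0 mulmx0 mul0mx subr0.
by congr (_ *m N); apply/rowP => a; rewrite mxE.
Qed.

Lemma enorm_sqr m (v : 'rV[R]_m) : enorm v ^+ 2 = dotp v v.
Proof. by rewrite /enorm sqr_sqrtr// dotp_ge0. Qed.

Lemma enorm_mean_curvature :
  enorm (mean_curvature phi 0 E) ^+ 2 = \sum_a (\sum_i h i i a) ^+ 2.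
Proof.
rewrite enorm_sqr /mean_curvature.
under eq_bigr do rewrite second_form_graph0.
rewrite -mulmx_suml dotp_mulE// dotpE; apply: eq_bigr => a _.
by rewrite expr2 !summxE; congr (_ * _); apply: eq_bigr => i _; rewrite mxE.
Qed.

Lemma dotp_second_form_row i j a :
  dotp (second_form phi 0 (row i E) (row j E)) (row a N) = h i j a.
Proof.
rewrite second_form_graph0 rowE dotp_mulE// dotpE (bigD1 a)//= big1.
  by rewrite !mxE !eqxx mulr1 addr0.
by move=> b ba; rewrite !mxE (negbTE ba) andbF mulr0.
Qed.

Lemma trace_third_form_graph0 :
  trace_third_form phi 0 E N = \sum_i \sum_l \sum_a h i l a ^+ 2.
Proof.
rewrite /trace_third_form; apply: eq_bigr => i _.
rewrite [RHS]exchange_big; apply: eq_bigr => a _.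
rewrite /third_form /weingarten.
have -> : \sum_l dotp (second_form phi 0 (row i E) (row l E)) (row a N) *: row l E
        = (\row_l h i l a) *m E.
  apply/rowP => c; rewrite summxE mxE; apply: eq_bigr => l _.
  by rewrite dotp_second_form_row !mxE.
rewrite dotp_mulE// dotpE; apply: eq_bigr => l _.
by rewrite mxE expr2.
Qed.


(** The first derivatives of the metric coefficients, needed on all of [B] because the curvature
    differentiates them once more. *)
Definition dmetric (m j l : 'I_n) (w : 'rV[R]_n) : R :=
  \sum_a (P [:: m; j] a w * P [:: l] a w + P [:: j] a w * P [:: m; l] a w).

Let continuous_P s a x : B x -> {for x, continuous (P s a)}.
Proof. by move=> Bx; apply: differentiable_continuous; apply: (differentiable_partial fsmooth). Qed.

Let is_derive_P s a m x : B x -> is_derive x (basis_rV m) (P s a) (P (m :: s) a x).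
Proof.
move=> Bx; apply: DeriveDef; last exact: (derive_partial fsmooth).
by apply: diff_derivable; exact: (differentiable_partial fsmooth).
Qed.

Lemma pd_metric_graph m j l w : B w -> pd m (fun w => metric phi w j l) w = dmetric m j l w.
Proof.
move=> Bw; rewrite /pd.
have -> : 'D_(basis_rV m) (fun w => metric phi w j l) w =
   'D_(basis_rV m) (cst (j == l)%:R + \sum_a (P [:: j] a * P [:: l] a)) w.
  apply: near_eq_derive; near=> x; rewrite (metric_graphE p EE NN EN Bopen fsmooth)//.
    by rewrite fctE fct_sumE.
  by near: x; exact: near_B.
have D a : is_derive w (basis_rV m) (P [:: j] a * P [:: l] a)
   (P [:: j] a w *: P [:: m; l] a w + P [:: l] a w *: P [:: m; j] a w).
  by apply: is_deriveM; exact: is_derive_P.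
have [_ ->] := is_deriveD (is_derive_cst ((j == l)%:R : R) w (basis_rV m)) (is_derive_sum D).
rewrite add0r; apply: eq_bigr => a _.
by rewrite addrC; congr (_ + _); exact: mulrC.
Unshelve. all: by end_near. Qed.

Lemma dmetric0 m j l : dmetric m j l 0 = 0.
Proof.
by rewrite /dmetric big1// => a _; rewrite !(partial10 B0 fsmooth Jf0) mulr0 mul0r addr0.
Qed.

Lemma is_derive_dmetric i m j l : is_derive (0 : 'rV[R]_n) (basis_rV i) (dmetric m j l)
  (\sum_a (h m j a * h i l a + h m l a * h i j a)).
Proof.
(* The products are reordered so that the first partial derivative of [f], which vanishes at the
   origin, is the second factor. *)
have D a : is_derive (0 : 'rV[R]_n) (basis_rV i)
    ((fun w => P [:: m; j] a w * P [:: l] a w) + (fun w => P [:: m; l] a w * P [:: j] a w))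
    (h m j a * h i l a + h m l a * h i j a).
  by apply: is_deriveD; (apply: is_derive_mul_zero; [exact: continuous_P|
    exact: (partial10 B0 fsmooth Jf0)|exact: is_derive_P]).
have := is_derive_sum D; rewrite (_ : \sum_a _ = dmetric m j l)//.
apply/funext => w; rewrite fct_sumE; apply: eq_bigr => a _.
by rewrite fctE; congr (_ + _); exact: mulrC.
Qed.

(** Twice the Christoffel symbol of the first kind. *)
Definition christoffel_num (l i j : 'I_n) w : R :=
  dmetric i j l w + dmetric j i l w - dmetric l i j w.

Lemma christoffel_graphE l i j w : B w -> christoffel (metric phi) l i j w =
  2^-1 * \sum_r invmx (metric phi w) l r * christoffel_num r i j w.
Proof.
move=> Bw; rewrite /christoffel; congr (_ * _); apply: eq_bigr => r _.
by rewrite !pd_metric_graph.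
Qed.

Lemma christoffel_graph0 l i j : christoffel (metric phi) l i j 0 = 0.
Proof.
rewrite christoffel_graphE// big1 ?mulr0// => r _.
by rewrite /christoffel_num !dmetric0 addr0 subr0 mulr0.
Qed.

Lemma cvg_metric_graph x i j : B x ->
  metric phi w i j @[w --> x] --> metric phi x i j.
Proof.
move=> Bx; rewrite [in X in _ --> X](metric_graphE p EE NN EN Bopen fsmooth i j Bx).
have H : (i == j)%:R + \sum_a P [:: i] a w * P [:: j] a w @[w --> x] -->
   (i == j)%:R + \sum_a P [:: i] a x * P [:: j] a x.
  apply: (@cvgD _ _ _ _ (nbhs_filter _)); first exact: cvg_cst.
  apply: (@cvg_sumr _ _ _ (nbhs_filter _)) => a.
  by apply: (@cvgM _ _ _ (nbhs_filter _)); exact: continuous_P.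
apply: cvg_trans H; apply: (@near_eq_cvg _ _ _ (nbhs_filter x)); near=> w.
rewrite (metric_graphE p EE NN EN Bopen fsmooth)//; near: w; exact: near_B.
Unshelve. all: by end_near. Qed.

Lemma continuous_volume_density x : B x -> {for x, continuous (volume_density phi)}.
Proof.
move=> Bx; rewrite /prop_for /volume_density.
apply: (@continuous_cvg _ _ _ _ (nbhs_filter x) (fun w => \det (metric phi w)) Num.sqrt).
  exact: sqrt_continuous.
by apply: (@cvg_det _ _ _ (nbhs_filter x)) => i j; exact: cvg_metric_graph.
Qed.

Lemma sum_invmx_metric_graph0 l (g : 'I_n -> R) :
  \sum_r invmx (metric phi 0) l r * g r = g l.
Proof.
rewrite invmx_metric_graph0 (bigD1 l)//= big1 ?mxE ?eqxx ?mul1r ?addr0// => r rl.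
by rewrite mxE eq_sym (negbTE rl) mul0r.
Qed.

(** [christoffel_num] vanishes at the origin, where the inverse metric is the identity, so only the
    derivative of [christoffel_num] survives. *)
Lemma pd_christoffel_graph0 m l i j : pd m (christoffel (metric phi) l i j) 0 =
  2^-1 * (\sum_a (h i j a * h m l a + h i l a * h m j a)
        + \sum_a (h j i a * h m l a + h j l a * h m i a)
        - \sum_a (h l i a * h m j a + h l j a * h m i a)).
Proof.
rewrite /pd.
have -> : 'D_(basis_rV m) (christoffel (metric phi) l i j) 0 =
   'D_(basis_rV m) (2^-1 *: \sum_r (fun w => invmx (metric phi w) l r * christoffel_num r i j w)) 0.
  apply: near_eq_derive; near=> x; rewrite christoffel_graphE//.
    by rewrite /GRing.scale/= fct_sumE.
  by near: x; exact: near_B.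
have num r : is_derive (0 : 'rV[R]_n) (basis_rV m) (christoffel_num r i j)
    (\sum_a (h i j a * h m r a + h i r a * h m j a)
        + \sum_a (h j i a * h m r a + h j r a * h m i a)
        - \sum_a (h r i a * h m j a + h r j a * h m i a)).
  exact: (is_deriveB (is_deriveD (is_derive_dmetric _ _ _ _) (is_derive_dmetric _ _ _ _))
    (is_derive_dmetric _ _ _ _)).
have D r : is_derive (0 : 'rV[R]_n) (basis_rV m)
    (fun w => invmx (metric phi w) l r * christoffel_num r i j w)
    (invmx (metric phi 0) l r * (\sum_a (h i j a * h m r a + h i r a * h m j a)
        + \sum_a (h j i a * h m r a + h j r a * h m i a)
        - \sum_a (h r i a * h m j a + h r j a * h m i a))).
  apply: is_derive_mul_zero => //.
    apply: (@cvg_invmx _ _ _ (nbhs_filter _)); last by move=> i0 j0; exact: cvg_metric_graph.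
    by rewrite metric_graph0 unitmx1.
  by rewrite /christoffel_num !dmetric0 addr0 subr0.
have [_ ->] := is_deriveZ 2^-1 (is_derive_sum D).
rewrite /GRing.scale/=; apply: (congr1 (fun t => 2^-1 * t)).
exact: (sum_invmx_metric_graph0 l).
Unshelve. all: by end_near. Qed.

(* The Christoffel symbols vanish at the origin, so only their first derivatives
   contribute. *)
Lemma scalar_curvature_graph0 : scalar_curvature (metric phi) 0 =
  \sum_a (\sum_i h i i a) ^+ 2 - \sum_i \sum_l \sum_a h i l a ^+ 2.
Proof.
have hC i j a : h i j a = h j i a by exact: (hessC Bopen B0 fsmooth).
(* The Gauss equation for the plane spanned by the basis vectors [i] and [j]. *)
have riem i j : riemann (metric phi) i j i j 0 =
    \sum_a h i i a * h j j a - \sum_a h i j a ^+ 2.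
  rewrite /riemann big1 ?addr0; last first.
    by move=> r _; rewrite !christoffel_graph0 !mul0r subr0.
  rewrite !pd_christoffel_graph0; apply: half_sum_comb => a.
  rewrite (hC j i a); move: (h i i a) (h j j a) (h i j a) => x y z.
  by field.
rewrite /scalar_curvature.
have -> : \sum_j \sum_k0 invmx (metric phi 0) j k0 * ricci (metric phi) j k0 0 =
    \sum_j ricci (metric phi) j j 0.
  by apply: eq_bigr => j _; rewrite sum_invmx_metric_graph0.
have -> : \sum_j ricci (metric phi) j j 0 =
    \sum_i \sum_j (\sum_a h i i a * h j j a - \sum_a h i j a ^+ 2).
  by rewrite [RHS]exchange_big; apply: eq_bigr => j _; apply: eq_bigr => i _; exact: riem.
have -> : \sum_a (\sum_i h i i a) ^+ 2 = \sum_i \sum_j \sum_a h i i a * h j j a.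
  under eq_bigr do rewrite expr2 mulr_suml.
  rewrite exchange_big; apply: eq_bigr => i _.
  under eq_bigr do rewrite mulr_sumr.
  by rewrite exchange_big.
by rewrite -sumrB; apply: eq_bigr => i _; rewrite -sumrB.
Qed.

Lemma gauss_graph0 (trIII := trace_third_form phi 0 E N)
    (H := mean_curvature phi 0 E) :
  2 * trIII - enorm H ^+ 2 = enorm H ^+ 2 - 2 * scalar_curvature (metric phi) 0.
Proof.
rewrite /trIII /H enorm_mean_curvature trace_third_form_graph0 scalar_curvature_graph0.
move: (\sum_a _) (\sum_i _) => u v; ring.
Qed.

End CurvatureAtOrigin.

(** * Gaussian moments of the quadratic forms *)
Section DeltaSums.
Context {R : realType} {n : nat}.

Lemma sum_delta (l : 'I_n) (g : 'I_n -> R) : \sum_m g m * (l == m)%:R = g l.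
Proof.
rewrite (bigD1 l)//= eqxx mulr1 big1 ?addr0// => m /negbTE ml.
by rewrite eq_sym ml mulr0.
Qed.

(* [(l == m)%:R / 2] is the second moment of the density [exp (- |y|^2)] after normalization. *)
Lemma wick2 (g : 'I_n -> R) :
  \sum_l \sum_m g l * g m * ((l == m)%:R / 2) = 2^-1 * \sum_l g l ^+ 2.
Proof.
rewrite mulr_sumr; apply: eq_bigr => l _.
rewrite -[RHS](sum_delta l (fun m => 2^-1 * (g l * g m))).
by apply: eq_bigr => m _; ring.
Qed.

(** The first pairing contracts to the squared trace of [g]; the other two agree by symmetry and
    give twice its squared norm. *)
Lemma wick4 (g : 'I_n -> 'I_n -> R) : (forall l m, g l m = g m l) ->
  \sum_l \sum_m \sum_r \sum_s g l m * g r s *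
     ((((l == m) && (r == s))%:R + ((l == r) && (m == s))%:R + ((l == s) && (m == r))%:R) / 4)
  = 4^-1 * ((\sum_l g l l) ^+ 2 + 2 * \sum_l \sum_m g l m ^+ 2).
Proof.
move=> gC; pose T := \sum_r g r r.
have inner l m : \sum_r \sum_s g r s *
     (((l == m) && (r == s))%:R + ((l == r) && (m == s))%:R + ((l == s) && (m == r))%:R)
    = (l == m)%:R * T + (g l m + g m l).
  have A : \sum_r \sum_s g r s * ((l == m) && (r == s))%:R = (l == m)%:R * T.
    rewrite mulr_sumr; apply: eq_bigr => r _.
    rewrite -[RHS](sum_delta r (fun s => (l == m)%:R * g r s)).
    by apply: eq_bigr => s _; rewrite -mulnb natrM mulrCA mulrA.
  have B : \sum_r \sum_s g r s * ((l == r) && (m == s))%:R = g l m.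
    rewrite -(sum_delta l (fun r => g r m)); apply: eq_bigr => r _.
    rewrite -(sum_delta m (fun s => g r s)) mulr_suml; apply: eq_bigr => s _.
    by rewrite -mulnb natrM mulrAC mulrA.
  have C : \sum_r \sum_s g r s * ((l == s) && (m == r))%:R = g m l.
    rewrite -(sum_delta m (fun r => g r l)); apply: eq_bigr => r _.
    rewrite -(sum_delta l (fun s => g r s)) mulr_suml; apply: eq_bigr => s _.
    by rewrite -mulnb natrM mulrA.
  rewrite -[in RHS]A -[X in _ + (X + _)]B -[X in _ + (_ + X)]C addrA -!big_split.
  by apply: eq_bigr => r _; rewrite -!big_split; apply: eq_bigr => s _; rewrite /= !mulrDr.
have inner4 l m : \sum_r \sum_s g l m * g r s *
     ((((l == m) && (r == s))%:R + ((l == r) && (m == s))%:R + ((l == s) && (m == r))%:R) / 4)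
    = 4^-1 * (T * (g l m * (l == m)%:R) + 2 * g l m ^+ 2).
  rewrite [RHS](_ : _ = 4^-1 * g l m * ((l == m)%:R * T + (g l m + g m l))); last first.
    by rewrite (gC m l); ring.
  rewrite -inner mulr_sumr; apply: eq_bigr => r _; rewrite mulr_sumr; apply: eq_bigr => s _.
  by ring.
under eq_bigr do under eq_bigr do rewrite inner4.
under eq_bigr do rewrite -mulr_sumr big_split/= -!mulr_sumr sum_delta.
by rewrite -mulr_sumr big_split/= -!mulr_sumr expr2.
Qed.

End DeltaSums.

Section GaussianForms.
Context {R : realType} {n : nat}.

Lemma has_gint_linear_sqr (g : 'I_n -> R) :
  has_gint (fun y : 'rV[R]_n => (\sum_l y 0 l * g l) ^+ 2)
   (@gtot R n * (2^-1 * \sum_l g l ^+ 2)).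
Proof.
rewrite -wick2 mulr_sumr.
apply: eq_has_gint (has_gint_sum (index_enum _) _); last first.
  move=> l; rewrite mulr_sumr; apply: has_gint_sum => m.
  rewrite mulrCA; apply: has_gintZ; exact: (has_gint_coord2 l m).
move=> y /=; rewrite expr2 mulr_suml; apply: eq_bigr => l _.
by rewrite mulr_sumr; apply: eq_bigr => m _; ring.
Qed.

Lemma has_gint_quadratic_sqr (g : 'I_n -> 'I_n -> R) : (forall l m, g l m = g m l) ->
  has_gint (fun y : 'rV[R]_n => (\sum_l \sum_m y 0 l * y 0 m * g l m) ^+ 2)
   (@gtot R n * (4^-1 * ((\sum_l g l l) ^+ 2 + 2 * \sum_l \sum_m g l m ^+ 2))).
Proof.
move=> gC; rewrite -(wick4 gC) mulr_sumr.
apply: eq_has_gint (has_gint_sum (index_enum _) _); last first.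
  move=> l; rewrite mulr_sumr; apply: has_gint_sum => m.
  rewrite mulr_sumr; apply: has_gint_sum => r.
  rewrite mulr_sumr; apply: has_gint_sum => s.
  rewrite mulrCA; apply: has_gintZ; rewrite mulrA; exact: (has_gint_coord4 l m r s).
move=> y /=; rewrite expr2 mulr_suml; apply: eq_bigr => l _.
rewrite mulr_suml; apply: eq_bigr => m _.
rewrite mulr_sumr; apply: eq_bigr => r _.
by rewrite mulr_sumr; apply: eq_bigr => s _; ring.
Qed.

End GaussianForms.

Section QuadraticMoments.
Context {R : realType} {n k : nat}.
Variables (f : 'rV[R]_n -> 'rV[R]_k).
Local Notation h := (hess f).
Implicit Types y : 'rV[R]_n.

Lemma measurable_grad_lin i a : measurable_fun setT (grad_lin f i a).
Proof.
apply: measurable_sum => l; apply: measurable_funM => //; exact: measurable_coord.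
Qed.

Lemma measurable_half_quad a : measurable_fun setT (half_quad f a).
Proof.
apply: measurable_funM => //.
apply: measurable_sum => l; apply: measurable_sum => m.
apply: measurable_funM => //; apply: measurable_funM; exact: measurable_coord.
Qed.

Lemma measurable_quad2 : measurable_fun setT (quad2 f).
Proof.
apply: measurable_sum => i; apply: measurable_sum => a.
by apply: measurable_funX; exact: measurable_grad_lin.
Qed.

Lemma measurable_quad4 : measurable_fun setT (quad4 f).
Proof.
apply: measurable_sum => a.
by apply: measurable_funX; exact: measurable_half_quad.
Qed.

Lemma quad2_ge0 y : 0 <= quad2 f y.
Proof. by apply: sumr_ge0 => i _; apply: sumr_ge0 => a _; exact: sqr_ge0. Qed.

Lemma quad4_ge0 y : 0 <= quad4 f y.
Proof. by apply: sumr_ge0 => a _; exact: sqr_ge0. Qed.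

Lemma quad2Z (c : R) y : quad2 f (c *: y) = c ^+ 2 * quad2 f y.
Proof.
rewrite /quad2 mulr_sumr; apply: eq_bigr => i _.
rewrite mulr_sumr; apply: eq_bigr => a _.
rewrite -exprMn; congr (_ ^+ 2); rewrite /grad_lin mulr_sumr.
by apply: eq_bigr => l _; rewrite mxE mulrA.
Qed.

Lemma quad4Z (c : R) y : quad4 f (c *: y) = c ^+ 4 * quad4 f y.
Proof.
rewrite /quad4 mulr_sumr; apply: eq_bigr => a _.
rewrite -[4%N]/(2 * 2)%N exprM -exprMn; congr (_ ^+ 2).
rewrite /half_quad mulrCA; congr (_ * _); rewrite mulr_sumr.
apply: eq_bigr => l _; rewrite mulr_sumr; apply: eq_bigr => m _.
by rewrite !mxE mulrACA -expr2 !mulrA.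
Qed.

Lemma norm_coord_le_enorm y i : `|y 0 i| <= enorm y.
Proof.
rewrite -(ler_pXn2r (n := 2))// ?nnegrE ?sqrtr_ge0//.
by rewrite enorm_sqr real_normK ?num_real// sqr_coord_le_dotp.
Qed.

Lemma quad2_bound : exists2 K : R, 0 <= K & forall y, quad2 f y <= K * dotp y y.
Proof.
exists (\sum_i \sum_a (\sum_l `|h l i a|) ^+ 2).
  by apply: sumr_ge0 => i _; apply: sumr_ge0 => a _; exact: sqr_ge0.
move=> y; rewrite mulr_suml; apply: ler_sum => i _.
rewrite mulr_suml; apply: ler_sum => a _.
rewrite -enorm_sqr -exprMn -[leLHS]real_normK ?num_real//.
rewrite ler_pXn2r ?nnegrE// ?mulr_ge0 ?sqrtr_ge0 ?sumr_ge0//.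
rewrite mulr_suml (le_trans (ler_norm_sum _ _ _))//.
apply: ler_sum => l _; rewrite normrM mulrC ler_wpM2l//.
exact: norm_coord_le_enorm.
Qed.

Lemma quad4_bound : exists2 K : R, 0 <= K & forall y, quad4 f y <= K * dotp y y ^+ 2.
Proof.
exists (\sum_a (2^-1 * \sum_l \sum_m `|h l m a|) ^+ 2).
  by apply: sumr_ge0 => a _; exact: sqr_ge0.
move=> y; rewrite mulr_suml; apply: ler_sum => a _.
rewrite -exprMn -[leLHS]real_normK ?num_real//.
have S0 : 0 <= \sum_l \sum_m `|h l m a| by apply: sumr_ge0 => l _; exact: sumr_ge0.
rewrite ler_pXn2r ?nnegrE// ?mulr_ge0 ?dotp_ge0//.
rewrite normrM ger0_norm// -mulrA ler_wpM2l// mulr_suml (le_trans (ler_norm_sum _ _ _))//.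
apply: ler_sum => l _; rewrite mulr_suml (le_trans (ler_norm_sum _ _ _))//.
apply: ler_sum => m _; rewrite normrM mulrC ler_wpM2l//.
by rewrite -enorm_sqr expr2 normrM ler_pM ?norm_coord_le_enorm.
Qed.

Lemma has_gint_quad2 :
  has_gint (quad2 f) (@gtot R n * ((\sum_i \sum_l \sum_a h i l a ^+ 2) / 2)).
Proof.
have := has_gint_sum (index_enum _) (fun i => has_gint_sum (index_enum _)
  (fun a => has_gint_linear_sqr (fun l => h l i a))).
suff -> : \sum_i \sum_a @gtot R n * (2^-1 * \sum_l h l i a ^+ 2)
    = @gtot R n * ((\sum_i \sum_l \sum_a h i l a ^+ 2) / 2) by [].
rewrite [X in X / 2]exchange_big mulr_suml mulr_sumr; apply: eq_bigr => i _.
rewrite exchange_big mulr_suml mulr_sumr; apply: eq_bigr => a _.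
by congr (_ * _); exact: mulrC.
Qed.

Hypothesis hC : forall i j a, h i j a = h j i a.

(** The denominator 16 is the square of the 2 in [half_quad] times the 4 of [wick4]. *)
Lemma has_gint_quad4 : has_gint (quad4 f)
  (@gtot R n * ((\sum_a (\sum_i h i i a) ^+ 2 + 2 * \sum_i \sum_l \sum_a h i l a ^+ 2) / 16)).
Proof.
have := has_gint_sum (index_enum _) (fun a => has_gintZ 4^-1 (has_gint_quadratic_sqr (fun l m => hC l m a))).
have -> : (fun y => \sum_a 4^-1 * (\sum_l \sum_m y 0 l * y 0 m * h l m a) ^+ 2) = quad4 f.
  apply/funext => y; apply: eq_bigr => a _; rewrite /half_quad exprMn; congr (_ * _).
  by rewrite exprVn -natrX.
suff -> : \sum_a 4^-1 * (@gtot R n * (4^-1 * ((\sum_l h l l a) ^+ 2 + 2 * \sum_l \sum_m h l m a ^+ 2)))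
    = @gtot R n * ((\sum_a (\sum_i h i i a) ^+ 2 + 2 * \sum_i \sum_l \sum_a h i l a ^+ 2) / 16) by [].
have -> : \sum_i \sum_l \sum_a h i l a ^+ 2 = \sum_a \sum_i \sum_l h i l a ^+ 2.
  rewrite [RHS]exchange_big; apply: eq_bigr => i _; exact: exchange_big.
rewrite [X in _ + X]mulr_sumr -big_split mulr_suml mulr_sumr; apply: eq_bigr => a _ /=.
by move: (_ + _) gtot => u v; field.
Qed.

End QuadraticMoments.

(** * Expansion of the volume *)
Section PowerExpansion.
Context {R : realType} {T : Type} (F : set_system T) {FF : Filter F} (N : T -> R).
Hypothesis N01 : \forall x \near F, 0 <= N x <= 1.
Local Notation O := (order_ge F N).

Lemma order_ge_expn_1D d a m : O d a -> O d (fun x => (1 + a x) ^+ m - 1).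
Proof.
move=> aO; elim: m => [|m IHm].
  apply: (@eq_order_ge _ _ _ _ _ _ (fun=> 0)); last exact: order_ge0.
  by move=> x; rewrite expr0 subrr.
apply: (@eq_order_ge _ _ _ _ _ _ (fun x => (1 + a x) * ((1 + a x) ^+ m - 1) + a x)).
  by move=> x; rewrite exprS; ring.
apply: order_geD => //; rewrite -[d]add0n; apply: order_geM => //.
apply: order_geD; first exact: order_ge_cst.
by apply: (@order_ge_le _ _ _ _ _ N01 0 d).
Qed.

Lemma order_ge_expn_gauge d : O d (fun x => N x ^+ d).
Proof.
exists 1 => //; near=> x; have /andP[n0 _] : 0 <= N x <= 1 by near: x.
by rewrite mul1r ger0_norm// exprn_ge0.
Unshelve. all: by end_near. Qed.

(** Common shape of the lower and upper bounds for the volume: [c] is the error of the density, [e]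
    that of the radius, [B1] and [B2] the remainders in [t]. None of them is felt below order 3. *)
Lemma order_ge_volume_expansion (n : nat) (c e b m B1 B2 : R) :
  O 3 (fun x => (1 + c * N x ^+ 3) * (1 + e * N x ^+ 3) ^+ n * (1 - N x ^+ 2 * b + N x ^+ 4 * B1)
     + (1 + e * N x ^+ 3) ^+ (n + 2) * (N x ^+ 2 * (m - N x ^+ 2 * B2))
     - 1 - N x ^+ 2 * (m - b)).
Proof.
have G d : O d (fun x => N x ^+ d) := order_ge_expn_gauge d.
have cst d e' (u : T -> R) : (d <= e')%N -> O e' u -> O d u.
  by move=> de; exact: (@order_ge_le _ _ _ _ _ N01 d e').
have pow d : O 3 (fun x => (1 + e * N x ^+ 3) ^+ d - 1).
  by apply: order_ge_expn_1D; exact: order_geZ.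
have P : O 3 (fun x => (1 + c * N x ^+ 3) * (1 + e * N x ^+ 3) ^+ n - 1).
  apply: (@eq_order_ge _ _ _ _ _ _ (fun x =>
     (1 + c * N x ^+ 3) * ((1 + e * N x ^+ 3) ^+ n - 1) + c * N x ^+ 3)).
    by move=> x; move: (_ ^+ n) => u; ring.
  apply: order_geD; last exact: order_geZ.
  apply: (@order_geM _ _ _ _ _ 0 3) => //.
  by apply: order_geD; [exact: order_ge_cst|apply: (cst 0 3) => //; exact: order_geZ].
have Q : O 0 (fun x => 1 - N x ^+ 2 * b + N x ^+ 4 * B1).
  apply: order_geD; first apply: order_geB; first exact: order_ge_cst.
    by apply: (order_geM (d := 0) (e := 0)); [exact: cst (G 2)|exact: order_ge_cst].
  by apply: (order_geM (d := 0) (e := 0)); [exact: cst (G 4)|exact: order_ge_cst].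
have S : O 0 (fun x => N x ^+ 2 * (m - N x ^+ 2 * B2)).
  apply: (order_geM (d := 0) (e := 0)); first exact: cst (G 2).
  apply: order_geB; first exact: order_ge_cst.
  by apply: (order_geM (d := 0) (e := 0)); [exact: cst (G 2)|exact: order_ge_cst].
(* What remains of the two main factors together once [1 + N x ^+ 2 * (m - b)] is removed. *)
have X : O 3 (fun x => (B1 - B2) * N x ^+ 4) by apply: order_geZ; exact: cst (G 4).
apply: eq_order_ge (order_geD (order_geD (order_geM (d := 3) (e := 0) P Q)
  (order_geM (d := 3) (e := 0) (pow (n + 2)) S)) X) => x /=.
move: (_ ^+ n) => u; move: (_ ^+ (n + 2)) => v; ring.
Qed.

End PowerExpansion.

(** * Squeezing the ball between sublevel sets of [Phi] *)

Section VolumeSandwich.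
Context {R : realType} {n : nat}.
Variables (q4 q2 : 'rV[R]_n -> R) (K a4 a2 : R).
Hypothesis mq4 : measurable_fun setT q4.
Hypothesis mq2 : measurable_fun setT q2.
Hypothesis q4_ge0 : forall y, 0 <= q4 y.
Hypothesis q2_ge0 : forall y, 0 <= q2 y.
Hypothesis q4Z : forall (c : R) y, 0 < c -> q4 (c *: y) = c ^+ 4 * q4 y.
Hypothesis q2Z : forall (c : R) y, 0 < c -> q2 (c *: y) = c ^+ 2 * q2 y.
Hypothesis K_ge0 : 0 <= K.
Hypothesis q4_le : forall y, q4 y <= K * dotp y y ^+ 2.
Hypothesis q2_le : forall y, q2 y <= K * dotp y y.
Hypothesis gq4 : has_gint q4 (@gtot R n * a4).
Hypothesis gq2 : has_gint q2 (@gtot R n * a2).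

Variables (B : set 'rV[R]_n) (w dens : 'rV[R]_n -> R) (C delta : R).
Hypothesis w_ge0 : forall x, 0 <= w x.
Hypothesis dens_ge0 : forall x, 0 <= dens x.
Hypothesis C_ge0 : 0 <= C.
Hypothesis delta_gt0 : 0 < delta.
Hypothesis near0 : forall x, enorm x < delta -> [/\ B x,
  `|w x - q4 x| <= C * enorm x ^+ 5 &
  `|dens x - (1 + q2 x / 2)| <= C * enorm x ^+ 3].

Local Notation Ph := (Phi q4).
Let A (eps : R) : set 'rV[R]_n := [set x | B x /\ dotp x x + w x <= eps ^+ 2].
Hypothesis mA : forall eps, measurable (A eps).
Hypothesis mdens : forall eps, measurable_fun (A eps) dens.

(** [C] bounds the error in replacing [w] by [q4], and [K ^+ 2] the term [hom2 * q4] of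
    [Phi_identity]. *)
Let L := C + K ^+ 2.

Let L_ge0 : 0 <= L. Proof. by rewrite addr_ge0// sqr_ge0. Qed.

Lemma enorm_ge0 (x : 'rV[R]_n) : 0 <= enorm x. Proof. exact: sqrtr_ge0. Qed.

Lemma Phi_identity eps x : Ph (eps ^+ 2) x - eps ^+ 2 =
  (dotp x x + q4 x - eps ^+ 2) * (1 - hom2 q4 x) + hom2 q4 x * q4 x.
Proof.
rewrite /Phi; have := hom2_dotp q4_ge0 q4_le x.
move: (hom2 q4 x) (dotp x x) (q4 x) => u v z <-; ring.
Qed.

Lemma sublevel_enorm_le eps (x : 'rV[R]_n) : 0 <= eps -> dotp x x <= eps ^+ 2 -> enorm x <= eps.
Proof. by move=> e0; rewrite -enorm_sqr ler_pXn2r ?nnegrE ?enorm_ge0. Qed.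

(** The factor [1 - hom2] of [Phi_identity] lies in []0, 1]], so multiplying or dividing by it
    preserves the sign. The natural bound [eps ^+ 6] on [hom2 * q4] is weakened to [eps ^+ 5] to
    match the error of [w]. *)
Let small eps (x : 'rV[R]_n) : 0 < eps <= 1 -> K * eps ^+ 2 < 1 -> enorm x <= eps ->
  [/\ 0 <= hom2 q4 x < 1, 0 <= hom2 q4 x * q4 x <= K ^+ 2 * eps ^+ 5
    & C * enorm x ^+ 5 <= C * eps ^+ 5].
Proof.
move=> /andP[e0 e1] Ke xe.
have s_le : dotp x x <= eps ^+ 2.
  by rewrite -enorm_sqr ler_pXn2r ?nnegrE ?enorm_ge0// ltW.
have h0 := hom2_ge0 q4_ge0 x; have hK := hom2_le q4_le x.
have he : hom2 q4 x <= K * eps ^+ 2 by apply: le_trans hK _; rewrite ler_wpM2l.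
split; first by rewrite h0 (le_lt_trans he).
  rewrite mulr_ge0//= (le_trans (ler_pM h0 (q4_ge0 x) he (q4_le x)))//.
  rewrite (_ : K ^+ 2 * eps ^+ 5 = K * (eps ^+ 2) * (K * eps ^+ 3)); last by ring.
  have Ke0 : 0 <= K * eps ^+ 2 by rewrite mulr_ge0 ?sqr_ge0.
  rewrite ler_wpM2l// ler_wpM2l//.
  apply: (@le_trans _ _ ((eps ^+ 2) ^+ 2)).
    by rewrite ler_pXn2r ?nnegrE ?sqr_ge0 ?dotp_ge0.
  by rewrite -exprM ler_wiXn2l// ltW.
by rewrite ler_wpM2l// ler_pXn2r ?nnegrE ?enorm_ge0// ltW.
Qed.

Lemma sublevel_outer eps : 0 < eps <= 1 -> K * eps ^+ 2 < 1 -> eps < delta ->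
  A eps `<=` [set x | Ph (eps ^+ 2) x <= (eps * (1 + L * eps ^+ 3)) ^+ 2].
Proof.
move=> e01 Ke ed x [Bx xA] /=.
have /andP[e0 e1] := e01.
have xe : enorm x <= eps.
  by apply: sublevel_enorm_le; [exact: ltW|apply: le_trans xA; rewrite lerDl].
have [/andP[h0 h1] /andP[hq0 hq] Ce] := small e01 Ke xe.
have [_ wq _] := near0 (le_lt_trans xe ed).
have := Phi_identity eps x; move: wq xA; rewrite ler_norml => /andP[wq1 wq2] xA PE.
have S : dotp x x + q4 x - eps ^+ 2 <= C * eps ^+ 5 by lra.
have M : (dotp x x + q4 x - eps ^+ 2) * (1 - hom2 q4 x) <= C * eps ^+ 5.
  have : 0 <= C * eps ^+ 5 by rewrite mulr_ge0// exprn_ge0// ltW.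
  by move: S h0 h1; move: (_ - eps ^+ 2) (hom2 _ _) (C * _) => u v z *; nra.
(* Squaring the enlarged radius yields [2 * L * eps ^+ 5], twice the excess to be covered. *)
apply: (@le_trans _ _ (eps ^+ 2 + L * eps ^+ 5)); first by rewrite /L mulrDl; lra.
rewrite (_ : (_ * _) ^+ 2 = eps ^+ 2 + L * eps ^+ 5 + (L * eps ^+ 5 + (L * eps ^+ 4) ^+ 2)); last by ring.
by rewrite lerDl addr_ge0 ?sqr_ge0// mulr_ge0// exprn_ge0// ltW.
Qed.

Lemma sublevel_inner eps : 0 < eps <= 1 -> K * eps ^+ 2 < 1 -> eps < delta ->
  L * eps ^+ 3 <= 1 ->
  [set x | Ph (eps ^+ 2) x <= (eps * (1 - L * eps ^+ 3)) ^+ 2] `<=` A eps.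
Proof.
move=> e01 Ke ed Le x /= xP.
have /andP[e0 e1] := e01.
have e3 : 0 <= L * eps ^+ 3 by rewrite mulr_ge0// exprn_ge0// ltW.
have ce : (eps * (1 - L * eps ^+ 3)) ^+ 2 <= eps ^+ 2 - L * eps ^+ 5.
  rewrite (_ : (_ * _) ^+ 2 = eps ^+ 2 - L * eps ^+ 5 - L * eps ^+ 5 * (1 - L * eps ^+ 3)); last by ring.
  by rewrite lerBlDr lerDl mulr_ge0 ?subr_ge0// mulr_ge0// exprn_ge0// ltW.
have e5 : 0 <= eps ^+ 5 by rewrite exprn_ge0// ltW.
have Le5 : 0 <= L * eps ^+ 5 by rewrite mulr_ge0.
(* Membership in [A eps] is not yet known, so the bound on [x] comes from [dotp x x <= Phi]. *)
have sx : dotp x x <= eps ^+ 2.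
  apply: (@le_trans _ _ (Ph (eps ^+ 2) x)).
    by rewrite /Phi lerDl mulr_ge0 ?sqr_ge0// hom2_ge0.
  by lra.
have xe : enorm x <= eps by apply: sublevel_enorm_le => //; exact: ltW.
have [/andP[h0 h1] /andP[hq0 hq] Ce] := small e01 Ke xe.
have [Bx wq _] := near0 (le_lt_trans xe ed).
split=> //.
have := Phi_identity eps x; move: wq; rewrite ler_norml => /andP[wq1 wq2] PE.
have M : (dotp x x + q4 x - eps ^+ 2) * (1 - hom2 q4 x) <= - (L * eps ^+ 5) by lra.
(* Dividing a nonpositive quantity by a factor in []0, 1]] can only lower it. *)
have S : dotp x x + q4 x - eps ^+ 2 <= - (L * eps ^+ 5).
  move: M h0 h1 Le5; move: (_ - eps ^+ 2) (hom2 _ _) (L * _) => u v z *; nra.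
have : C * eps ^+ 5 <= L * eps ^+ 5 by rewrite ler_wpM2r// lerDl sqr_ge0.
by lra.
Qed.


(** [om] is the volume of the unit ball. Relative to it, and per unit of [eps ^+ 2], [b] is the
    volume lost to the height of the graph and [m] the gain from its density. *)
Let om := @gtot R n / Gamma (n%:R / 2 + 1).
Let b := a4 / (n%:R / 2 + 1).
Let m := 2^-1 * (a2 / (n%:R / 2 + 1)).

Let om_gt0 : 0 < om.
Proof. by rewrite /om divr_gt0 ?gtot_gt0//; exact: Gamma_half_gt0. Qed.

Let measurable_sub t (c : R) : measurable [set x | Ph t x <= c].
Proof.
rewrite -[X in measurable X]setTI.
have := measurable_Phi mq4 t measurableT (measurable_itv `]-oo, c]).
by rewrite (_ : _ @^-1` _ = [set x | Ph t x <= c])//; apply/seteqP; split => x; rewrite /= in_itv.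
Qed.

Let integral_affine t c kappa : 0 <= t -> 0 < c -> 0 <= kappa ->
  (\int[lebesgue_rV n]_(x in [set x | (Ph t x <= c ^+ 2)%R]) (kappa + q2 x / 2)%:E =
   kappa%:E * ((c ^+ n)%:E * \int[lebesgue_rV n]_(x in [set x | (Ph t x <= 1)%R]) 1%:E) +
   (2^-1)%:E * ((c ^+ (n + 2))%:E * \int[lebesgue_rV n]_(x in [set x | (Ph t x <= 1)%R]) (q2 x)%:E))%E.
Proof.
move=> t0 c0 k0.
have [<- <-] := integral_Phi_sublevel mq4 mq2 q2_ge0 q4Z q2Z t0 c0.
rewrite -!ge0_integralZl//.
- rewrite -ge0_integralD//.
  + by apply: eq_integral => x _; rewrite -!EFinM -EFinD mulr1 [q2 x / 2]mulrC.
  + by move=> x _; rewrite mule1 lee_fin.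
  + by move=> x _; rewrite -EFinM lee_fin mulr_ge0.
  + apply/measurable_EFinP; apply: measurable_funM => //; exact: measurable_funS mq2.
- by apply/measurable_EFinP; exact: measurable_funS mq2.
- by move=> x _; rewrite lee_fin.
Qed.

Lemma volume_expansion : exists r : R -> R,
  order_ge (0 : R)^'+ id 3 r /\
  \forall eps \near (0 : R)^'+,
    (\int[lebesgue_rV n]_(x in A eps) (dens x)%:E)%E =
    (om * eps ^+ n * (1 + eps ^+ 2 * (m - b) + r eps))%:E.
Proof.
have [Bv Bv0 vol_b] := sublevel_volume mq4 q4_ge0 q4Z K_ge0 q4_le gq4.
have [Bm Bm0 mom_b] := sublevel_moment mq4 mq2 q4_ge0 q2_ge0 q4Z q2Z q4_le q2_le gq2.
pose B2 := 2^-1 / (n%:R / 2 + 1) * Bm.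
have n2 : 0 < n%:R / 2 + 1 :> R by rewrite ltr_wpDl// divr_ge0.
pose I eps := (\int[lebesgue_rV n]_(x in A eps) (dens x)%:E)%E.
(* The parameters are [- C], [- L] below and [C], [L] above. A zero stands in for [B1] below and for
   [B2] above, since [sublevel_volume] and [sublevel_moment] have no remainder on those sides. *)
pose W c e B1 B2 eps : R := (1 + c * eps ^+ 3) * (1 + e * eps ^+ 3) ^+ n *
    (1 - eps ^+ 2 * b + eps ^+ 4 * B1)
     + (1 + e * eps ^+ 3) ^+ (n + 2) * (eps ^+ 2 * (m - eps ^+ 2 * B2)).
have sandwich : \forall eps \near (0 : R)^'+,
   [/\ 0 < eps, I eps \is a fin_num & om * eps ^+ n * W (- C) (- L) 0 B2 eps
     <= fine (I eps) <= om * eps ^+ n * W C L Bv 0 eps].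
  near=> eps.
  have e0 : 0 < eps by near: eps; exact: nbhs_right_gt.
  have e1 : eps <= 1 by near: eps; apply: nbhs_right_le.
  have ed : eps < delta by near: eps; apply: nbhs_right_lt.
  have sm (k : R) : 0 <= k -> eps < (k + 1)^-1 -> k * eps < 1.
    move=> k0 ek; apply: (@le_lt_trans _ _ ((k + 1) * eps)).
      by rewrite ler_wpM2r ?lerDl// ltW.
    by rewrite mulrC -ltr_pdivlMr ?div1r// ltr_wpDl.
  have sm' (k : R) j : 0 <= k -> eps < (k + 1)^-1 -> k * eps ^+ j.+1 < 1.
    move=> k0 ek; apply: le_lt_trans (sm k k0 ek).
    by rewrite ler_wpM2l// exprS ler_piMr ?exprn_ile1// ltW.
  have Ke : K * eps ^+ 2 < 1.
    by apply: sm' => //; near: eps; apply: nbhs_right_lt; rewrite invr_gt0 ltr_wpDl.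
  have Le : L * eps ^+ 3 < 1.
    by apply: sm' => //; near: eps; apply: nbhs_right_lt; rewrite invr_gt0 ltr_wpDl.
  have Ce : C * eps ^+ 3 < 1.
    by apply: sm' => //; near: eps; apply: nbhs_right_lt; rewrite invr_gt0 ltr_wpDl.
  have e01 : 0 < eps <= 1 by rewrite e0.
  have t0 : 0 <= eps ^+ 2 by exact: sqr_ge0.
  have [v0 [Ev0 /andP[v0l v0u]]] := vol_b _ t0.
  have [v2 [Ev2 /andP[v2l v2u]]] := mom_b _ t0.
  pose c1 := eps * (1 + L * eps ^+ 3); pose c2 := eps * (1 - L * eps ^+ 3).
  have c10 : 0 < c1.
    by rewrite mulr_gt0// ltr_wpDr// mulr_ge0// exprn_ge0// ltW.
  have c20 : 0 < c2 by rewrite mulr_gt0// subr_gt0.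
  have k10 : 0 <= 1 + C * eps ^+ 3 by rewrite addr_ge0// mulr_ge0// exprn_ge0// ltW.
  have k20 : 0 <= 1 - C * eps ^+ 3 by rewrite subr_ge0 ltW.
  have int c kappa : 0 < c -> 0 <= kappa ->
     (\int[lebesgue_rV n]_(x in [set x | (Ph (eps ^+ 2) x <= c ^+ 2)%R]) (kappa + q2 x / 2)%:E
      = (kappa * (c ^+ n * v0) + 2^-1 * (c ^+ (n + 2) * v2))%:E)%E.
    by move=> c0 ka0; rewrite integral_affine// Ev0 Ev2 -!EFinM -EFinD.
  have maff D kappa : measurable_fun D (fun x => (kappa + q2 x / 2)%:E).
    by apply/measurable_EFinP; apply: measurable_funD => //; apply: measurable_funM => //;
      exact: measurable_funTS.
  have densC x : A eps x -> `|dens x - (1 + q2 x / 2)| <= C * eps ^+ 3.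
    move=> [Bx xA]; have xe : enorm x <= eps.
      by apply: sublevel_enorm_le; [exact: ltW|apply: le_trans xA; rewrite lerDl].
    have [_ _ dx] := near0 (le_lt_trans xe ed); apply: le_trans dx _.
    by rewrite ler_wpM2l// ler_pXn2r ?nnegrE ?enorm_ge0// ltW.
  have up : (I eps <= ((1 + C * eps ^+ 3) * (c1 ^+ n * v0) + 2^-1 * (c1 ^+ (n + 2) * v2))%:E)%E.
    rewrite -int//.
    have Asub := sublevel_outer e01 Ke ed.
    apply: (@le_trans _ _ (\int[lebesgue_rV n]_(x in A eps) (1 + C * eps ^+ 3 + q2 x / 2)%:E)%E).
      apply: ge0_le_integral => //.
      - by move=> x _; rewrite lee_fin.
      - by apply/measurable_EFinP; exact: mdens.
      - by move=> x /densC; rewrite ler_norml lee_fin => /andP[_ ?]; lra.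
    apply: ge0_subset_integral => //.
    - by move=> x _; rewrite lee_fin addr_ge0// divr_ge0.
  have lo : (((1 - C * eps ^+ 3) * (c2 ^+ n * v0) + 2^-1 * (c2 ^+ (n + 2) * v2))%:E <= I eps)%E.
    rewrite -int//.
    have Asub := sublevel_inner e01 Ke ed (ltW Le).
    apply: (@le_trans _ _ (\int[lebesgue_rV n]_(x in [set x | (Ph (eps ^+ 2) x <= c2 ^+ 2)%R]) (dens x)%:E)%E).
      apply: ge0_le_integral => //.
      - by move=> x _; rewrite lee_fin addr_ge0// divr_ge0.
      - by apply/measurable_EFinP; exact: measurable_funS (mA eps) Asub (@mdens eps).
      - by move=> x /Asub/densC; rewrite ler_norml lee_fin => /andP[? _]; lra.
    apply: ge0_subset_integral => //.
    - by apply/measurable_EFinP; exact: mdens.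
    - by move=> x _; rewrite lee_fin.
  have If : I eps \is a fin_num.
    by move: up lo; case: (I eps).
  split=> //; move: up lo; rewrite -(fineK If) !lee_fin => up lo; apply/andP; split.
  - apply: le_trans lo; rewrite /W.
    have -> : om * eps ^+ n * ((1 + - C * eps ^+ 3) * (1 + - L * eps ^+ 3) ^+ n *
       (1 - eps ^+ 2 * b + eps ^+ 4 * 0) + (1 + - L * eps ^+ 3) ^+ (n + 2) *
          (eps ^+ 2 * (m - eps ^+ 2 * B2)))
      = (1 - C * eps ^+ 3) * (c2 ^+ n * (om * (1 - eps ^+ 2 * b))) +
        2^-1 * (c2 ^+ (n + 2) * (om / (n%:R / 2 + 1) * (a2 - eps ^+ 2 * Bm))).
      rewrite /c2 !exprMn !mulNr [eps ^+ (n + 2)]exprD /B2 /m.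
      move: (eps ^+ n) ((1 - L * eps ^+ 3) ^+ n) ((1 - L * eps ^+ 3) ^+ (n + 2)) => u v z.
      by move: om b => om' b'; move: (n%:R / 2 + 1) n2 => n' n20; field; rewrite gt_eqF.
    apply: lerD; first by rewrite ler_wpM2l// ler_wpM2l// exprn_ge0// ltW.
    by rewrite ler_wpM2l// ler_wpM2l// exprn_ge0// ltW.
  - apply: le_trans up _; rewrite /W.
    have -> : om * eps ^+ n * ((1 + C * eps ^+ 3) * (1 + L * eps ^+ 3) ^+ n *
       (1 - eps ^+ 2 * b + eps ^+ 4 * Bv) + (1 + L * eps ^+ 3) ^+ (n + 2) *
          (eps ^+ 2 * (m - eps ^+ 2 * 0)))
      = (1 + C * eps ^+ 3) * (c1 ^+ n * (om * (1 - eps ^+ 2 * b + (eps ^+ 2) ^+ 2 * Bv))) +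
        2^-1 * (c1 ^+ (n + 2) * (om / (n%:R / 2 + 1) * a2)).
      rewrite /c1 !exprMn [eps ^+ (n + 2)]exprD /m.
      move: (eps ^+ n) ((1 + L * eps ^+ 3) ^+ n) ((1 + L * eps ^+ 3) ^+ (n + 2)) => u v z.
      by move: om b => om' b'; move: (n%:R / 2 + 1) n2 => n' n20; field; rewrite gt_eqF.
    apply: lerD; first by rewrite ler_wpM2l// ler_wpM2l// exprn_ge0// ltW.
    by rewrite ler_wpM2l// ler_wpM2l// exprn_ge0// ltW.
(* Solving the expansion for [r] makes it exact; both bounds have the same terms up to order 2,
   which confines [r] to order 3. *)
pose r eps := fine (I eps) / (om * eps ^+ n) - 1 - eps ^+ 2 * (m - b).
have N01 : \forall x \near (0 : R)^'+, 0 <= id x <= 1.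
  near=> x; apply/andP; split; first by near: x; exact: nbhs_right_ge.
  by near: x; exact: nbhs_right_le.
have [C1 C10 H1] := order_ge_volume_expansion N01 n (- C) (- L) b m 0 B2.
have [C2 C20 H2] := order_ge_volume_expansion N01 n C L b m Bv 0.
exists r; split.
  exists (C1 + C2); first by rewrite addr_ge0.
  near=> eps; have [e0 _ /andP[lo up]] : [/\ 0 < eps, I eps \is a fin_num &
     om * eps ^+ n * W (- C) (- L) 0 B2 eps <= fine (I eps) <= om * eps ^+ n * W C L Bv 0 eps].
    by near: eps.
  have d0 : 0 < om * eps ^+ n by rewrite mulr_gt0// exprn_gt0.
  have lo' : W (- C) (- L) 0 B2 eps <= fine (I eps) / (om * eps ^+ n).
    by rewrite ler_pdivlMr// mulrC.
  have up' : fine (I eps) / (om * eps ^+ n) <= W C L Bv 0 eps.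
    by rewrite ler_pdivrMr// mulrC.
  have b1 : `|W (- C) (- L) 0 B2 eps - 1 - eps ^+ 2 * (m - b)| <= C1 * eps ^+ 3.
    by near: eps; exact: H1.
  have b2 : `|W C L Bv 0 eps - 1 - eps ^+ 2 * (m - b)| <= C2 * eps ^+ 3.
    by near: eps; exact: H2.
  have p1 : 0 <= C1 * eps ^+ 3 by rewrite mulr_ge0// exprn_ge0// ltW.
  have p2 : 0 <= C2 * eps ^+ 3 by rewrite mulr_ge0// exprn_ge0// ltW.
  rewrite /r [leRHS]mulrDl; move: lo' up' b1 b2 p1 p2.
  move: (W _ _ _ _ _) (W _ _ _ _ _) (_ / (om * _)) (eps ^+ 2 * _) (C1 * _) => u v z t y lo' up'.
  move: (C2 * _) => x.
  rewrite !ler_norml => /andP[? ?] /andP[? ?] ? ?; lra.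
near=> eps; have [e0 If _] : [/\ 0 < eps, I eps \is a fin_num &
     om * eps ^+ n * W (- C) (- L) 0 B2 eps <= fine (I eps) <= om * eps ^+ n * W C L Bv 0 eps].
  by near: eps.
rewrite -/(I eps) -(fineK If); congr (_%:E).
have d0 : om * eps ^+ n != 0 by rewrite gt_eqF// mulr_gt0// exprn_gt0.
rewrite /r; move: (_ * (m - b)) (fine _) (om * _) d0 => u v z z0.
by field.
Unshelve. all: by end_near. Qed.

End VolumeSandwich.

Lemma norm_le_enorm {R : realType} {n : nat} (x : 'rV[R]_n) : `|x| <= enorm x.
Proof.
rewrite [leLHS]/Num.Def.normr/= mx_normrE.
by apply: bigmax_le; [exact: enorm_ge0|move=> [i j] _ /=; rewrite (ord1 i); exact: norm_coord_le_enorm].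
Qed.

(** * The ball [D_p(eps)] read in the graph chart *)

Section GraphSublevel.
Context {R : realType} {n k : nat}.
Variables (p : 'rV[R]_(n + k)) (E : 'M[R]_(n, n + k)) (N : 'M[R]_(k, n + k))
  (f : 'rV[R]_n -> 'rV[R]_k) (B : set 'rV[R]_n).
Hypothesis EE : E *m E^T = 1%:M.
Hypothesis NN : N *m N^T = 1%:M.
Hypothesis EN : E *m N^T = 0.
Hypothesis Bopen : open B.
Hypothesis B0 : B 0.
Hypothesis fsmooth : smooth_on B f.
Hypothesis f0 : f 0 = 0.
Hypothesis Jf0 : 'J f 0 = 0.
Local Notation phi := (graph_map p E N f).

Definition graph_sublevel (eps : R) : set 'rV[R]_n :=
  [set x | B x /\ dotp x x + dotp (f x) (f x) <= eps ^+ 2].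

Lemma measurable_graph_sublevel eps : measurable (graph_sublevel eps).
Proof.
have cf a x : B x -> {for x, continuous (partial f [::] a)}.
  by move=> Bx; apply: differentiable_continuous; exact: (differentiable_partial fsmooth).
have mB : measurable B by exact: open_measurable_rV.
have mu : measurable_fun B (fun x => dotp x x + dotp (f x) (f x)).
  apply: measurable_funD; first exact: measurable_funTS measurable_dotp.
  rewrite (_ : (fun x => _) = fun x => \sum_a partial f [::] a x * partial f [::] a x); last first.
    by apply/funext => x; rewrite dotpE.
  apply: measurable_sum => a.
  have mf : measurable_fun B (partial f [::] a).
    exact: (measurable_fun_continuous_on Bopen (cf a)).
  exact: measurable_funM.
have := mu mB _ (measurable_itv `]-oo, eps ^+ 2]).
by rewrite (_ : _ `&` _ = graph_sublevel eps)//.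
Qed.

Lemma near_graph_bounds : exists (C delta : R), [/\ 0 <= C, 0 < delta &
  forall x, enorm x < delta -> [/\ B x,
   `|dotp (f x) (f x) - quad4 f x| <= C * enorm x ^+ 5 &
   `|volume_density phi x - (1 + quad2 f x / 2)| <= C * enorm x ^+ 3]].
Proof.
have [C1 C10 H1] := graph_height_order5 Bopen B0 fsmooth f0 Jf0.
have [C2 C20 H2] := volume_density_order3 p EE NN EN Bopen B0 fsmooth Jf0.
have H3 : \forall x \near (0 : 'rV[R]_n), B x by exact: near_B.
have /nbhs_norm0P[d /= d0 dP] : \forall x \near (0 : 'rV[R]_n), B x /\
   (`|dotp (f x) (f x) - quad4 f x| <= C1 * gauge0 x ^+ 5 /\
    `|volume_density phi x - (1 + quad2 f x / 2)| <= C2 * gauge0 x ^+ 3).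
  exact: filterI H3 (filterI H1 H2).
exists (C1 + C2), d; split=> //; first by rewrite addr_ge0.
move=> x xd; have [Bx [h1 h2]] := dP x (le_lt_trans (norm_le_enorm x) xd).
have le j : `|x| ^+ j <= enorm x ^+ j.
  by rewrite lerXn2r ?nnegrE ?enorm_ge0// norm_le_enorm.
split=> //; [apply: le_trans h1 _|apply: le_trans h2 _];
  by rewrite ler_pM ?lerDl ?lerDr ?exprn_ge0 ?le// /gauge0.
Qed.

(** Once the ball of radius [eps] around [p] lies inside [U], no part of [M] outside the graph can
    enter it. *)
Lemma spherical_component_graph (M U : set 'rV[R]_(n + k)) :
  open U -> U p -> M `&` U = phi @` B ->
  \forall eps \near (0 : R)^'+, spherical_component M p eps = phi @` graph_sublevel eps.
Proof.
move=> oU Up MU.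
have /nbhs_normP[rho /= rho0 rhoU] : nbhs p U by exact: open_nbhs_nbhs.
near=> eps.
have e0 : 0 < eps by near: eps; exact: nbhs_right_gt.
have er : eps < rho by near: eps; exact: nbhs_right_lt.
have enE x : (enorm (phi x - p) <= eps) = (dotp x x + dotp (f x) (f x) <= eps ^+ 2).
  rewrite (enorm_graph_map p f EE NN EN) -[eps in LHS]ger0_norm ?(ltW e0)// -sqrtr_sqr.
  by rewrite ler_sqrt// sqr_ge0.
apply/seteqP; split=> q.
  move=> [Mq /= qp].
  have : (M `&` U) q.
    split=> //; apply: rhoU; rewrite /ball_/= distrC.
    by apply: le_lt_trans (norm_le_enorm _) _; apply: le_lt_trans er.
  rewrite MU => -[x Bx xq]; exists x => //; split=> //.
  by rewrite -enE xq.
move=> [x [Bx xe] xq]; split; last by rewrite /= -xq enE.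
have : (phi @` B) q by exists x.
by rewrite -MU => -[].
Unshelve. all: by end_near. Qed.

End GraphSublevel.

Theorem proposition5p2 (R : realType) (n k : nat) (M : set 'rV[R]_(n + k))
    (vol : {measure set 'rV[R]_(n + k) -> \bar R}) (p : 'rV[R]_(n + k))
    (E : 'M[R]_(n, n + k)) (N : 'M[R]_(k, n + k)) (f : 'rV[R]_n -> 'rV[R]_k) :
  embedded_submanifold n M ->
  riemannian_measure n M vol ->
  M p ->
  graph_coordinates M p E N f ->
  let phi := graph_map p E N f in
  let trIII := trace_third_form phi 0 E N in
  let H := mean_curvature phi 0 E in
  let scal := scalar_curvature (metric phi) 0 in
  (exists r : R -> R,
     r =O_ (0^'+) (fun eps : R => eps ^+ 3) /\
     \forall eps \near 0^'+,
       vol (spherical_component M p eps) =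
         (ball_volume n eps *
          (1 + eps ^+ 2 / (8 * (n%:R + 2)) * (2 * trIII - enorm H ^+ 2)
           + r eps))%:E) /\
  2 * trIII - enorm H ^+ 2 = enorm H ^+ 2 - 2 * scal.
Proof.
move=> _ [_ volE] _ [EE NN EN [f0 Jf0] [B [U [[Bopen B0 oU Up] [fsmooth MU]]]]] phi trIII H scal.
split; last exact: (gauss_graph0 p EE NN EN Bopen B0 fsmooth Jf0).
have hC := hessC Bopen B0 fsmooth.
have [K4 K40 q4K] := quad4_bound f.
have [K2 K20 q2K] := quad2_bound f.
have [C [delta [C0 delta0 bounds]]] := near_graph_bounds p EE NN EN Bopen B0 fsmooth f0 Jf0.
(* [volume_expansion] takes one constant for both forms. *)
have q4_le y : quad4 f y <= (K4 + K2) * dotp y y ^+ 2.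
  by rewrite (le_trans (q4K y))// ler_wpM2r ?sqr_ge0// lerDl.
have q2_le y : quad2 f y <= (K4 + K2) * dotp y y.
  by rewrite (le_trans (q2K y))// ler_wpM2r ?dotp_ge0// lerDr.
have param := local_parametrization_graph EE EN Bopen fsmooth oU MU.
have subB eps : graph_sublevel f B eps `<=` B by move=> x [].
have mA := measurable_graph_sublevel Bopen fsmooth.
have mdens eps : measurable_fun (graph_sublevel f B eps) (volume_density phi).
  apply: (measurable_fun_continuous_on Bopen) => // x Bx.
  by rewrite /phi; exact (@continuous_volume_density _ _ _ p _ _ _ _ EE NN EN Bopen fsmooth x Bx).
have [r [rO volr]] := volume_expansion (measurable_quad4 f) (measurable_quad2 f)
  (quad4_ge0 f) (quad2_ge0 f) (fun c y _ => quad4Z f c y) (fun c y _ => quad2Z f c y)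
  (addr_ge0 K40 K20) q4_le q2_le (has_gint_quad4 hC) (has_gint_quad2 f)
  (fun x => dotp_ge0 (f x)) (fun x => sqrtr_ge0 _) C0 delta0 bounds mA mdens.
exists r; split.
  apply/eqO_exP; have [C1 C10 rC] := rO; exists (C1 + 1); first by rewrite ltr_wpDl.
  near=> eps; have e0 : 0 < eps by near: eps; exact: nbhs_right_gt.
  have : `|r eps| <= C1 * eps ^+ 3 by near: eps.
  have e3 : 0 <= eps ^+ 3 by rewrite exprn_ge0// ltW.
  by move=> /le_trans; apply; rewrite ger0_norm// ler_wpM2r// lerDl.
near=> eps.
have -> : spherical_component M p eps = phi @` graph_sublevel f B eps.
  by near: eps; exact: (spherical_component_graph EE NN EN oU Up MU).
rewrite (volE _ _ param _ (mA eps) (subB eps)).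
apply: etrans (near volr eps _) _; first by [].
(* Here [a2 = trIII / 2] and [a4 = (|H|^2 + 2 trIII) / 16], so [m - b = (a2 / 2 - a4) / (n / 2 + 1)]
   is the announced [(2 trIII - |H|^2) / (8 (n + 2))]. *)
rewrite ball_volumeE; congr (_ * (1 + _ + _))%:E.
rewrite /trIII /H (enorm_mean_curvature p EE NN EN Bopen B0 fsmooth Jf0).
rewrite (trace_third_form_graph0 p EE NN EN Bopen B0 fsmooth Jf0).
move: (\sum_a _ ^+ 2) (\sum_i _) => u v.
have n0 : 0 < n%:R + 2 :> R by rewrite ltr_wpDl.
have -> : n%:R / 2 + 1 = (n%:R + 2) / 2 :> R by field.
by move: (n%:R + 2) n0 => n' n0; field; rewrite gt_eqF.
Unshelve. all: by end_near. Qed.
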